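(* Let $\bullet$ and $\circ$ denote the generating associative multiplications of two copies $\mathcal{P}_1=\mathcal{A}ss$ (operation $\bullet$) and $\mathcal{P}_2=\mathcal{A}ss$ (operation $\circ$) of the associative operad. Consider the rewrite rules \[ \begin{array}{lll} (a) & (x\circ y)\bullet z = 0, & x\bullet(y\circ z)=0;\\ (b) & (x\circ y)\bullet z = 0, & x\bullet(y\circ z)=(x\bullet y)\circ z;\\ (c) & (x\circ y)\bullet z = x\circ(y\bullet z), & x\bullet(y\circ z)=0;\\ (d) & (x\circ y)\bullet z = x\circ(y\bullet z), & x\bullet(y\circ z)=(x\bullet y)\circ z;\\ (e) & (x\circ y)\bullet z = 0, & x\bullet(y\circ z)=y\circ(x\bullet z);\\ (f) & (x\circ y)\bullet z = (x\bullet z)\circ y, & x\bullet(y\circ z)=0;\\ (g) & (x\circ y)\bullet z = (x\bullet z)\circ y, & x\bullet(y\circ z)=y\circ(x\bullet z). \end{array} \] There are precisely three isomorphism classes of distributive laws of $\mathcal{P}_1$ over $\mathcal{P}_2$, namely: the class of the trivial law (a); the class of the truncated law, represented by any of (b), (c), (e), (f); and the class of the law for nonsymmetric Poisson algebras, represented by either of (d), (g).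
   Context: Fix a field $\Bbbk$ of characteristic $0$; operads are symmetric operads in $\Bbbk$-vector spaces, and all generating operations have degree $0$. For a $\Sigma_2$-module $E$, $\mathcal{F}(E)$ is the free operad generated by $E$ placed in arity $2$; for a $\Sigma_3$-submodule $R\subseteq\mathcal{F}(E)(3)$, $\langle E;R\rangle=\mathcal{F}(E)/(R)$, where $(R)$ is the operad ideal generated by $R$. Let $\mathcal{P}_1=\langle E_1;R_1\rangle$, $\mathcal{P}_2=\langle E_2;R_2\rangle$ and $E=E_1\oplus E_2$. For $i,j\in\{1,2\}$ let $\mathcal{F}(E)(3)_{ij}\subseteq\mathcal{F}(E)(3)$ be the $\Sigma_3$-submodule generated by the compositions $\mu(1,\nu)$, $\mu(\nu,1)$ with $\mu\in E_i$ (root operation) and $\nu\in E_j$. Given a $\Sigma_3$-equivariant linear map $\mathcal{D}\colon\mathcal{F}(E)(3)_{12}\to\mathcal{F}(E)(3)_{21}$, let $R_{\mathcal{D}}$ be the submodule of all $x-\mathcal{D}(x)$, $x\in\mathcal{F}(E)(3)_{12}$, and let $\mathcal{P}=\langle E_1\oplus E_2;\,R_1\oplus R_{\mathcal{D}}\oplus R_2\rangle$ (the combined operad). The canonical maps $\mathcal{P}_i\to\mathcal{P}$ and operadic composition in $\mathcal{P}$ induce, via $(\mu;\nu_1,\dots,\nu_l)\mapsto\mu(\nu_1,\dots,\nu_l)$ with $\mu\in\mathcal{P}_2(l)$ and $\nu_s\in\mathcal{P}_1(m_s)$, $m_1+\cdots+m_l=n$, an equivariant map $\xi(n)\colon(\mathcal{P}_2\circ\mathcal{P}_1)(n)\to\mathcal{P}(n)$,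 where $\mathcal{P}_2\circ\mathcal{P}_1$ is the composite product of $\Sigma$-modules. The map $\mathcal{D}$ is called a distributive law of $\mathcal{P}_1$ over $\mathcal{P}_2$ if $\xi(n)$ is an isomorphism for every $n\ge2$. A law is written by rewrite rules $u=v$, meaning $\mathcal{D}(u)=v$ for $u$ running over $\Sigma_3$-module generators of $\mathcal{F}(E)(3)_{12}$. Two distributive laws are isomorphic if the corresponding combined operads are isomorphic. $\mathcal{A}ss$ is the operad of associative algebras: $E=\Bbbk[\Sigma_2]$ is spanned by one binary operation with no symmetry and its opposite, and $R$ is generated by the associativity relation. Here $E_1$ is spanned by $\bullet$ and its opposite, and $E_2$ by $\circ$ and its opposite. *)

(* Defs.v *)
From HB Require Import structures.
From mathcomp Require Import all_boot all_order all_algebra all_fingroup.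
From mathcomp Require Import boolp.

Set Implicit Arguments.
Unset Strict Implicit.
Unset Printing Implicit Defensive.

Import GRing.Theory.
Local Open Scope ring_scope.

(* A vector space "up to an equivalence relation": the vector space axioms are
   only required modulo [pl_eq].  [quot S] is the resulting vector space, whose
   elements are the equivalence classes. *)
Record prelmod (K : fieldType) := PreLmod {
  pl_sort :> Type;
  pl_zero : pl_sort;
  pl_add : pl_sort -> pl_sort -> pl_sort;
  pl_scale : K -> pl_sort -> pl_sort;
  pl_eq : pl_sort -> pl_sort -> Prop;
  pl_refl : forall x, pl_eq x x;
  pl_sym : forall x y, pl_eq x y -> pl_eq y x;
  pl_trans : forall x y z, pl_eq x y -> pl_eq y z -> pl_eq x z;
  pl_addc : forall x x' y y', pl_eq x x' -> pl_eq y y' ->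
    pl_eq (pl_add x y) (pl_add x' y');
  pl_scalec : forall a x x', pl_eq x x' -> pl_eq (pl_scale a x) (pl_scale a x');
  pl_addA : forall x y z, pl_eq (pl_add x (pl_add y z)) (pl_add (pl_add x y) z);
  pl_addC : forall x y, pl_eq (pl_add x y) (pl_add y x);
  pl_add0 : forall x, pl_eq (pl_add pl_zero x) x;
  pl_addN : forall x, pl_eq (pl_add (pl_scale (-1) x) x) pl_zero;
  pl_scaleA : forall a b x, pl_eq (pl_scale a (pl_scale b x)) (pl_scale (a * b) x);
  pl_scale1 : forall x, pl_eq (pl_scale 1 x) x;
  pl_scaleDr : forall a x y,
    pl_eq (pl_scale a (pl_add x y)) (pl_add (pl_scale a x) (pl_scale a y));
  pl_scaleDl : forall a b x,
    pl_eq (pl_scale (a + b) x) (pl_add (pl_scale a x) (pl_scale b x)) }.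

Definition quot (K : fieldType) (S : prelmod K) : Type :=
  {A : S -> Prop | exists x, A = pl_eq x}.

Section Quot.
Variables (K : fieldType) (S : prelmod K).

Definition cls (x : S) : quot S := exist _ (pl_eq x) (ex_intro _ x erefl).

Definition rep (u : quot S) : S := projT1 (cid (svalP u)).

Lemma clsP (x y : S) : cls x = cls y <-> pl_eq x y.
Proof.
split=> [/(congr1 sval)/= e | e]; first by rewrite e; exact: pl_refl.
apply/eq_exist/funext => z; apply/propext; split=> h.
  exact: pl_trans (pl_sym e) h.
exact: pl_trans e h.
Qed.

Lemma repK (u : quot S) : cls (rep u) = u.
Proof.
rewrite /rep; case: cid => x e.
by rewrite /cls; case: u e => A hA /= e; apply/eq_exist.
Qed.

Lemma rep_cls (x : S) : pl_eq (rep (cls x)) x.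
Proof. by apply/clsP; rewrite repK. Qed.

HB.instance Definition _ := gen_eqMixin (quot S).
HB.instance Definition _ := gen_choiceMixin (quot S).

Definition qzero : quot S := cls (pl_zero S).
Definition qadd (u v : quot S) := cls (pl_add (rep u) (rep v)).
Definition qscale (a : K) (u : quot S) := cls (pl_scale a (rep u)).
Definition qopp (u : quot S) := qscale (-1) u.

Lemma qaddE x y : qadd (cls x) (cls y) = cls (pl_add x y).
Proof. by apply/clsP/pl_addc; exact: rep_cls. Qed.

Lemma qscaleE a x : qscale a (cls x) = cls (pl_scale a x).
Proof. by apply/clsP/pl_scalec; exact: rep_cls. Qed.

Lemma qaddA : associative qadd.
Proof.
move=> u v w; rewrite -(repK u) -(repK v) -(repK w) !qaddE.
by apply/clsP/pl_addA.
Qed.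

Lemma qaddC : commutative qadd.
Proof. by move=> u v; rewrite -(repK u) -(repK v) !qaddE; apply/clsP/pl_addC. Qed.

Lemma qadd0 : left_id qzero qadd.
Proof. by move=> u; rewrite -(repK u) qaddE; apply/clsP/pl_add0. Qed.

Lemma qaddN : left_inverse qzero qopp qadd.
Proof. by move=> u; rewrite -(repK u) /qopp qscaleE qaddE; apply/clsP/pl_addN. Qed.

HB.instance Definition _ := GRing.isZmodule.Build (quot S) qaddA qaddC qadd0 qaddN.

Lemma qscaleA a b u : qscale a (qscale b u) = qscale (a * b) u.
Proof. by rewrite -(repK u) !qscaleE; apply/clsP/pl_scaleA. Qed.

Lemma qscale1 : left_id 1 qscale.
Proof. by move=> u; rewrite -(repK u) qscaleE; apply/clsP/pl_scale1. Qed.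

Lemma qscaleDr : right_distributive qscale +%R.
Proof.
move=> a u v; rewrite -(repK u) -(repK v) [_ + _]qaddE !qscaleE [RHS]qaddE.
by apply/clsP/pl_scaleDr.
Qed.

Lemma qscaleDl u : {morph qscale^~ u : a b / a + b}.
Proof.
by move=> a b /=; rewrite -(repK u) !qscaleE [RHS]qaddE; apply/clsP/pl_scaleDl.
Qed.

HB.instance Definition _ :=
  GRing.Zmodule_isLmodule.Build K (quot S) qscaleA qscale1 qscaleDr qscaleDl.

Lemma cls0 : cls (pl_zero S) = 0. Proof. by []. Qed.
Lemma clsD x y : cls (pl_add x y) = cls x + cls y.
Proof. by rewrite [RHS]qaddE. Qed.
Lemma clsZ a x : cls (pl_scale a x) = a *: cls x.
Proof. by rewrite [RHS]qscaleE. Qed.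

Lemma quotP (P : quot S -> Prop) : (forall x, P (cls x)) -> forall u, P u.
Proof. by move=> h u; rewrite -(repK u). Qed.

End Quot.

(* Sigma-modules and operads are taken in coordinate-free form: the space of
   operations is indexed by the finite set of its inputs, and bijections of
   input sets act by relabelling.  The arity [n] component is the value at
   ['I_n], with the symmetric group acting through its bijections of ['I_n].
   Below, axioms quantifying over a proof [h] that some explicit map is bijective
   only do so to avoid naming a particular proof. *)
Record sigma_module (K : fieldType) := SigmaModule {
  sm_car :> finType -> lmodType K;
  relabel : forall (I J : finType) (f : I -> J), bijective f ->
    sm_car I -> sm_car J;
  relabel_linear : forall (I J : finType) (f : I -> J) (hf : bijective f),
    linear (relabel hf);
  relabel_id : forall (I : finType) (h : bijective (@id I)) x, relabel h x = x;
  relabel_comp : forall (I J L : finType) (f : I -> J) (g : J -> L)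
    (hf : bijective f) (hg : bijective g) (h : bijective (g \o f)) x,
    relabel h x = relabel hg (relabel hf x) }.

(* [op_comp p q] is the total composition p(q_i, i in I), with inputs the disjoint
   union of the input sets of the q_i. *)
Record operad (K : fieldType) := Operad {
  op_sm :> sigma_module K;
  op_one : op_sm unit;
  op_comp : forall (I : finType) (J : I -> finType),
    op_sm I -> (forall i, op_sm (J i)) -> op_sm {i : I & J i};
  comp_linearl : forall (I : finType) (J : I -> finType) (q : forall i, op_sm (J i)),
    linear (fun p : op_sm I => op_comp p q);
  comp_linearr : forall (I : finType) (J : I -> finType) (p : op_sm I)
    (q : forall i, op_sm (J i)) (i : I),
    linear (fun x : op_sm (J i) => op_comp p (dfwith q x));
  comp_relabell : forall (I I' : finType) (J : I' -> finType) (f : I -> I')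
    (hf : bijective f) (p : op_sm I) (q : forall i, op_sm (J i))
    (h : bijective (fun s : {i : I & J (f i)} =>
                      existT (fun i => J i) (f (tag s)) (tagged s))),
    op_comp (relabel hf p) q = relabel h (op_comp p (fun i => q (f i)));
  comp_relabelr : forall (I : finType) (J J' : I -> finType)
    (g : forall i, J i -> J' i) (hg : forall i, bijective (g i))
    (p : op_sm I) (q : forall i, op_sm (J i))
    (h : bijective (fun s : {i : I & J i} =>
                      existT (fun i => J' i) (tag s) (g (tag s) (tagged s)))),
    op_comp p (fun i => relabel (hg i) (q i)) = relabel h (op_comp p q);
  comp_unitl : forall (I : finType) (p : op_sm I)
    (h : bijective (fun s : {_ : unit & I} => tagged s)),
    relabel h (op_comp op_one (fun _ => p)) = p;
  comp_unitr : forall (I : finType) (p : op_sm I)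
    (h : bijective (fun s : {_ : I & unit} => tag s)),
    relabel h (op_comp p (fun _ => op_one)) = p;
  comp_assoc : forall (I : finType) (J : I -> finType)
    (L : forall i, J i -> finType) (p : op_sm I) (q : forall i, op_sm (J i))
    (r : forall i j, op_sm (L i j))
    (h : bijective (fun s : {s : {i : I & J i} & L (tag s) (tagged s)} =>
           existT (fun i => {j : J i & L i j} : Type) (tag (tag s))
             (existT (fun j => L (tag (tag s)) j : Type) (tagged (tag s)) (tagged s)))),
    relabel h (op_comp (op_comp p q) (fun s => r (tag s) (tagged s))) =
    op_comp p (fun i => op_comp (q i) (r i)) }.

Record operad_hom (K : fieldType) (P Q : operad K) := OperadHom {
  hom_fun :> forall I : finType, P I -> Q I;
  hom_linear : forall I : finType, linear (@hom_fun I);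
  hom_relabel : forall (I J : finType) (f : I -> J) (hf : bijective f) (x : P I),
    hom_fun (relabel hf x) = relabel hf (hom_fun x);
  hom_one : hom_fun (op_one P) = op_one Q;
  hom_comp : forall (I : finType) (J : I -> finType) (p : P I)
    (q : forall i, P (J i)),
    hom_fun (op_comp p q) = op_comp (hom_fun p) (fun i => hom_fun (q i)) }.

Definition operad_iso (K : fieldType) (P Q : operad K) : Prop :=
  exists phi : operad_hom P Q, forall I : finType, bijective (@hom_fun _ _ _ phi I).

Record sigma2_module (K : fieldType) := Sigma2Module {
  s2_car :> lmodType K;
  s2_swap : s2_car -> s2_car;
  s2_linear : linear s2_swap;
  s2_invol : involutive s2_swap }.

Section Terms.
Variables (K : fieldType).

Inductive term (E I : Type) : Type :=
| Var of I
| Zero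
| Add of term E I & term E I
| Scale of K & term E I
| Op of E & term E I & term E I.

Arguments Zero {E I}.
Arguments Var {E I}.

Fixpoint bind (E I J : Type) (t : term E I) (k : I -> term E J) : term E J :=
  match t with
  | Var i => k i
  | Zero => Zero
  | Add t s => Add (bind t k) (bind s k)
  | Scale a t => Scale a (bind t k)
  | Op e t s => Op e (bind t k) (bind s k)
  end.

Fixpoint opmap (E E' I : Type) (h : E -> E') (t : term E I) : term E' I :=
  match t with
  | Var i => Var i
  | Zero => Zero
  | Add t s => Add (opmap h t) (opmap h s)
  | Scale a t => Scale a (opmap h t)
  | Op e t s => Op (h e) (opmap h t) (opmap h s)
  end.

(* The smallest congruence making terms into a vector space on which the
   symbols [Op] are bilinear operations, depending linearly on [e : E], with
   (e.(12))(x, y) = e(y, x). *)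
Inductive teq (E : sigma2_module K) (I : Type) : term E I -> term E I -> Prop :=
| teq_refl t : teq t t
| teq_sym t s : teq t s -> teq s t
| teq_trans t s u : teq t s -> teq s u -> teq t u
| teq_addc t t' s s' : teq t t' -> teq s s' -> teq (Add t s) (Add t' s')
| teq_scalec a t t' : teq t t' -> teq (Scale a t) (Scale a t')
| teq_opc e t t' s s' : teq t t' -> teq s s' -> teq (Op e t s) (Op e t' s')
| teq_addA t s u : teq (Add t (Add s u)) (Add (Add t s) u)
| teq_addC t s : teq (Add t s) (Add s t)
| teq_add0 t : teq (Add Zero t) t
| teq_addN t : teq (Add (Scale (-1) t) t) Zero
| teq_scaleA a b t : teq (Scale a (Scale b t)) (Scale (a * b) t)
| teq_scale1 t : teq (Scale 1 t) t
| teq_scaleDr a t s : teq (Scale a (Add t s)) (Add (Scale a t) (Scale a s))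
| teq_scaleDl a b t : teq (Scale (a + b) t) (Add (Scale a t) (Scale b t))
| teq_opl e a t t' s :
    teq (Op e (Add (Scale a t) t') s) (Add (Scale a (Op e t s)) (Op e t' s))
| teq_opr e a t s s' :
    teq (Op e t (Add (Scale a s) s')) (Add (Scale a (Op e t s)) (Op e t s'))
| teq_ope a e e' t s :
    teq (Op (a *: e + e') t s) (Add (Scale a (Op e t s)) (Op e' t s))
| teq_swap e t s : teq (Op (s2_swap e) t s) (Op e s t).

(* [ml t A]: every monomial of [t] contains each variable of [A] exactly once,
   and no other variable. *)
Fixpoint ml (E : Type) (I : finType) (t : term E I) (A : {set I}) : Prop :=
  match t with
  | Var i => A = [set i]
  | Zero => True
  | Add t s => ml t A /\ ml s A
  | Scale _ t => ml t A
  | Op _ t s => exists B C : {set I},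
      [/\ A = B :|: C, [disjoint B & C], ml t B & ml s C]
  end.

Lemma bind_Var (E I : Type) (t : term E I) : bind t Var = t.
Proof. by elim: t => //= [t -> s ->|a t ->|e t -> s ->]. Qed.

Lemma bind_bind (E I J L : Type) (t : term E I) (k : I -> term E J)
  (k' : J -> term E L) : bind (bind t k) k' = bind t (fun i => bind (k i) k').
Proof. by elim: t => //= [t -> s ->|a t ->|e t -> s ->]. Qed.

Lemma bind_ext (E I J : Type) (t : term E I) (k k' : I -> term E J) :
  k =1 k' -> bind t k = bind t k'.
Proof. by move=> /funext ->. Qed.

Lemma opmap_bind (E E' I J : Type) (h : E -> E') (t : term E I)
    (k : I -> term E J) :
  opmap h (bind t k) = bind (opmap h t) (fun i => opmap h (k i)).
Proof. by elim: t => //= [t -> s ->|a t ->|e t -> s ->]. Qed.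

Lemma ml_opmap (E E' : Type) (I : finType) (h : E -> E') (t : term E I) A :
  ml t A -> ml (opmap h t) A.
Proof.
elim: t A => //= [t IHt s IHs A []|e t IHt s IHs A [B [C [-> d m1 m2]]]].
  by move=> /IHt ? /IHs ?.
by exists B, C; split=> //; [exact: IHt | exact: IHs].
Qed.

Lemma ml_bind (E : Type) (I J : finType) (g : J -> I) (t : term E I)
    (k : I -> term E J) (A : {set I}) :
  (forall i, ml (k i) [set j | g j == i]) -> ml t A ->
  ml (bind t k) [set j | g j \in A].
Proof.
move=> hk; elim: t A => //=.
- by move=> i A ->; have := hk i; congr (ml _ _); apply/setP => j; rewrite !inE.
- by move=> t IHt s IHs A [/IHt ? /IHs ?].
move=> e t IHt s IHs A [B [C [-> d m1 m2]]].
exists [set j | g j \in B], [set j | g j \in C]; split; [ | |exact: IHt|exact: IHs].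
  by apply/setP => j; rewrite !inE.
apply/pred0P => j /=; rewrite !inE; apply/negbTE/negP => /andP[jB jC].
by have /pred0P/(_ (g j)) := d; rewrite /= jB jC.
Qed.

Lemma ml_bindT (E : Type) (I J : finType) (g : J -> I) (t : term E I)
    (k : I -> term E J) :
  (forall i, ml (k i) [set j | g j == i]) -> ml t setT -> ml (bind t k) setT.
Proof.
move=> hk /(ml_bind hk); congr (ml _ _).
by apply/setP => j; rewrite !inE.
Qed.

Variable E : sigma2_module K.

Lemma teq_bind (I J : Type) (t t' : term E I) (k k' : I -> term E J) :
  teq t t' -> (forall i, teq (k i) (k' i)) -> teq (bind t k) (bind t' k').
Proof.
move=> tt' kk'; apply: (@teq_trans _ _ _ (bind t k')).
  by elim: t {tt'} => *; [exact: kk'|exact: teq_refl|exact: teq_addc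
                       |exact: teq_scalec|exact: teq_opc].
by elim: tt' => //= *; solve [ exact: teq_refl | exact: teq_sym
  | apply: teq_trans; eassumption
  | exact: teq_addc | exact: teq_scalec | exact: teq_opc
  | exact: teq_addA | exact: teq_addC | exact: teq_add0 | exact: teq_addN
  | exact: teq_scaleA | exact: teq_scale1 | exact: teq_scaleDr
  | exact: teq_scaleDl | exact: teq_opl | exact: teq_opr | exact: teq_ope
  | exact: teq_swap ].
Qed.

Lemma ml_bind_out (I J : finType) (t : term E I) (A : {set I})
    (k k' : I -> term E J) :
  ml t A -> (forall i, i \in A -> k i = k' i) -> bind t k = bind t k'.
Proof.
elim: t A => //=.
- by move=> i A -> h; rewrite h // inE.
- by move=> t IHt s IHs A [m1 m2] h; rewrite (IHt A) ?(IHs A).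
- by move=> a t IHt A m h; rewrite (IHt A).
move=> e t IHt s IHs A [B [C [-> _ m1 m2]]] h.
rewrite (IHt B) ?(IHs C) // => i iA; apply: h; rewrite inE iA ?orbT //.
Qed.

Lemma teq_scale0 (I : Type) a : teq (Scale a (Zero : term E I)) Zero.
Proof.
set z := Scale a Zero.
have zz : teq (Add z z) z.
  apply: teq_trans (teq_sym (teq_scaleDr _ _ _)) _.
  exact/teq_scalec/teq_add0.
have h : teq (Add (Scale (-1) z) (Add z z)) Zero.
  apply: teq_trans (teq_addN z); apply: teq_addc => //; exact: teq_refl.
apply: teq_trans h; apply: teq_sym; apply: teq_trans (teq_addA _ _ _) _.
apply: teq_trans (teq_add0 z); apply: teq_addc; last exact: teq_refl.
exact: teq_addN.
Qed.

Lemma teq_add4 (I : Type) (a b c d : term E I) :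
  teq (Add (Add a b) (Add c d)) (Add (Add a c) (Add b d)).
Proof.
apply: teq_trans (teq_sym (teq_addA _ _ _)) _.
apply: teq_trans (teq_addA _ _ _); apply: teq_addc; first exact: teq_refl.
apply: teq_trans (teq_addA _ _ _) _; apply: teq_sym.
apply: teq_trans (teq_addA _ _ _) _; apply: teq_addc; last exact: teq_refl.
exact: teq_addC.
Qed.

Lemma teq_bind_linear (I J : finType) (t : term E I) (A : {set I}) (i0 : I)
    (a : K) (k kx ky : I -> term E J) :
  ml t A -> i0 \in A ->
  (forall i, i != i0 -> k i = kx i /\ k i = ky i) ->
  teq (k i0) (Add (Scale a (kx i0)) (ky i0)) ->
  teq (bind t k) (Add (Scale a (bind t kx)) (bind t ky)).
Proof.
move=> + + hne h0; elim: t A => //=.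
- by move=> i A ->; rewrite inE => /eqP <-.
- move=> A _ _; apply: teq_sym; apply: teq_trans (teq_addC _ _) _.
  by apply: teq_trans (teq_add0 _) _; exact: teq_scale0.
- move=> t IHt s IHs A [m1 m2] iA.
  apply: teq_trans (teq_addc (IHt _ m1 iA) (IHs _ m2 iA)) _.
  apply: teq_trans (teq_add4 _ _ _ _) _.
  by apply: teq_addc; [exact/teq_sym/teq_scaleDr | exact: teq_refl].
- move=> b t IHt A m iA; apply: teq_trans (teq_scalec _ (IHt _ m iA)) _.
  apply: teq_trans (teq_scaleDr _ _ _) _; apply: teq_addc; last exact: teq_refl.
  apply: teq_trans (teq_scaleA _ _ _) _; rewrite mulrC.
  exact/teq_sym/teq_scaleA.
move=> e t IHt s IHs A [B [C [-> d m1 m2]]].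
have hd i : i \in B -> i \in C -> False.
  by move=> iB iC; have /pred0P/(_ i) := d; rewrite /= iB iC.
have off (u : term E I) D : ml u D -> i0 \notin D ->
    bind u k = bind u kx /\ bind u k = bind u ky.
  move=> m iD; split; apply: (ml_bind_out m) => i iD'.
    by have [|-> //] := hne i; apply: contraNneq iD => <-.
  by have [|_ -> //] := hne i; apply: contraNneq iD => <-.
rewrite inE => /orP[iB|iC].
  have [|<- <-] := off _ _ m2; first by apply/negP; exact: hd.
  apply: teq_trans (teq_opl _ _ _ _ _).
  by apply: teq_opc; [exact: IHt iB | exact: teq_refl].
have [|<- <-] := off _ _ m1; first by apply/negP => /hd; exact.
apply: teq_trans (teq_opr _ _ _ _ _).
by apply: teq_opc; [exact: teq_refl | exact: IHs iC].
Qed.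

End Terms.

Arguments Zero {K E I}.
Arguments Var {K E I}.
Arguments teq_refl {K E I t}.

Section FreeOperad.
Variables (K : fieldType) (E : sigma2_module K).

Definition mlterm (I : finType) := {t : term K E I | ml t setT}.

Section Car.
Variable I : finType.

Definition ml_zero : mlterm I := exist _ Zero Logic.I.
Definition ml_add (t s : mlterm I) : mlterm I :=
  exist _ (Add (sval t) (sval s)) (conj (svalP t) (svalP s)).
Definition ml_scale (a : K) (t : mlterm I) : mlterm I :=
  exist (fun t => ml t setT) (Scale a (sval t)) (svalP t).

(* The free operad on [E] at [I]: the multilinear part of the free algebra on
   the set of variables [I], for the type of algebras having a bilinear
   operation for each element of [E], subject to the symmetries of [E]. *)
Definition free_prelmod : prelmod K.
Proof.
refine (@PreLmod K (mlterm I) ml_zero ml_add ml_scale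
  (fun t s => teq (sval t) (sval s)) _ _ _ _ _ _ _ _ _ _ _ _ _).
- by move=> x; exact: teq_refl.
- by move=> x y; exact: teq_sym.
- by move=> x y z; exact: teq_trans.
- by move=> x x' y y'; exact: teq_addc.
- by move=> a x x'; exact: teq_scalec.
- by move=> x y z; exact: teq_addA.
- by move=> x y; exact: teq_addC.
- by move=> x; exact: teq_add0.
- by move=> x; exact: teq_addN.
- by move=> a b x; exact: teq_scaleA.
- by move=> x; exact: teq_scale1.
- by move=> a x y; exact: teq_scaleDr.
- by move=> a b x; exact: teq_scaleDl.
Defined.

Definition free_car : lmodType K := quot free_prelmod.

Definition fcls (t : mlterm I) : free_car := @cls K free_prelmod t.
Definition frep (x : free_car) : mlterm I := @rep K free_prelmod x.

Lemma fclsP (t s : mlterm I) : fcls t = fcls s <-> teq (sval t) (sval s).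
Proof. exact: (@clsP K free_prelmod). Qed.
Lemma frepK (x : free_car) : fcls (frep x) = x.
Proof. exact: (@repK K free_prelmod). Qed.
Lemma frep_cls (t : mlterm I) : teq (sval (frep (fcls t))) (sval t).
Proof. by apply/fclsP; rewrite frepK. Qed.
Lemma fcls_lin a (t s : mlterm I) :
  a *: fcls t + fcls s = fcls (ml_add (ml_scale a t) s).
Proof. by rewrite /fcls (clsD (S := free_prelmod)) (clsZ (S := free_prelmod)). Qed.

End Car.

Lemma ml_var_bij (I J : finType) (f : I -> J) (hf : bijective f) :
  exists g : J -> I, forall i, @ml K E J (Var (f i)) [set j | g j == i].
Proof.
case: hf => g fK gK; exists g => i /=; apply/setP => j; rewrite !inE.
by apply/eqP/eqP => [<-|->].
Qed.

Lemma ml_relabel (I J : finType) (f : I -> J) (hf : bijective f)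
  (t : mlterm I) : ml (bind (sval t) (fun i => Var (f i))) setT.
Proof. by have [g hg] := ml_var_bij hf; exact: ml_bindT hg (svalP t). Qed.

Definition term_relabel (I J : finType) (f : I -> J) (hf : bijective f)
  (t : mlterm I) : mlterm J := exist (fun t => ml t setT) _ (ml_relabel hf t).

Lemma ml_comp (I : finType) (J : I -> finType) (t : mlterm I)
  (q : forall i, mlterm (J i)) :
  ml (bind (sval t) (fun i => bind (sval (q i))
     (fun j => Var (existT (fun i => J i : Type) i j)))) setT.
Proof.
pose SJ : finType := {i : I & J i}.
apply: (@ml_bindT _ _ _ SJ (fun s => tag s) _ _ _ (svalP t)) => i.
pose V (j : J i) : term K E SJ := Var (existT (fun i => J i : Type) i j).
suff h u A : ml u A ->
    ml (bind u V) [set s : SJ | [exists j in A, s == existT (fun i => J i : Type) i j]].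
  have := h _ _ (svalP (q i)); congr (ml _ _).
  apply/setP => s; rewrite !inE; apply/existsP/eqP => [[j /andP[_ /eqP ->]]//|].
  case: s => i' j /= e; by subst i'; exists j; rewrite inE /=.
elim: u A => //=.
- move=> j A ->; apply/setP => s; rewrite !inE.
  apply/existsP/eqP => [[j' /andP[]]|->]; first by rewrite inE => /eqP -> /eqP.
  by exists j; rewrite inE !eqxx.
- by move=> t1 IHt s IHs A [/IHt ? /IHs ?].
move=> e t1 IHt s IHs A [B [C [-> d m1 m2]]].
eexists; eexists; split; [ | |exact: IHt m1|exact: IHs m2].
  apply/setP => x; rewrite !inE; apply/existsP/orP.
    move=> [j /andP[]]; rewrite inE => /orP[jB|jC] xj; [left|right];
    by apply/existsP; exists j; apply/andP.
  by move=> [] /existsP[j /andP[jB xj]]; exists j; rewrite inE jB xj ?orbT.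
apply/pred0P => x /=; rewrite !inE; apply/negbTE/negP => /andP[].
move=> /existsP[j /andP[jB /eqP ->]] /existsP[j' /andP[jC]].
rewrite -tag_eqE /tag_eq /= eqxx tagged_asE => /eqP jj'.
by have /pred0P/(_ j) := d; rewrite /= jB jj' jC.
Qed.

Definition term_comp (I : finType) (J : I -> finType) (t : mlterm I)
    (q : forall i, mlterm (J i)) : mlterm {i : I & J i} :=
  exist (fun t => ml t setT) _ (ml_comp t q).

Lemma ml_one : @ml K E unit (Var tt) setT.
Proof. by apply/setP => -[]; rewrite !inE. Qed.

Definition free_one : free_car unit :=
  fcls (exist (fun t => ml t setT) (Var tt) ml_one).

Definition free_relabel (I J : finType) (f : I -> J) (hf : bijective f)
  (x : free_car I) : free_car J := fcls (term_relabel hf (frep x)).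

Definition free_comp (I : finType) (J : I -> finType) (x : free_car I)
    (q : forall i, free_car (J i)) : free_car {i : I & J i} :=
  fcls (term_comp (frep x) (fun i => frep (q i))).

Lemma free_relabelE (I J : finType) (f : I -> J) (hf : bijective f) t :
  free_relabel hf (fcls t) = fcls (term_relabel hf t).
Proof.
by apply/fclsP/teq_bind => [|i]; [exact: frep_cls | exact: teq_refl].
Qed.

Lemma free_compE (I : finType) (J : I -> finType) t (q : forall i, mlterm (J i)) :
  free_comp (fcls t) (fun i => fcls (q i)) = fcls (term_comp t q).
Proof.
apply/fclsP/teq_bind => [|i]; first exact: frep_cls.
by apply: teq_bind => [|j]; [exact: frep_cls | exact: teq_refl].
Qed.

Lemma freeP (I : finType) (P : free_car I -> Prop) :
  (forall t, P (fcls t)) -> forall x, P x.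
Proof. by move=> h x; rewrite -(frepK x). Qed.

Lemma free_famP (I : finType) (J : I -> finType)
    (P : (forall i, free_car (J i)) -> Prop) :
  (forall q : forall i, mlterm (J i), P (fun i => fcls (q i))) -> forall q, P q.
Proof.
move=> h q.
have -> : q = (fun i => fcls (frep (q i))).
  by apply: functional_extensionality_dep => i; rewrite frepK.
exact: h.
Qed.

Lemma free_relabel_linear (I J : finType) (f : I -> J) (hf : bijective f) :
  linear (free_relabel hf).
Proof.
move=> a; elim/freeP => x; elim/freeP => y.
by rewrite fcls_lin !free_relabelE fcls_lin; apply/fclsP/teq_refl.
Qed.

Lemma free_relabel_id (I : finType) (h : bijective (@id I)) x :
  free_relabel h x = x.
Proof.
elim/freeP: x => x; rewrite free_relabelE; apply/fclsP => /=.
by rewrite bind_Var; exact: teq_refl.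
Qed.

Lemma free_relabel_comp (I J L : finType) (f : I -> J) (g : J -> L)
    (hf : bijective f) (hg : bijective g) (h : bijective (g \o f)) x :
  free_relabel h x = free_relabel hg (free_relabel hf x).
Proof.
elim/freeP: x => x; rewrite !free_relabelE; apply/fclsP => /=.
by rewrite bind_bind; exact: teq_refl.
Qed.

Definition free_sigma_module : sigma_module K :=
  SigmaModule free_relabel_linear free_relabel_id free_relabel_comp.

Lemma free_comp_linearl (I : finType) (J : I -> finType)
  (q : forall i, free_car (J i)) : linear (fun p => free_comp p q).
Proof.
move=> a; elim/freeP => x; elim/freeP => y; elim/free_famP: q => q.
by rewrite fcls_lin !free_compE fcls_lin; apply/fclsP/teq_refl.
Qed.

Lemma free_comp_linearr (I : finType) (J : I -> finType) (p : free_car I)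
    (q : forall i, free_car (J i)) (i : I) :
  linear (fun x : free_car (J i) => free_comp p (dfwith q x)).
Proof.
move=> a x y; elim/freeP: p => p.
rewrite -(frepK (free_comp _ (dfwith q x))) -(frepK (free_comp _ (dfwith q y))).
rewrite fcls_lin; apply/fclsP => /=.
have cg (r : forall i, free_car (J i)) :
  teq (sval (frep (free_comp (fcls p) r))) (sval (term_comp p (fun i => frep (r i)))).
  apply/fclsP; rewrite frepK -free_compE; congr free_comp.
  by apply: functional_extensionality_dep => j; rewrite frepK.
apply: teq_trans (teq_bind (frep_cls p) (fun=> teq_refl)) _.
apply: teq_sym; apply: teq_trans (teq_addc (teq_scalec a (cg _)) (cg _)) _.
apply: teq_sym => /=.
apply: (teq_bind_linear (i0 := i) (svalP p)) => [|j ji|]; first by rewrite inE.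
  by rewrite !dfwith_out // eq_sym.
rewrite !dfwith_in -[X in teq _ (Add X _)]/(bind (Scale a (sval (frep x))) _).
rewrite -[X in teq _ X]/(bind (Add (Scale a (sval (frep x))) (sval (frep y))) _).
apply: teq_bind => [|?]; last exact: teq_refl.
rewrite -{1}(frepK x) -{1}(frepK y) fcls_lin.
exact: frep_cls.
Qed.

Lemma free_comp_relabell (I I' : finType) (J : I' -> finType) (f : I -> I')
    (hf : bijective f) (p : free_car I) (q : forall i, free_car (J i))
    (h : bijective (fun s : {i : I & J (f i)} =>
                      existT (fun i => J i) (f (tag s)) (tagged s))) :
  free_comp (free_relabel hf p) q = free_relabel h (free_comp p (fun i => q (f i))).
Proof.
elim/freeP: p => p; elim/free_famP: q => q.
rewrite free_relabelE free_compE (free_compE p (fun i => q (f i))) free_relabelE.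
apply/fclsP => /=; rewrite !bind_bind /=.
under [X in teq _ X]bind_ext => i do rewrite bind_bind /=.
exact: teq_refl.
Qed.

Lemma free_comp_relabelr (I : finType) (J J' : I -> finType)
    (g : forall i, J i -> J' i) (hg : forall i, bijective (g i))
    (p : free_car I) (q : forall i, free_car (J i))
    (h : bijective (fun s : {i : I & J i} =>
                      existT (fun i => J' i) (tag s) (g (tag s) (tagged s)))) :
  free_comp p (fun i => free_relabel (hg i) (q i)) = free_relabel h (free_comp p q).
Proof.
elim/freeP: p => p; elim/free_famP: q => q.
rewrite free_compE free_relabelE.
have -> : (fun i => free_relabel (hg i) (fcls (q i))) =
          (fun i => fcls (term_relabel (hg i) (q i))).
  by apply: functional_extensionality_dep => i; rewrite free_relabelE.
rewrite free_compE; apply/fclsP => /=; rewrite !bind_bind /=.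
under [X in teq X _]bind_ext => i do rewrite bind_bind /=.
under [X in teq _ X]bind_ext => i do rewrite bind_bind /=.
exact: teq_refl.
Qed.

Lemma free_comp_unitl (I : finType) (p : free_car I)
    (h : bijective (fun s : {_ : unit & I} => tagged s)) :
  free_relabel h (free_comp free_one (fun _ => p)) = p.
Proof.
elim/freeP: p => p; rewrite free_compE free_relabelE; apply/fclsP => /=.
by rewrite bind_bind /= bind_Var; exact: teq_refl.
Qed.

Lemma free_comp_unitr (I : finType) (p : free_car I)
    (h : bijective (fun s : {_ : I & unit} => tag s)) :
  free_relabel h (free_comp p (fun _ => free_one)) = p.
Proof.
elim/freeP: p => p; rewrite free_compE free_relabelE; apply/fclsP => /=.
by rewrite bind_bind /= bind_Var; exact: teq_refl.
Qed.

Lemma free_comp_assoc (I : finType) (J : I -> finType)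
    (L : forall i, J i -> finType) (p : free_car I) (q : forall i, free_car (J i))
    (r : forall i j, free_car (L i j))
    (h : bijective (fun s : {s : {i : I & J i} & L (tag s) (tagged s)} =>
           existT (fun i => {j : J i & L i j} : Type) (tag (tag s))
             (existT (fun j => L (tag (tag s)) j : Type) (tagged (tag s)) (tagged s)))) :
  free_relabel h (free_comp (free_comp p q) (fun s => r (tag s) (tagged s))) =
  free_comp p (fun i => free_comp (q i) (r i)).
Proof.
elim/freeP: p => p; elim/free_famP: q => q.
pose r' i j := frep (r i j).
have -> : r = (fun i j => fcls (r' i j)).
  apply: functional_extensionality_dep => i.
  by apply: functional_extensionality_dep => j; rewrite frepK.
rewrite free_compE (free_compE _ (fun s => r' (tag s) (tagged s))) free_relabelE.
have -> : (fun i => free_comp (fcls (q i)) (fun j => fcls (r' i j))) =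
          (fun i => fcls (term_comp (q i) (r' i))).
  by apply: functional_extensionality_dep => i; rewrite free_compE.
rewrite free_compE; apply/fclsP => /=; rewrite !bind_bind /=.
apply: teq_bind => [|i]; first exact: teq_refl.
rewrite !bind_bind /=; apply: teq_bind => [|j]; first exact: teq_refl.
by rewrite /= !bind_bind; exact: teq_refl.
Qed.

Definition free_operad : operad K :=
  @Operad K free_sigma_module free_one free_comp free_comp_linearl
    free_comp_linearr free_comp_relabell free_comp_relabelr free_comp_unitl
    free_comp_unitr free_comp_assoc.

End FreeOperad.

Section Ideals.
Variables (K : fieldType) (P : operad K).

Record is_ideal (W : forall I : finType, P I -> Prop) : Prop := IsIdeal {
  ideal0 : forall I : finType, W I 0;
  ideal_lin : forall (I : finType) (a : K) (x y : P I),
    W I x -> W I y -> W I (a *: x + y);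
  ideal_relabel : forall (I J : finType) (f : I -> J) (hf : bijective f) (x : P I),
    W I x -> W J (relabel hf x);
  ideal_compl : forall (I : finType) (J : I -> finType) (p : P I)
    (q : forall i, P (J i)), W I p -> W {i : I & J i} (op_comp p q);
  ideal_compr : forall (I : finType) (J : I -> finType) (p : P I)
    (q : forall i, P (J i)) (i : I), W (J i) (q i) -> W {i : I & J i} (op_comp p q) }.

Definition ideal_gen (n : nat) (X : P 'I_n -> Prop) (I : finType) (x : P I) : Prop :=
  forall W : forall I : finType, P I -> Prop,
    is_ideal W -> (forall y, X y -> W 'I_n y) -> W I x.

Lemma ideal_genP (n : nat) (X : P 'I_n -> Prop) : is_ideal (ideal_gen X).
Proof.
split=> [I|I a x y hx hy|I J f hf x hx|I J p q hp|I J p q i hq] W iW XW.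
- exact: ideal0.
- by apply: ideal_lin; [|exact: hx|exact: hy].
- by apply: ideal_relabel => //; exact: hx.
- by apply: ideal_compl => //; exact: hp.
- by apply: (ideal_compr _ _ (i := i)) => //; exact: hq.
Qed.

Variables (W : forall I : finType, P I -> Prop) (iW : is_ideal W).

Lemma idealD (I : finType) (x y : P I) : W x -> W y -> W (x + y).
Proof. by move=> hx hy; rewrite -[x]scale1r; exact: ideal_lin. Qed.
Lemma idealZ (I : finType) a (x : P I) : W x -> W (a *: x).
Proof. by move=> hx; rewrite -[_ *: _]addr0; apply: ideal_lin => //; exact: ideal0. Qed.
Lemma idealB (I : finType) (x y : P I) : W x -> W y -> W (x - y).
Proof. by move=> hx hy; rewrite -scaleN1r; apply: idealD => //; exact: idealZ. Qed.

Lemma relabelB (I J : finType) (f : I -> J) (hf : bijective f) (x y : P I) :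
  relabel hf (x - y) = relabel hf x - relabel hf y.
Proof. by rewrite addrC -scaleN1r relabel_linear scaleN1r addrC. Qed.

Lemma comp_idealr (I : finType) (J : I -> finType) (p : P I)
    (q q' : forall i, P (J i)) :
  (forall i, W (q i - q' i)) -> W (op_comp p q - op_comp p q').
Proof.
move=> hq.
pose mix (s : seq I) (i : I) : P (J i) := if i \in s then q' i else q i.
have step s : W (op_comp p q - op_comp p (mix s)).
  elim: s => [|i s IHs].
    have -> : mix [::] = q by apply: functional_extensionality_dep => i.
    by rewrite subrr; exact: ideal0.
  have -> : op_comp p q - op_comp p (mix (i :: s)) =
     (op_comp p q - op_comp p (mix s)) + (op_comp p (mix s) - op_comp p (mix (i :: s))).
    by rewrite addrA subrK.
  apply: idealD => //.
  have e (r : forall i, P (J i)) : r = dfwith r (r i).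
    apply: functional_extensionality_dep => j.
    by have [->|ji] := eqVneq i j; rewrite ?dfwith_in ?dfwith_out.
  have -> : mix (i :: s) = dfwith (mix s) (q' i).
    apply: functional_extensionality_dep => j.
    have [<-|ij] := eqVneq i j; first by rewrite dfwith_in /mix inE eqxx.
    by rewrite dfwith_out // /mix inE eq_sym (negbTE ij).
  rewrite {1}(e (mix s)).
  have -> : op_comp p (dfwith (mix s) (mix s i)) - op_comp p (dfwith (mix s) (q' i))
          = op_comp p (dfwith (mix s) (mix s i - q' i)).
    by rewrite addrC -scaleN1r -comp_linearr scaleN1r addrC.
  apply: (@ideal_compr _ iW I J p _ i); rewrite dfwith_in /mix.
  by case: ifP => // _; rewrite subrr; exact: ideal0.
have := step (enum I); congr (W (_ - op_comp p _)).
by apply: functional_extensionality_dep => i; rewrite /mix mem_enum.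
Qed.

Lemma comp_ideal (I : finType) (J : I -> finType) (p p' : P I)
    (q q' : forall i, P (J i)) :
  W (p - p') -> (forall i, W (q i - q' i)) -> W (op_comp p q - op_comp p' q').
Proof.
move=> hp hq.
have -> : op_comp p q - op_comp p' q' = (op_comp p q - op_comp p' q) + (op_comp p' q - op_comp p' q').
  by rewrite addrA subrK.
apply: idealD; last exact: comp_idealr.
have -> : op_comp p q - op_comp p' q = op_comp (p - p') q.
  by rewrite addrC -scaleN1r -comp_linearl scaleN1r addrC.
exact: ideal_compl.
Qed.

Definition ideal_prelmod (I : finType) : prelmod K.
Proof.
refine (@PreLmod K (P I) 0 +%R *:%R (fun x y => W (x - y)) _ _ _ _ _ _ _ _ _ _ _ _ _).
- by move=> x; rewrite subrr; exact: ideal0.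
- by move=> x y h; rewrite -opprB -scaleN1r; exact: idealZ.
- by move=> x y z h1 h2; rewrite -(subrK y x) -addrA; exact: idealD.
- by move=> x x' y y' h1 h2; rewrite opprD addrACA; exact: idealD.
- by move=> a x x' h; rewrite -scalerBr; exact: idealZ.
- by move=> x y z; rewrite addrA subrr; exact: ideal0.
- by move=> x y; rewrite (addrC x) subrr; exact: ideal0.
- by move=> x; rewrite add0r subrr; exact: ideal0.
- by move=> x; rewrite scaleN1r addNr subrr; exact: ideal0.
- by move=> a b x; rewrite scalerA subrr; exact: ideal0.
- by move=> x; rewrite scale1r subrr; exact: ideal0.
- by move=> a x y; rewrite scalerDr subrr; exact: ideal0.
- by move=> a b x; rewrite scalerDl subrr; exact: ideal0.
Defined.

Definition quot_car (I : finType) : lmodType K := quot (ideal_prelmod I).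

Definition qproj (I : finType) (x : P I) : quot_car I := @cls K (ideal_prelmod I) x.
Definition qrep (I : finType) (u : quot_car I) : P I := @rep K (ideal_prelmod I) u.

Lemma qprojP (I : finType) (x y : P I) : qproj x = qproj y <-> W (x - y).
Proof. exact: (@clsP K (ideal_prelmod I)). Qed.
Lemma qrepK (I : finType) (u : quot_car I) : qproj (qrep u) = u.
Proof. exact: (@repK K (ideal_prelmod I)). Qed.
Lemma qrep_qproj (I : finType) (x : P I) : W (qrep (qproj x) - x).
Proof. by apply/qprojP; rewrite qrepK. Qed.
Lemma qproj_lin (I : finType) : linear (@qproj I).
Proof.
move=> a x y; rewrite /qproj.
by rewrite -(clsZ (S := ideal_prelmod I)) -(clsD (S := ideal_prelmod I)).
Qed.

Lemma quot_carP (I : finType) (Q : quot_car I -> Prop) :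
  (forall x, Q (qproj x)) -> forall u, Q u.
Proof. by move=> h u; rewrite -(qrepK u). Qed.

Lemma quot_famP (I : finType) (J : I -> finType)
    (Q : (forall i, quot_car (J i)) -> Prop) :
  (forall q : forall i, P (J i), Q (fun i => qproj (q i))) -> forall q, Q q.
Proof.
move=> h q.
have -> : q = (fun i => qproj (qrep (q i))).
  by apply: functional_extensionality_dep => i; rewrite qrepK.
exact: h.
Qed.

Definition quot_relabel (I J : finType) (f : I -> J) (hf : bijective f)
  (u : quot_car I) : quot_car J := qproj (relabel hf (qrep u)).

Definition quot_comp (I : finType) (J : I -> finType) (u : quot_car I)
    (v : forall i, quot_car (J i)) : quot_car {i : I & J i} :=
  qproj (op_comp (qrep u) (fun i => qrep (v i))).

Lemma quot_relabelE (I J : finType) (f : I -> J) (hf : bijective f) (x : P I) :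
  quot_relabel hf (qproj x) = qproj (relabel hf x).
Proof.
by apply/qprojP; rewrite -relabelB; apply: ideal_relabel => //; exact: qrep_qproj.
Qed.

Lemma quot_compE (I : finType) (J : I -> finType) (p : P I) (q : forall i, P (J i)) :
  quot_comp (qproj p) (fun i => qproj (q i)) = qproj (op_comp p q).
Proof. by apply/qprojP/comp_ideal => [|i]; exact: qrep_qproj. Qed.

Lemma quot_relabel_linear (I J : finType) (f : I -> J) (hf : bijective f) :
  linear (quot_relabel hf).
Proof.
move=> a; elim/quot_carP => x; elim/quot_carP => y.
by rewrite -qproj_lin !quot_relabelE relabel_linear qproj_lin.
Qed.

Lemma quot_relabel_id (I : finType) (h : bijective (@id I)) x :
  quot_relabel h x = x.
Proof. by elim/quot_carP: x => x; rewrite quot_relabelE relabel_id. Qed.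

Lemma quot_relabel_comp (I J L : finType) (f : I -> J) (g : J -> L)
    (hf : bijective f) (hg : bijective g) (h : bijective (g \o f)) x :
  quot_relabel h x = quot_relabel hg (quot_relabel hf x).
Proof. by elim/quot_carP: x => x; rewrite !quot_relabelE relabel_comp. Qed.

Definition quot_sigma_module : sigma_module K :=
  SigmaModule quot_relabel_linear quot_relabel_id quot_relabel_comp.

Definition quot_one : quot_car unit := qproj (op_one P).

Lemma quot_comp_linearl (I : finType) (J : I -> finType)
  (q : forall i, quot_car (J i)) : linear (fun p => quot_comp p q).
Proof.
move=> a; elim/quot_carP => x; elim/quot_carP => y; elim/quot_famP: q => q.
by rewrite -qproj_lin !quot_compE comp_linearl qproj_lin.
Qed.

Lemma quot_comp_linearr (I : finType) (J : I -> finType) (p : quot_car I)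
    (q : forall i, quot_car (J i)) (i : I) :
  linear (fun x : quot_car (J i) => quot_comp p (dfwith q x)).
Proof.
move=> a; elim/quot_carP => x; elim/quot_carP => y.
elim/quot_carP: p => p; elim/quot_famP: q => q.
have e (z : P (J i)) : dfwith (fun j => qproj (q j)) (qproj z) =
    (fun j => qproj (dfwith q z j)).
  apply: functional_extensionality_dep => j.
  by have [<-|ij] := eqVneq i j; rewrite ?dfwith_in ?dfwith_out.
by rewrite -qproj_lin !e !quot_compE comp_linearr qproj_lin.
Qed.

Lemma quot_comp_relabell (I I' : finType) (J : I' -> finType) (f : I -> I')
    (hf : bijective f) (p : quot_car I) (q : forall i, quot_car (J i))
    (h : bijective (fun s : {i : I & J (f i)} =>
                      existT (fun i => J i) (f (tag s)) (tagged s))) :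
  quot_comp (quot_relabel hf p) q = quot_relabel h (quot_comp p (fun i => q (f i))).
Proof.
elim/quot_carP: p => p; elim/quot_famP: q => q.
rewrite quot_relabelE quot_compE (quot_compE p (fun i => q (f i))) quot_relabelE.
by rewrite comp_relabell.
Qed.

Lemma quot_comp_relabelr (I : finType) (J J' : I -> finType)
    (g : forall i, J i -> J' i) (hg : forall i, bijective (g i))
    (p : quot_car I) (q : forall i, quot_car (J i))
    (h : bijective (fun s : {i : I & J i} =>
                      existT (fun i => J' i) (tag s) (g (tag s) (tagged s)))) :
  quot_comp p (fun i => quot_relabel (hg i) (q i)) = quot_relabel h (quot_comp p q).
Proof.
elim/quot_carP: p => p; elim/quot_famP: q => q.
rewrite quot_compE quot_relabelE.
have -> : (fun i => quot_relabel (hg i) (qproj (q i))) =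
          (fun i => qproj (relabel (hg i) (q i))).
  by apply: functional_extensionality_dep => i; rewrite quot_relabelE.
by rewrite quot_compE -comp_relabelr.
Qed.

Lemma quot_comp_unitl (I : finType) (p : quot_car I)
    (h : bijective (fun s : {_ : unit & I} => tagged s)) :
  quot_relabel h (quot_comp quot_one (fun _ => p)) = p.
Proof.
by elim/quot_carP: p => p; rewrite quot_compE quot_relabelE comp_unitl.
Qed.

Lemma quot_comp_unitr (I : finType) (p : quot_car I)
    (h : bijective (fun s : {_ : I & unit} => tag s)) :
  quot_relabel h (quot_comp p (fun _ => quot_one)) = p.
Proof.
by elim/quot_carP: p => p; rewrite quot_compE quot_relabelE comp_unitr.
Qed.

Lemma quot_comp_assoc (I : finType) (J : I -> finType)
    (L : forall i, J i -> finType) (p : quot_car I) (q : forall i, quot_car (J i))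
    (r : forall i j, quot_car (L i j))
    (h : bijective (fun s : {s : {i : I & J i} & L (tag s) (tagged s)} =>
           existT (fun i => {j : J i & L i j} : Type) (tag (tag s))
             (existT (fun j => L (tag (tag s)) j : Type) (tagged (tag s)) (tagged s)))) :
  quot_relabel h (quot_comp (quot_comp p q) (fun s => r (tag s) (tagged s))) =
  quot_comp p (fun i => quot_comp (q i) (r i)).
Proof.
elim/quot_carP: p => p; elim/quot_famP: q => q.
pose r' i j := qrep (r i j).
have -> : r = (fun i j => qproj (r' i j)).
  apply: functional_extensionality_dep => i.
  by apply: functional_extensionality_dep => j; rewrite qrepK.
rewrite quot_compE (quot_compE _ (fun s => r' (tag s) (tagged s))) quot_relabelE.
have -> : (fun i => quot_comp (qproj (q i)) (fun j => qproj (r' i j))) =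
          (fun i => qproj (op_comp (q i) (r' i))).
  by apply: functional_extensionality_dep => i; rewrite quot_compE.
by rewrite quot_compE comp_assoc.
Qed.

Definition quot_operad : operad K :=
  @Operad K quot_sigma_module quot_one quot_comp quot_comp_linearl
    quot_comp_linearr quot_comp_relabell quot_comp_relabelr quot_comp_unitl
    quot_comp_unitr quot_comp_assoc.

End Ideals.

(* The operad < E; R >. *)
Definition presented (K : fieldType) (E : sigma2_module K)
    (R : free_operad E 'I_3 -> Prop) : operad K :=
  quot_operad (ideal_genP R).

Record sigma2_hom (K : fieldType) (E E' : sigma2_module K) := Sigma2Hom {
  s2_fun :> E -> E';
  s2_fun_linear : linear s2_fun;
  s2_fun_swap : forall e, s2_fun (s2_swap e) = s2_swap (s2_fun e) }.

Section FreeMap.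
Variables (K : fieldType) (E E' : sigma2_module K) (h : sigma2_hom E E').

Lemma teq_opmap (I : Type) (t t' : term K E I) :
  teq t t' -> teq (opmap h t) (opmap h t').
Proof.
have hlin := @s2_fun_linear K E E' h; have hsw := @s2_fun_swap K E E' h.
by elim=> //= *; rewrite ?hlin ?hsw; solve [ exact: teq_refl | exact: teq_sym
  | apply: teq_trans; eassumption
  | exact: teq_addc | exact: teq_scalec | exact: teq_opc
  | exact: teq_addA | exact: teq_addC | exact: teq_add0 | exact: teq_addN
  | exact: teq_scaleA | exact: teq_scale1 | exact: teq_scaleDr
  | exact: teq_scaleDl | exact: teq_opl | exact: teq_opr | exact: teq_ope
  | exact: teq_swap ].
Qed.

Definition term_opmap (I : finType) (t : mlterm E I) : mlterm E' I :=
  exist (fun t => ml t setT) _ (ml_opmap h (svalP t)).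

Definition free_fun (I : finType) (x : free_operad E I) : free_operad E' I :=
  fcls (term_opmap (frep x)).

Lemma free_funE (I : finType) (t : mlterm E I) :
  free_fun (fcls t) = fcls (term_opmap t).
Proof. by apply/fclsP/teq_opmap; exact: frep_cls. Qed.

Lemma free_fun_linear (I : finType) : linear (@free_fun I).
Proof.
move=> a; elim/freeP => x; elim/freeP => y.
by rewrite fcls_lin !free_funE fcls_lin; apply/fclsP/teq_refl.
Qed.

Lemma free_fun_relabel (I J : finType) (f : I -> J) (hf : bijective f)
    (x : free_operad E I) :
  free_fun (relabel hf x) = relabel hf (free_fun x).
Proof.
elim/freeP: x => x; rewrite [relabel _ _]free_relabelE !free_funE.
rewrite [RHS]free_relabelE; apply/fclsP => /=; rewrite opmap_bind.
exact: teq_refl.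
Qed.

Lemma free_fun_one : free_fun (op_one (free_operad E)) = op_one (free_operad E').
Proof. by rewrite [LHS]free_funE; apply/fclsP/teq_refl. Qed.

Lemma free_fun_comp (I : finType) (J : I -> finType) (p : free_operad E I)
    (q : forall i, free_operad E (J i)) :
  free_fun (op_comp p q) = op_comp (free_fun p) (fun i => free_fun (q i)).
Proof.
elim/freeP: p => p; elim/free_famP: q => q.
rewrite [op_comp _ _]free_compE !free_funE.
have -> : (fun i => free_fun (fcls (q i))) = (fun i => fcls (term_opmap (q i))).
  by apply: functional_extensionality_dep => i; rewrite free_funE.
rewrite [RHS]free_compE; apply/fclsP => /=; rewrite opmap_bind.
under [X in teq X _]bind_ext => i do rewrite opmap_bind.
exact: teq_refl.
Qed.

Definition free_map : operad_hom (free_operad E) (free_operad E') :=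
  OperadHom free_fun_linear free_fun_relabel free_fun_one free_fun_comp.

Variables (R : free_operad E 'I_3 -> Prop) (R' : free_operad E' 'I_3 -> Prop).
Hypothesis RR' : forall x, R x -> R' (free_map _ x).

Lemma free_map_ideal (I : finType) (x : free_operad E I) :
  ideal_gen R x -> ideal_gen R' (free_map _ x).
Proof.
move=> hx W iW RW.
apply: (hx (fun I x => W I (free_map _ x))) => [|y /RR' /RW //].
move=> {I x hx}; split=> [I|I a x y|I J f hf x|I J p q|I J p q i] /=.
- suff -> : free_fun (0 : free_operad E I) = 0 by exact: ideal0.
  have := free_fun_linear (-1) (0 : free_operad E I) 0.
  by rewrite scaler0 addr0 scaleN1r addNr.
- by rewrite free_fun_linear; exact: ideal_lin.
- by rewrite free_fun_relabel; exact: ideal_relabel.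
- by rewrite free_fun_comp; exact: ideal_compl.
- by rewrite free_fun_comp => hq; apply: (@ideal_compr _ _ _ iW I J _ _ i).
Qed.

Definition presented_fun (I : finType) (u : presented R I) : presented R' I :=
  qproj (ideal_genP R') (free_map _ (qrep u)).

Lemma presented_funE (I : finType) (x : free_operad E I) :
  presented_fun (qproj (ideal_genP R) x) = qproj (ideal_genP R') (free_map _ x).
Proof.
apply/qprojP; rewrite -scaleN1r addrC -free_fun_linear scaleN1r addrC.
by apply: free_map_ideal; exact: qrep_qproj.
Qed.

Lemma presented_fun_linear (I : finType) : linear (@presented_fun I).
Proof.
move=> a; elim/quot_carP => x; elim/quot_carP => y.
by rewrite -qproj_lin !presented_funE hom_linear qproj_lin.
Qed.

Lemma presented_fun_relabel (I J : finType) (f : I -> J) (hf : bijective f)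
    (u : presented R I) :
  presented_fun (relabel hf u) = relabel hf (presented_fun u).
Proof.
elim/quot_carP: u => x; rewrite [relabel _ _]quot_relabelE !presented_funE.
by rewrite [RHS]quot_relabelE hom_relabel.
Qed.

Lemma presented_fun_one :
  presented_fun (op_one (presented R)) = op_one (presented R').
Proof. by rewrite [LHS]presented_funE hom_one. Qed.

Lemma presented_fun_comp (I : finType) (J : I -> finType) (p : presented R I)
    (q : forall i, presented R (J i)) :
  presented_fun (op_comp p q) =
  op_comp (presented_fun p) (fun i => presented_fun (q i)).
Proof.
elim/quot_carP: p => p; elim/quot_famP: q => q.
rewrite [op_comp _ _]quot_compE !presented_funE.
have -> : (fun i => presented_fun (qproj (ideal_genP R) (q i))) =
    (fun i => qproj (ideal_genP R') (free_map _ (q i))).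
  by apply: functional_extensionality_dep => i; rewrite presented_funE.
by rewrite [RHS]quot_compE hom_comp.
Qed.

Definition presented_map : operad_hom (presented R) (presented R') :=
  OperadHom presented_fun_linear presented_fun_relabel presented_fun_one
    presented_fun_comp.

End FreeMap.

Lemma perm_bij (T : finType) (s : {perm T}) : bijective s.
Proof. by exists (s^-1)%g; [exact: permK | exact: permKV]. Qed.

Section Composite.
Variables (K : fieldType) (M N : sigma_module K).

Definition fibre (I : finType) (l : nat) (f : I -> 'I_l) (j : 'I_l) : finType :=
  {i : I | f i == j}.

Lemma refibre_subproof (I : finType) (l : nat) (f : I -> 'I_l) (s : 'S_l)
  (j : 'I_l) (u : fibre (s \o f) (s j)) : f (val u) == j.
Proof. by have := valP u; rewrite /= (inj_eq perm_inj). Qed.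

Definition refibre (I : finType) (l : nat) (f : I -> 'I_l) (s : 'S_l) (j : 'I_l)
    (u : fibre (s \o f) (s j)) : fibre f j :=
  exist _ (val u) (refibre_subproof u).

Lemma refibre_bij (I : finType) (l : nat) (f : I -> 'I_l) (s : 'S_l) (j : 'I_l) :
  bijective (@refibre I l f s j).
Proof.
have h (u : fibre f j) : (s \o f) (val u) == s j.
  by rewrite /= (inj_eq perm_inj) (valP u).
by exists (fun u => exist _ (val u) (h u)) => u; exact: val_inj.
Qed.

Variable I : finType.

Inductive cterm : Type :=
| CZero
| CAdd of cterm & cterm
| CScale of K & cterm
| CGen (l : nat) (f : I -> 'I_l) (m : M 'I_l) (n : forall j, N (fibre f j)).

(* The space at [I] of the composite product of M and N,
     (+)_l M(l) (x)_{S_l} ( (+)_{f : I -> [l]} (x)_j N(f^-1(j)) ).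
   The sum over all f, with fibres of sizes m_1, ..., m_l, is the sum of the
   induced representations Ind (N(m_1) (x) ... (x) N(m_l)); [ceq_perm] takes
   the coinvariants under S_l. *)
Inductive ceq : cterm -> cterm -> Prop :=
| ceq_refl t : ceq t t
| ceq_sym t s : ceq t s -> ceq s t
| ceq_trans t s u : ceq t s -> ceq s u -> ceq t u
| ceq_addc t t' s s' : ceq t t' -> ceq s s' -> ceq (CAdd t s) (CAdd t' s')
| ceq_scalec a t t' : ceq t t' -> ceq (CScale a t) (CScale a t')
| ceq_addA t s u : ceq (CAdd t (CAdd s u)) (CAdd (CAdd t s) u)
| ceq_addC t s : ceq (CAdd t s) (CAdd s t)
| ceq_add0 t : ceq (CAdd CZero t) t
| ceq_addN t : ceq (CAdd (CScale (-1) t) t) CZero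
| ceq_scaleA a b t : ceq (CScale a (CScale b t)) (CScale (a * b) t)
| ceq_scale1 t : ceq (CScale 1 t) t
| ceq_scaleDr a t s : ceq (CScale a (CAdd t s)) (CAdd (CScale a t) (CScale a s))
| ceq_scaleDl a b t : ceq (CScale (a + b) t) (CAdd (CScale a t) (CScale b t))
| ceq_genl l (f : I -> 'I_l) a m m' n :
    ceq (@CGen l f (a *: m + m') n) (CAdd (CScale a (@CGen l f m n)) (@CGen l f m' n))
| ceq_genr l (f : I -> 'I_l) a m n j x y :
    ceq (@CGen l f m (@dfwith _ (fun j => N (fibre f j)) n j (a *: x + y)))
        (CAdd (CScale a (@CGen l f m (@dfwith _ (fun j => N (fibre f j)) n j x)))
              (@CGen l f m (@dfwith _ (fun j => N (fibre f j)) n j y)))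
| ceq_perm l (f : I -> 'I_l) (s : 'S_l) m n :
    ceq (@CGen l (s \o f) (relabel (perm_bij s) m) n)
        (@CGen l f m (fun j => relabel (@refibre_bij I l f s j) (n (s j)))).

Definition composite_prelmod : prelmod K.
Proof.
refine (@PreLmod K cterm CZero CAdd CScale ceq _ _ _ _ _ _ _ _ _ _ _ _ _).
- exact: ceq_refl.
- exact: ceq_sym.
- exact: ceq_trans.
- exact: ceq_addc.
- exact: ceq_scalec.
- exact: ceq_addA.
- exact: ceq_addC.
- exact: ceq_add0.
- exact: ceq_addN.
- exact: ceq_scaleA.
- exact: ceq_scale1.
- exact: ceq_scaleDr.
- exact: ceq_scaleDl.
Defined.

Definition composite : lmodType K := quot composite_prelmod.

End Composite.

Arguments CZero {K M N I}.

Section Xi.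
Variables (K : fieldType) (P1 P2 P : operad K).
Variables (phi1 : operad_hom P1 P) (phi2 : operad_hom P2 P).

Section XiDef.
Variable I : finType.

Definition flat (l : nat) (f : I -> 'I_l) (u : {j : 'I_l & fibre f j}) : I :=
  val (tagged u).

Lemma flat_bij (l : nat) (f : I -> 'I_l) : bijective (@flat l f).
Proof.
pose g (i : I) : {j : 'I_l & fibre f j} :=
  existT (fun j => fibre f j : Type) (f i) (exist _ i (eqxx (f i))).
exists g => // -[j [i fi]]; rewrite /flat /g /=.
by move: (fi); rewrite -(eqP fi) => e; congr (existT _ _ _); exact: val_inj.
Qed.

Fixpoint xi_term (t : cterm P2 P1 I) : P I :=
  match t with
  | CZero => 0
  | CAdd t s => xi_term t + xi_term s
  | CScale a t => a *: xi_term t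
  | CGen l f m n =>
      relabel (flat_bij f) (op_comp (phi2 _ m) (fun j => phi1 _ (n j)))
  end.

Lemma xi_term_eq (t s : cterm P2 P1 I) : ceq t s -> xi_term t = xi_term s.
Proof.
elim=> //=.
- by move=> {}t {}s u _ -> _ ->.
- by move=> {}t t' {}s s' _ -> _ ->.
- by move=> a {}t t' _ ->.
- by move=> *; rewrite addrA.
- by move=> *; rewrite addrC.
- by move=> *; rewrite add0r.
- by move=> *; rewrite scaleN1r addNr.
- by move=> *; rewrite scalerA.
- by move=> *; rewrite scale1r.
- by move=> *; rewrite scalerDr.
- by move=> *; rewrite scalerDl.
- by move=> l f a m m' n; rewrite hom_linear comp_linearl relabel_linear.
- move=> l f a m n j x y.
  have e (z : P1 (fibre f j)) :
      (fun i => phi1 _ (@dfwith _ (fun j => P1 (fibre f j)) n j z i)) =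
      @dfwith _ (fun j => P (fibre f j)) (fun i => phi1 _ (n i)) j (phi1 _ z).
    apply: functional_extensionality_dep => i.
    by have [<-|ij] := eqVneq j i; rewrite ?dfwith_in ?dfwith_out.
  by rewrite !e hom_linear comp_linearr relabel_linear.
move=> l f {}s m n; rewrite hom_relabel.
have h1 : bijective (fun u : {j : 'I_l & fibre (s \o f) (s j)} =>
    existT (fun j => fibre (s \o f) j : Type) (s (tag u)) (tagged u)).
  pose g (u : {j : 'I_l & fibre (s \o f) j}) : {j : 'I_l & fibre (s \o f) (s j)} :=
    let i := val (tagged u) in
    existT (fun j => fibre (s \o f) (s j) : Type) (f i) (exist _ i (eqxx (s (f i)))).
  exists g => -[j [i fi]]; rewrite /g /=.
    have e := fi; rewrite /= (inj_eq perm_inj) in e; move: (fi).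
    by rewrite -(eqP e) => e'; congr (existT _ _ _); exact: val_inj.
  by move: (fi); rewrite -(eqP fi) => e'; congr (existT _ _ _); exact: val_inj.
have h2 : bijective (fun u : {j : 'I_l & fibre (s \o f) (s j)} =>
    existT (fun j => fibre f j : Type) (tag u) (refibre (tagged u))).
  have [g gK Kg] : bijective (fun u : {j : 'I_l & fibre (s \o f) (s j)} => flat (f := f)
    (existT (fun j => fibre f j : Type) (tag u) (refibre (tagged u)))).
    exists (fun i => existT (fun j => fibre (s \o f) (s j) : Type) (f i)
               (exist _ i (eqxx (s (f i))))) => // -[j [i fi]]; rewrite /flat /=.
    have e := fi; rewrite /= (inj_eq perm_inj) in e; move: (fi).
    by rewrite -(eqP e) => e'; congr (existT _ _ _); exact: val_inj.
  exists (fun v => g (flat v)) => [u|v]; first exact: gK.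
  by apply: (bij_inj (flat_bij f)); exact: Kg.
rewrite (comp_relabell _ _ _ h1).
have -> : (fun j => phi1 _ (relabel (@refibre_bij I l f s j) (n (s j)))) =
    (fun j => relabel (@refibre_bij I l f s j) (phi1 _ (n (s j)))).
  by apply: functional_extensionality_dep => j; rewrite hom_relabel.
rewrite (comp_relabelr _ _ _ h2).
have h3 := bij_comp (flat_bij (s \o f)) h1.
have h4 := bij_comp (flat_bij f) h2.
rewrite -(relabel_comp _ _ h3) -(relabel_comp _ _ h4).
by congr relabel; exact: Prop_irrelevance.
Qed.

Definition xi (u : composite P2 P1 I) : P I := xi_term (rep u).

Lemma xiE (t : cterm P2 P1 I) : xi (@cls K (composite_prelmod P2 P1 I) t) = xi_term t.
Proof. by apply: xi_term_eq; exact: (@rep_cls K (composite_prelmod P2 P1 I)). Qed.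

Lemma xi_linear : linear xi.
Proof.
move=> a; elim/quotP => t; elim/quotP => s.
by rewrite -clsZ -clsD !xiE.
Qed.

End XiDef.
End Xi.

Section Span.
Variables (K : fieldType) (M : sigma_module K) (n : nat).

Definition is_submodule (W : M 'I_n -> Prop) : Prop :=
  [/\ W 0, forall (a : K) x y, W x -> W y -> W (a *: x + y)
    & forall (s : 'S_n) x, W x -> W (relabel (perm_bij s) x)].

Definition span (X : M 'I_n -> Prop) (x : M 'I_n) : Prop :=
  forall W : M 'I_n -> Prop, is_submodule W -> (forall y, X y -> W y) -> W x.

Lemma span_gen (X : M 'I_n -> Prop) x : X x -> span X x.
Proof. by move=> Xx W _; apply. Qed.

End Span.

Section Ternary.
Variables (K : fieldType) (E : sigma2_module K).

Lemma uniq3_cover (i j k : 'I_3) : uniq [:: i; j; k] ->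
  [set i; j] :|: [set k] = [set: 'I_3].
Proof.
move=> u; apply/eqP; rewrite eqEcard subsetT cardsT card_ord /=.
have -> : [set i; j] :|: [set k] = [set x in [:: i; j; k]].
  by apply/setP => x; rewrite !inE orbA.
by rewrite cardsE (card_uniqP u).
Qed.

Lemma ml_lmon (m n : E) (i j k : 'I_3) (u : uniq [:: i; j; k]) :
  ml (Op m (Op n (@Var K E _ i) (Var j)) (Var k)) setT.
Proof.
rewrite /=; exists [set i; j], [set k]; split=> //.
- by rewrite uniq3_cover.
- move: u; rewrite /= !inE !negb_or => /and3P[/andP[_ ik] jk _].
  rewrite disjoints_subset; apply/subsetP => x.
  by rewrite !inE => /orP[] /eqP ->.
exists [set i], [set j]; split=> //.
by move: u; rewrite /= !inE negb_or disjoints1 inE => /and3P[/andP[]].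
Qed.

Lemma ml_rmon (m n : E) (i j k : 'I_3) (u : uniq [:: i; j; k]) :
  ml (Op m (@Var K E _ i) (Op n (Var j) (Var k))) setT.
Proof.
have u' : uniq [:: j; k; i] by rewrite -(rot_uniq 2).
rewrite /=; exists [set i], [set j; k]; split=> //.
- by rewrite setUC uniq3_cover.
- move: u; rewrite /= !inE !negb_or => /and3P[/andP[ij ik] _ _].
  by rewrite disjoints1 !inE negb_or ij ik.
exists [set j], [set k]; split=> //.
by move: u; rewrite /= !inE disjoints1 inE => /and3P[_ ->].
Qed.

(* The elements m(n(x_i, x_j), x_k) and m(x_i, n(x_j, x_k)). *)
Definition lmon (m n : E) (i j k : 'I_3) (u : uniq [:: i; j; k]) :
  free_operad E 'I_3 := fcls (exist (fun t => ml t setT) _ (ml_lmon m n u)).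

Definition rmon (m n : E) (i j k : 'I_3) (u : uniq [:: i; j; k]) :
  free_operad E 'I_3 := fcls (exist (fun t => ml t setT) _ (ml_rmon m n u)).

End Ternary.

Definition x1 : 'I_3 := @Ordinal 3 0 isT.
Definition x2 : 'I_3 := @Ordinal 3 1 isT.
Definition x3 : 'I_3 := @Ordinal 3 2 isT.

Section DistributiveLaws.
Variables (K : fieldType) (E1 E2 : sigma2_module K).

Definition sum_swap (e : (E1 * E2)%type) : (E1 * E2)%type :=
  (s2_swap e.1, s2_swap e.2).

Lemma sum_swap_linear : linear sum_swap.
Proof. by move=> a [x y] [x' y']; rewrite /sum_swap /= !s2_linear. Qed.

Lemma sum_swap_invol : involutive sum_swap.
Proof. by case=> x y; rewrite /sum_swap /= !s2_invol. Qed.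

Definition sum_module : sigma2_module K := Sigma2Module sum_swap_linear sum_swap_invol.

Lemma s2_swap0 (E : sigma2_module K) : s2_swap (0 : E) = 0.
Proof.
by have := @s2_linear K E (-1) 0 0; rewrite scaler0 addr0 scaleN1r addNr.
Qed.

Definition inj1_fun (e : E1) : sum_module := (e, 0).
Definition inj2_fun (e : E2) : sum_module := (0, e).

Lemma inj1_linear : linear inj1_fun.
Proof. by move=> a x y; congr pair; rewrite /= scaler0 addr0. Qed.
Lemma inj2_linear : linear inj2_fun.
Proof. by move=> a x y; congr pair; rewrite /= scaler0 addr0. Qed.
Lemma inj1_swap e : inj1_fun (s2_swap e) = s2_swap (inj1_fun e).
Proof. by congr pair; rewrite s2_swap0. Qed.
Lemma inj2_swap e : inj2_fun (s2_swap e) = s2_swap (inj2_fun e).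
Proof. by congr pair; rewrite s2_swap0. Qed.

Definition inj1 : sigma2_hom E1 sum_module := Sigma2Hom inj1_linear inj1_swap.
Definition inj2 : sigma2_hom E2 sum_module := Sigma2Hom inj2_linear inj2_swap.

Notation F3 := (free_operad sum_module 'I_3).

Definition F3_12 : F3 -> Prop := span (fun y : F3 => exists (m : E1) (n : E2),
  y = lmon (inj1 m) (inj2 n) (isT : uniq [:: x1; x2; x3]) \/
  y = rmon (inj1 m) (inj2 n) (isT : uniq [:: x1; x2; x3])).

Definition F3_21 : F3 -> Prop := span (fun y : F3 => exists (m : E2) (n : E1),
  y = lmon (inj2 m) (inj1 n) (isT : uniq [:: x1; x2; x3]) \/
  y = rmon (inj2 m) (inj1 n) (isT : uniq [:: x1; x2; x3])).

(* An equivariant linear map F(E)(3)_12 -> F(E)(3)_21, given by a function on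
   F(E)(3) whose values outside F(E)(3)_12 are irrelevant. *)
Definition rewriting_map (D : F3 -> F3) : Prop :=
  [/\ forall x, F3_12 x -> F3_21 (D x),
      forall (a : K) x y, F3_12 x -> F3_12 y -> D (a *: x + y) = a *: D x + D y
    & forall (s : 'S_3) x, F3_12 x ->
        D (relabel (perm_bij s) x) = relabel (perm_bij s) (D x)].

Variables (R1 : free_operad E1 'I_3 -> Prop) (R2 : free_operad E2 'I_3 -> Prop).

(* R1 + R_D + R2, as the submodule of F(E)(3) spanned by its three summands. *)
Definition combined_rel (D : F3 -> F3) : F3 -> Prop := span (fun y : F3 =>
  [\/ exists2 r, R1 r & y = free_map inj1 _ r,
      exists2 x, F3_12 x & y = x - D x
    | exists2 r, R2 r & y = free_map inj2 _ r]).

Definition combined (D : F3 -> F3) : operad K := presented (combined_rel D).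

Lemma combined_rel1 D r : R1 r -> combined_rel D (free_map inj1 _ r).
Proof. by move=> Rr; apply: span_gen; apply: Or31; exists r. Qed.
Lemma combined_rel2 D r : R2 r -> combined_rel D (free_map inj2 _ r).
Proof. by move=> Rr; apply: span_gen; apply: Or33; exists r. Qed.

Definition canon1 D : operad_hom (presented R1) (combined D) :=
  presented_map (@combined_rel1 D).
Definition canon2 D : operad_hom (presented R2) (combined D) :=
  presented_map (@combined_rel2 D).

Definition distributive_law (D : F3 -> F3) : Prop :=
  rewriting_map D /\
  forall n : nat, (2 <= n)%N -> bijective (@xi _ _ _ _ (canon1 D) (canon2 D) 'I_n).

Definition isomorphic_laws (D D' : F3 -> F3) : Prop :=
  operad_iso (combined D) (combined D').

End DistributiveLaws.

Section Ass.
Variable K : fieldType.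

(* The regular representation K[S_2]: (1, 0) is the generating operation and
   (0, 1) its opposite. *)
Definition reg_swap (e : (K^o * K^o)%type) : (K^o * K^o)%type := (e.2, e.1).

Lemma reg_swap_linear : linear reg_swap. Proof. by move=> a [x y] [x' y']. Qed.
Lemma reg_swap_invol : involutive reg_swap. Proof. by case. Qed.

Definition ass_gen : sigma2_module K := Sigma2Module reg_swap_linear reg_swap_invol.

Definition ass_mul : ass_gen := (1, 0).

Definition ass_rel : free_operad ass_gen 'I_3 -> Prop :=
  span (fun y : free_operad ass_gen 'I_3 =>
    y = lmon ass_mul ass_mul (isT : uniq [:: x1; x2; x3]) -
        rmon ass_mul ass_mul (isT : uniq [:: x1; x2; x3])).

Definition ass2_gen : sigma2_module K := sum_module ass_gen ass_gen.

Notation F3 := (free_operad ass2_gen 'I_3).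

Definition bul : ass2_gen := inj1 ass_gen ass_gen ass_mul.
Definition cir : ass2_gen := inj2 ass_gen ass_gen ass_mul.

Definition ass_law (D : F3 -> F3) : Prop := distributive_law ass_rel ass_rel D.

Definition ass_laws_iso (D D' : F3 -> F3) : Prop :=
  isomorphic_laws ass_rel ass_rel D D'.

(* With (x, y, z) = (x1, x2, x3). *)
Definition xy_z (m n : ass2_gen) : F3 := lmon m n (isT : uniq [:: x1; x2; x3]).
Definition x_yz (m n : ass2_gen) : F3 := rmon m n (isT : uniq [:: x1; x2; x3]).
Definition xz_y (m n : ass2_gen) : F3 := lmon m n (isT : uniq [:: x1; x3; x2]).
Definition y_xz (m n : ass2_gen) : F3 := rmon m n (isT : uniq [:: x2; x1; x3]).

Inductive rules := rule_a | rule_b | rule_c | rule_d | rule_e | rule_f | rule_g.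

(* The right-hand sides of the rules for (x o y) * z and x * (y o z), where
   o is [cir] and * is [bul]; the first argument of [xy_z], ... is the root. *)
Definition rhs_left (r : rules) : F3 :=
  match r with
  | rule_a | rule_b | rule_e => 0
  | rule_c | rule_d => x_yz cir bul
  | rule_f | rule_g => xz_y cir bul
  end.

Definition rhs_right (r : rules) : F3 :=
  match r with
  | rule_a | rule_c | rule_f => 0
  | rule_b | rule_d => xy_z cir bul
  | rule_e | rule_g => y_xz cir bul
  end.

Definition obeys (r : rules) (D : F3 -> F3) : Prop :=
  D (xy_z bul cir) = rhs_left r /\ D (x_yz bul cir) = rhs_right r.

Inductive law_class := trivial_class | truncated_class | ns_poisson_class.

Definition class_of (r : rules) : law_class :=
  match r with
  | rule_a => trivial_class
  | rule_b | rule_c | rule_e | rule_f => truncated_class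
  | rule_d | rule_g => ns_poisson_class
  end.

End Ass.

(* Main.v *)
(* A word of words, [good] below, stands for the element obtained by multiplying
   each inner word with *, then the results with o.  These normal forms span every
   combined operad obeying one of the seven systems of rules; a model on M x M, M
   a matrix algebra, tells them apart, so that xi is bijective.

   Conversely, the two images under a distributive law D of the generators of
   F(E)(3)_12 have 24 coefficients in all.  As the normal forms of arity 4 are
   independent, rewriting (x o y) * z * t, x * y * (z o t), (x o y o z) * t,
   x * (y o z o t) and (x o y) * (z o t) in two ways gives quadratic equations
   in these coefficients.  Since 2 is invertible, they force the coefficients to be
   those of one of the seven systems.

   Passing to opposite multiplications for * or o, or both, exchanges the laws
   inside each class.  The classes are told apart by the pairs of nonzero binary
   operations mu, nu with mu(nu, 1) = 0: there are none for (d), and for (b) there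
   are none such that the opposite of mu satisfies the same equation. *)
From HB Require Import structures.
Require Import Defs.
From mathcomp Require Import all_boot all_order all_algebra all_fingroup.
From mathcomp Require Import boolp ring zify.

Set Implicit Arguments.
Unset Strict Implicit.
Unset Printing Implicit Defensive.

Import GRing.Theory.
Local Open Scope ring_scope.

(** Rewriting replaces a subterm, while the relations of an operad are available only through total
    compositions. The class of a subterm is therefore taken in the component of its own set of
    variables, where substitution becomes a composition followed by a relabelling. A general law D
    comes with no algebra in which to evaluate. But the composite product does not depend on D, so
    the functionals dual to the normal words of one known law can be transported through xi to D.
    They turn each identity of arity 4 into polynomial equations in the 24 coefficients. These are
    produced by reducing trees with symbolic coefficients, a procedure run by computation and proved
    sound. Only four coefficients survive: c, f, b, e, those of the nonzero right-hand sides of (c),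
    (f), (b), (e). They are idempotent and satisfy cf = be = fb = ce = 0, so the nonzero ones lie in
    {c, b} or in {f, e}. This leaves 4 + 4 - 1 = 7 systems. *)

Lemma lin_zero (K : fieldType) (U V : lmodType K) (f : U -> V) : linear f -> f 0 = 0.
Proof. by move=> lf; have := lf (-1) 0 0; rewrite scaler0 addr0 scaleN1r addNr. Qed.

Lemma lin_sub (K : fieldType) (U V : lmodType K) (f : U -> V) (x y : U) :
  linear f -> f (x - y) = f x - f y.
Proof. by move=> lf; rewrite addrC -scaleN1r lf scaleN1r addrC. Qed.

(** * Classes of terms in free and presented operads *)

Section MultilinearTerms.
Variables (K : fieldType) (E : sigma2_module K).

Lemma ml_Op (I : finType) (e : E) (t s : term K E I) (A B : {set I}) :
  ml t A -> ml s B -> [disjoint A & B] -> ml (Op e t s) (A :|: B).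
Proof. by move=> mt ms d; exists A, B. Qed.

End MultilinearTerms.

Section FreeClasses.
Variables (K : fieldType) (E : sigma2_module K).

(** The value 0 on terms that are not multilinear makes this total, so that equations between
    classes can be written before multilinearity is proved. *)
Definition fcl (I : finType) (t : term K E I) : free_operad E I :=
  if pselect (ml t setT) is left m then fcls (exist (fun t => ml t setT) t m) else 0.

Lemma fclE (I : finType) (t : term K E I) (m : ml t setT) :
  fcl t = fcls (exist (fun t => ml t setT) t m).
Proof.
rewrite /fcl; case: pselect => // m'; congr fcls; congr exist.
exact: Prop_irrelevance.
Qed.

Lemma fcl_sval (I : finType) (t : mlterm E I) : fcl (sval t) = fcls t.
Proof. by case: t => t m; rewrite fclE. Qed.

Lemma fcl_rep (I : finType) (x : free_operad E I) : exists2 t, ml t setT & x = fcl t.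
Proof. by exists (sval (frep x)); [exact: (svalP (frep x))|rewrite fcl_sval frepK]. Qed.

Lemma fcl_teq (I : finType) (t s : term K E I) :
  ml t setT -> ml s setT -> teq t s -> fcl t = fcl s.
Proof. by move=> mt ms ts; rewrite !fclE; apply/fclsP. Qed.

Lemma fcl0 (I : finType) : fcl (Zero : term K E I) = 0.
Proof.
rewrite (@fclE I Zero Logic.I); have := fcls_lin (-1) (ml_zero E I) (ml_zero E I).
rewrite scaleN1r addNr => ->; apply/fclsP => /=; apply: teq_sym.
apply: teq_trans (teq_addc (teq_scale0 _ _ _) teq_refl) _; exact: teq_add0.
Qed.

Lemma fclD (I : finType) (t s : term K E I) :
  ml t setT -> ml s setT -> fcl (Add t s) = fcl t + fcl s.
Proof.
move=> mt ms; rewrite (fclE mt) (fclE ms) -[fcls (exist _ t mt)]scale1r fcls_lin.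
rewrite -fcl_sval /=; apply: fcl_teq => //=.
by apply: teq_addc; [exact/teq_sym/teq_scale1|exact: teq_refl].
Qed.

Lemma fclZ (I : finType) a (t : term K E I) :
  ml t setT -> fcl (Scale a t) = a *: fcl t.
Proof.
move=> mt; rewrite (fclE mt) -[RHS]addr0 -(fcl0 I) (@fclE I Zero Logic.I) fcls_lin.
rewrite -fcl_sval /=; apply: fcl_teq => //=; apply: teq_sym.
by apply: teq_trans (teq_addC _ _) _; exact: teq_add0.
Qed.

Lemma fcl_relabel (I J : finType) (f : I -> J) (hf : bijective f) (t : term K E I) :
  ml t setT -> relabel hf (fcl t) = fcl (bind t (fun i => Var (f i))).
Proof. by move=> mt; rewrite (fclE mt) [LHS]free_relabelE -fcl_sval. Qed.

Lemma fcl_comp (I : finType) (J : I -> finType) (p : term K E I)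
    (q : forall i, term K E (J i)) :
  ml p setT -> (forall i, ml (q i) setT) ->
  op_comp (fcl p) (fun i => fcl (q i)) =
  fcl (bind p (fun i => bind (q i) (fun j => Var (existT (fun i => J i : Type) i j)))).
Proof.
move=> mp mq; rewrite (fclE mp).
have -> : (fun i => fcl (q i)) = (fun i => fcls (exist (fun t => ml t setT) (q i) (mq i))).
  by apply: functional_extensionality_dep => i; rewrite (fclE (mq i)).
by rewrite [LHS]free_compE -fcl_sval.
Qed.

End FreeClasses.

Lemma fcl_map (K : fieldType) (E E' : sigma2_module K) (h : sigma2_hom E E')
  (I : finType) (t : term K E I) :
  ml t setT -> free_map h I (fcl t) = fcl (opmap h t).
Proof. by move=> mt; rewrite (fclE mt) [LHS]free_funE -fcl_sval. Qed.

Section PresentedClasses.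
Variables (K : fieldType) (E : sigma2_module K) (R : free_operad E 'I_3 -> Prop).
Notation P := (presented R).

Definition pr (I : finType) (x : free_operad E I) : P I := qproj (ideal_genP R) x.

Lemma pr_lin (I : finType) : linear (@pr I). Proof. exact: qproj_lin. Qed.

Lemma pr0 (I : finType) : pr (0 : free_operad E I) = 0.
Proof. exact/lin_zero/pr_lin. Qed.
Lemma prD (I : finType) (x y : free_operad E I) : pr (x + y) = pr x + pr y.
Proof. by have := pr_lin 1 x y; rewrite !scale1r. Qed.
Lemma prZ (I : finType) a (x : free_operad E I) : pr (a *: x) = a *: pr x.
Proof. by have := pr_lin a x 0; rewrite pr0 !addr0. Qed.
Lemma prB (I : finType) (x y : free_operad E I) : pr (x - y) = pr x - pr y.
Proof. exact/lin_sub/pr_lin. Qed.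

Lemma pr_rel (x : free_operad E 'I_3) : R x -> pr x = 0.
Proof.
by move=> Rx; rewrite -(pr0 'I_3); apply/qprojP; rewrite subr0 => W _ XW; exact: XW.
Qed.

Lemma pr_surj (I : finType) (x : P I) : exists y, x = pr y.
Proof. by exists (qrep x); rewrite /pr qrepK. Qed.

Definition cl (I : finType) (t : term K E I) : P I := pr (fcl t).

Lemma cl_rep (I : finType) (x : P I) : exists2 t, ml t setT & x = cl t.
Proof. by have [y ->] := pr_surj x; have [t mt ->] := fcl_rep y; exists t. Qed.

Lemma cl_teq (I : finType) (t s : term K E I) :
  ml t setT -> ml s setT -> teq t s -> cl t = cl s.
Proof. by move=> mt ms ts; rewrite /cl (fcl_teq mt ms ts). Qed.

Lemma cl0 (I : finType) : cl (Zero : term K E I) = 0.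
Proof. by rewrite /cl fcl0 pr0. Qed.
Lemma clD (I : finType) (t s : term K E I) :
  ml t setT -> ml s setT -> cl (Add t s) = cl t + cl s.
Proof. by move=> *; rewrite /cl fclD // prD. Qed.
Lemma clZ (I : finType) a (t : term K E I) :
  ml t setT -> cl (Scale a t) = a *: cl t.
Proof. by move=> *; rewrite /cl fclZ // prZ. Qed.

Lemma pr_relabel (I J : finType) (f : I -> J) (hf : bijective f) (x : free_operad E I) :
  relabel hf (pr x) = pr (relabel hf x).
Proof. exact: quot_relabelE. Qed.

Lemma cl_relabel (I J : finType) (f : I -> J) (hf : bijective f) (t : term K E I) :
  ml t setT -> relabel hf (cl t) = cl (bind t (fun i => Var (f i))).
Proof. by move=> mt; rewrite pr_relabel fcl_relabel. Qed.

Lemma pr_comp (I : finType) (J : I -> finType) (p : free_operad E I)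
    (q : forall i, free_operad E (J i)) :
  op_comp (pr p) (fun i => pr (q i)) = pr (op_comp p q).
Proof. exact: quot_compE. Qed.

Lemma cl_comp (I : finType) (J : I -> finType) (p : term K E I)
    (q : forall i, term K E (J i)) :
  ml p setT -> (forall i, ml (q i) setT) ->
  op_comp (cl p) (fun i => cl (q i)) =
  cl (bind p (fun i => bind (q i) (fun j => Var (existT (fun i => J i : Type) i j)))).
Proof. by move=> mp mq; rewrite pr_comp fcl_comp. Qed.

(* The class of a term whose monomials contain each variable of [A] once: it
   lives in the component indexed by the set [A] itself. *)
Definition sub (I : finType) (A : {set I}) : finType := {i : I | i \in A}.

Definition pull (I : finType) (A : {set I}) (t : term K E I) : term K E (sub A) :=
  bind t (fun i => if insub i is Some j then Var (j : sub A) else Zero).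

Lemma ml_pull (I : finType) (A : {set I}) (t : term K E I) : ml t A -> ml (pull A t) setT.
Proof.
move=> mt; suff h (u : term K E I) B : ml u B -> ml (pull A u) [set j | val j \in B].
  have := h _ _ mt; congr (ml _ _); apply/setP => j; rewrite !inE; exact: valP.
elim: u B => {mt} //=.
- move=> i B ->; rewrite /pull /=; case: insubP => [j iA ji|iA] //=.
  by apply/setP => j'; rewrite !inE -ji.
- by move=> u IHu v IHv B [/IHu ? /IHv ?].
move=> e u IHu v IHv B [C [D [-> d mu mv]]].
exists [set j | val j \in C], [set j | val j \in D]; split; [ | |exact: IHu|exact: IHv].
  by apply/setP => j; rewrite !inE.
apply/pred0P => j /=; rewrite !inE; apply/negbTE/negP => /andP[jB jC].
by have /pred0P/(_ (val j)) := d; rewrite /= jB jC.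
Qed.

Definition pcl (I : finType) (A : {set I}) (t : term K E I) : P (sub A) := cl (pull A t).

Lemma pcl_teq (I : finType) (A : {set I}) (t s : term K E I) :
  ml t A -> ml s A -> teq t s -> pcl A t = pcl A s.
Proof.
move=> mt ms ts; apply: cl_teq; [exact: ml_pull|exact: ml_pull|].
by apply: teq_bind => // i; exact: teq_refl.
Qed.

(** The component at [sub [set: I]] is a relabelling of the component at [I]. This is the way back
    from classes of subterms to elements of the operad. *)
Lemma pcl_setT (I : finType) (t s : term K E I) :
  ml t setT -> ml s setT -> pcl setT t = pcl setT s -> cl t = cl s.
Proof.
move=> mt ms ts.
have bv : bijective (fun j : sub [set: I] => val j).
  by exists (fun i => exist (fun x => x \in [set: I]) i (in_setT i)) => // j; exact: val_inj.
have e (u : term K E I) : ml u setT -> cl u = relabel bv (pcl setT u).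
  move=> mu; rewrite cl_relabel; last exact: ml_pull.
  rewrite /pull bind_bind -{1}(bind_Var u); congr (cl (bind _ _)).
  by apply/funext => i; rewrite insubT ?in_setT.
by rewrite (e _ mt) (e _ ms) ts.
Qed.

Section Comp.
Variables (I0 I : finType) (B : I0 -> {set I}) (A : {set I}).
Hypotheses (dB : forall i j, i != j -> [disjoint B i & B j]) (AB : A = \bigcup_i B i).

Lemma cover_mem (s : {i : I0 & sub (B i)}) : val (tagged s) \in A.
Proof. by rewrite AB; apply/bigcupP; exists (tag s) => //; exact: (valP (tagged s)). Qed.

Definition cover_map (s : {i : I0 & sub (B i)}) : sub A :=
  exist (fun i => i \in A) _ (cover_mem s).

Lemma cover_bij : bijective cover_map.
Proof.
have inj : injective cover_map.
  move=> [i [x xi]] [j [y yj]] /(congr1 val)/= exy; subst y.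
  have [ij|/dB/pred0P/(_ x)] := eqVneq i j; last by rewrite /= xi yj.
  by subst j; congr (existT _ _ _); exact: val_inj.
have surj (j : sub A) : exists s, cover_map s == j.
  have : val j \in \bigcup_i B i by rewrite -AB; exact: valP.
  move=> /bigcupP[i _ ji].
  exists (existT (fun i => sub (B i) : Type) i (exist (fun x => x \in B i) (val j) ji)).
  exact/eqP/val_inj.
exists (fun j => xchoose (surj j)) => [s|j]; last exact/eqP/(xchooseP (surj j)).
by apply: inj; apply/eqP/(xchooseP (surj (cover_map s))).
Qed.

(** Substitution of terms with disjoint supports is a total composition, once the disjoint union of
    the supports is identified with [A]. Equal classes may therefore be exchanged inside a
    context. *)
Lemma pcl_bind (p : term K E I0) (k : I0 -> term K E I) :
  ml p setT -> (forall i, ml (k i) (B i)) ->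
  pcl A (bind p k) = relabel cover_bij (op_comp (cl p) (fun i => pcl (B i) (k i))).
Proof.
move=> mp mk; rewrite (cl_comp mp) => [|i]; last exact: ml_pull.
rewrite cl_relabel; last exact: (ml_comp (exist (fun t => ml t setT) p mp)
  (fun i => exist (fun t => ml t setT) _ (ml_pull (mk i)))).
rewrite /pcl /pull !bind_bind; congr (cl (bind _ _)); apply/funext => i.
rewrite !bind_bind; apply: (ml_bind_out (mk i)) => l lB.
have lA : l \in A by rewrite AB; apply/bigcupP; exists i.
by rewrite !insubT /=; congr Var; exact: val_inj.
Qed.

Lemma pcl_bind_congr (p p' : term K E I0) (k k' : I0 -> term K E I) :
  ml p setT -> ml p' setT -> (forall i, ml (k i) (B i)) -> (forall i, ml (k' i) (B i)) ->
  cl p = cl p' -> (forall i, pcl (B i) (k i) = pcl (B i) (k' i)) ->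
  pcl A (bind p k) = pcl A (bind p' k').
Proof.
move=> mp mp' mk mk' pp' kk'; rewrite (pcl_bind mp mk) (pcl_bind mp' mk') pp'.
by congr (relabel _ (op_comp _ _)); exact: functional_extensionality_dep.
Qed.

End Comp.

(** The instance of [pcl_bind_congr] for a binary operation whose inputs are indexed by [bool]. *)
Lemma pcl_Op (I : finType) (e : E) (A B : {set I}) (t t' s s' : term K E I) :
  [disjoint A & B] -> ml t A -> ml t' A -> ml s B -> ml s' B ->
  pcl A t = pcl A t' -> pcl B s = pcl B s' ->
  pcl (A :|: B) (Op e t s) = pcl (A :|: B) (Op e t' s').
Proof.
move=> d mt mt' ms ms' tt' ss'.
pose c (X : Type) (x y : X) (b : bool) := if b then x else y.
have mp : ml (@Op K E bool e (Var true) (Var false)) setT.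
  exists [set true], [set false]; split=> //.
    by apply/setP => -[]; rewrite !inE.
  by rewrite disjoints1 inE.
apply: (@pcl_bind_congr _ _ (c _ A B) _ _ _ _ _ (c _ t s) (c _ t' s') mp mp) => //.
- by move=> [] [] //= _; rewrite disjoint_sym.
- by apply/setP => i; rewrite inE; apply/orP/bigcupP => [[]|[[] _]]; [exists true|exists false|left|right].
- by case.
- by case.
by case.
Qed.

Definition sub3 (T : Type) (x0 x y z : T) (i : 'I_3) : T := nth x0 [:: x; y; z] i.

(** Relations live on the variables [x1], [x2], [x3]; this makes them usable at the root of
    arbitrary terms, and [pcl_Op] carries the result into larger ones. *)
Lemma pcl_rel (I : finType) (A B C : {set I}) (t s u : term K E I) (p p' : term K E 'I_3) :
  [disjoint A & B] -> [disjoint A & C] -> [disjoint B & C] ->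
  ml t A -> ml s B -> ml u C -> ml p setT -> ml p' setT -> cl p = cl p' ->
  pcl (A :|: (B :|: C)) (bind p (sub3 Zero t s u)) =
  pcl (A :|: (B :|: C)) (bind p' (sub3 Zero t s u)).
Proof.
move=> dAB dAC dBC mt ms mu mp mp' pp'.
apply: (@pcl_bind_congr _ _ (sub3 set0 A B C)) => //.
- by case=> [[|[|[|]]] hi] // [[|[|[|]]] hj] //= _; rewrite disjoint_sym.
- by rewrite !big_ord_recl big_ord0 setU0.
- by case=> [[|[|[|]]] hi].
- by case=> [[|[|[|]]] hi].
Qed.

End PresentedClasses.

Section TermEquivalences.
Variables (K : fieldType) (E : sigma2_module K) (I : Type).
Implicit Types (e : E) (t s u : term K E I).

Lemma teq_scale_zero t : teq (Scale 0 t) Zero.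
Proof.
rewrite -(addNr (1 : K)); apply: teq_trans (teq_scaleDl _ _ _) _.
apply: teq_trans (teq_addN t); apply: teq_addc; first exact: teq_refl.
exact: teq_scale1.
Qed.

Lemma teq_addr0 t : teq (Add t Zero) t.
Proof. by apply: teq_trans (teq_addC _ _) _; exact: teq_add0. Qed.

Lemma teq_opDl e t t' s : teq (Op e (Add t t') s) (Add (Op e t s) (Op e t' s)).
Proof.
apply: (@teq_trans _ _ _ _ (Op e (Add (Scale 1 t) t') s)).
  apply: teq_opc; last exact: teq_refl.
  by apply: teq_addc; [exact/teq_sym/teq_scale1|exact: teq_refl].
apply: teq_trans (teq_opl _ _ _ _ _) _.
by apply: teq_addc; [exact: teq_scale1|exact: teq_refl].
Qed.

Lemma teq_op0l e s : teq (Op e Zero s) Zero.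
Proof.
apply: (@teq_trans _ _ _ _ (Op e (Add (Scale (-1) Zero) Zero) s)).
  by apply: teq_opc; [exact/teq_sym/teq_addN|exact: teq_refl].
by apply: teq_trans (teq_opl _ _ _ _ _) _; exact: teq_addN.
Qed.

Lemma teq_opZl e a t s : teq (Op e (Scale a t) s) (Scale a (Op e t s)).
Proof.
apply: (@teq_trans _ _ _ _ (Op e (Add (Scale a t) Zero) s)).
  by apply: teq_opc; [exact/teq_sym/teq_addr0|exact: teq_refl].
apply: teq_trans (teq_opl _ _ _ _ _) _; apply: teq_trans (teq_addr0 _).
by apply: teq_addc; [exact: teq_refl|exact: teq_op0l].
Qed.

Lemma teq_opDr e t s s' : teq (Op e t (Add s s')) (Add (Op e t s) (Op e t s')).
Proof.
apply: (@teq_trans _ _ _ _ (Op e t (Add (Scale 1 s) s'))).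
  apply: teq_opc; first exact: teq_refl.
  by apply: teq_addc; [exact/teq_sym/teq_scale1|exact: teq_refl].
apply: teq_trans (teq_opr _ _ _ _ _) _.
by apply: teq_addc; [exact: teq_scale1|exact: teq_refl].
Qed.

Lemma teq_op0r e s : teq (Op e s Zero) Zero.
Proof.
apply: (@teq_trans _ _ _ _ (Op e s (Add (Scale (-1) Zero) Zero))).
  by apply: teq_opc; [exact: teq_refl|exact/teq_sym/teq_addN].
by apply: teq_trans (teq_opr _ _ _ _ _) _; exact: teq_addN.
Qed.

Lemma teq_opZr e a t s : teq (Op e t (Scale a s)) (Scale a (Op e t s)).
Proof.
apply: (@teq_trans _ _ _ _ (Op e t (Add (Scale a s) Zero))).
  by apply: teq_opc; [exact: teq_refl|exact/teq_sym/teq_addr0].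
apply: teq_trans (teq_opr _ _ _ _ _) _; apply: teq_trans (teq_addr0 _).
by apply: teq_addc; [exact: teq_refl|exact: teq_op0r].
Qed.

Lemma teq_opeD e e' t s : teq (Op (e + e') t s) (Add (Op e t s) (Op e' t s)).
Proof.
rewrite -{1}[e]scale1r; apply: teq_trans (teq_ope _ _ _ _ _) _.
by apply: teq_addc; [exact: teq_scale1|exact: teq_refl].
Qed.

Lemma teq_ope0 t s : teq (Op (0 : E) t s) Zero.
Proof.
have -> : (0 : E) = -1 *: 0 + 0 by rewrite scaler0 addr0.
by apply: teq_trans (teq_ope _ _ _ _ _) _; exact: teq_addN.
Qed.

Lemma teq_opeZ a e t s : teq (Op (a *: e) t s) (Scale a (Op e t s)).
Proof.
rewrite -[a *: e]addr0; apply: teq_trans (teq_ope _ _ _ _ _) _.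
apply: teq_trans (teq_addr0 _); apply: teq_addc; [exact: teq_refl|exact: teq_ope0].
Qed.

End TermEquivalences.

(** * Normal forms *)

Section Combs.
Variable K : fieldType.

Fixpoint comb (E I : Type) (e : E) (ts : seq (term K E I)) : term K E I :=
  match ts with
  | [::] => Zero
  | t :: ts' => if ts' is [::] then t else Op e t (comb e ts')
  end.

Lemma comb_bind (E I J : Type) (e : E) (ts : seq (term K E I)) (k : I -> term K E J) :
  bind (comb e ts) k = comb e (map (fun t => bind t k) ts).
Proof. by elim: ts => //= t [|s ts] //= ->. Qed.

Lemma comb_opmap (E E' I : Type) (h : E -> E') (e : E) (ts : seq (term K E I)) :
  opmap h (comb e ts) = comb (h e) (map (opmap h) ts).
Proof. by elim: ts => //= t [|s ts] //= ->. Qed.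

Variables (E : sigma2_module K) (I : finType) (T : eqType).
Variables (f : T -> term K E I) (sp : T -> seq I).
Implicit Types (l : seq T) (e : E).
Notation supp l := [set i in flatten (map sp l)].

Lemma set_cat (s t : seq I) : [set i in s ++ t] = [set i in s] :|: [set i in t].
Proof. by apply/setP => i; rewrite !inE mem_cat. Qed.

Lemma disjoint_cat (s t : seq I) :
  uniq (s ++ t) -> [disjoint [set i in s] & [set i in t]].
Proof.
rewrite cat_uniq => /and3P[_ /hasPn h _]; apply/pred0P => i /=; rewrite !inE.
by apply/negbTE/negP => /andP[si /h/negP].
Qed.

Lemma ml_comb e l : l != [::] -> uniq (flatten (map sp l)) ->
  {in l, forall x, ml (f x) [set i in sp x]} -> ml (comb e (map f l)) (supp l).
Proof.
elim: l => // x [|y l] IHl _ u mf.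
  by rewrite /= cats0; apply: mf; rewrite inE.
rewrite -[flatten _]/(sp x ++ flatten (map sp (y :: l))) in u *.
rewrite set_cat; apply: ml_Op; [|apply: IHl => //|exact: disjoint_cat].
- by apply: mf; rewrite inE eqxx.
- by move: u; rewrite cat_uniq => /and3P[].
by move=> z zl; apply: mf; rewrite inE zl orbT.
Qed.

Variable R : free_operad E 'I_3 -> Prop.
Notation pcl := (@pcl K E R I).

Definition associates e := forall (A B C : {set I}) (t s u : term K E I),
  [disjoint A & B] -> [disjoint A & C] -> [disjoint B & C] ->
  ml t A -> ml s B -> ml u C ->
  pcl (A :|: (B :|: C)) (Op e (Op e t s) u) = pcl (A :|: (B :|: C)) (Op e t (Op e s u)).

(** Induction on the left word, whose first factor is split off by associativity. The factors [f x]
    with supports [sp x] are abstract so that the lemma serves at both levels: letters in a block,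
    with [sp i = [:: i]], and blocks in a normal form, with [sp = id]. *)
Lemma comb_cat e l1 l2 : associates e -> l1 != [::] -> l2 != [::] ->
  uniq (flatten (map sp (l1 ++ l2))) ->
  {in l1 ++ l2, forall x, ml (f x) [set i in sp x]} ->
  pcl (supp (l1 ++ l2)) (Op e (comb e (map f l1)) (comb e (map f l2))) =
  pcl (supp (l1 ++ l2)) (comb e (map f (l1 ++ l2))).
Proof.
move=> assoc + l2n; elim: l1 => // x [|y l1] IHl _ u mf.
  by move=> {IHl u mf}; case: l2 l2n.
set c1 := comb e (map f (y :: l1)); set c2 := comb e (map f l2).
have mfx : ml (f x) [set i in sp x] by apply: mf; rewrite inE eqxx.
have u' : uniq (flatten (map sp ((y :: l1) ++ l2))).
  by move: u; rewrite [flatten _]/(sp x ++ _) cat_uniq => /and3P[].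
have mf' : {in (y :: l1) ++ l2, forall x, ml (f x) [set i in sp x]}.
  by move=> z zl; apply: mf; rewrite cat_cons inE zl orbT.
have m1 : ml c1 (supp (y :: l1)).
  apply: ml_comb => // [|z zl]; last by apply: mf'; rewrite mem_cat zl.
  by move: u'; rewrite map_cat flatten_cat cat_uniq => /and3P[].
have m2 : ml c2 (supp l2).
  apply: ml_comb => // [|z zl]; last by apply: mf'; rewrite mem_cat zl orbT.
  by move: u'; rewrite map_cat flatten_cat cat_uniq => /and3P[].
have d12 : [disjoint supp (y :: l1) & supp l2].
  by apply: disjoint_cat; rewrite -flatten_cat -map_cat.
have dx : [disjoint [set i in sp x] & supp ((y :: l1) ++ l2)] by exact: disjoint_cat.
have e12 : supp ((y :: l1) ++ l2) = supp (y :: l1) :|: supp l2.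
  by rewrite map_cat flatten_cat set_cat.
have [dx1 dx2] : [disjoint [set i in sp x] & supp (y :: l1)] /\ [disjoint [set i in sp x] & supp l2].
  by split; apply: disjointWr dx; rewrite e12 ?subsetUl ?subsetUr.
have -> : supp ((x :: y :: l1) ++ l2) = [set i in sp x] :|: supp ((y :: l1) ++ l2).
  by rewrite -set_cat.
rewrite -[comb e (map f (x :: y :: l1))]/(Op e (f x) c1).
rewrite -[comb e (map f ((x :: y :: l1) ++ l2))]/(Op e (f x) (comb e (map f ((y :: l1) ++ l2)))).
rewrite e12 assoc // -e12; apply: pcl_Op => //.
- by rewrite e12; apply: ml_Op.
- exact: ml_comb.
by rewrite IHl.
Qed.

End Combs.

Section LinearSpan.
Variables (K : fieldType) (E : sigma2_module K) (R : free_operad E 'I_3 -> Prop).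
Variables (I : finType) (G : {set I} -> term K E I -> Prop).

(** The span is built on terms and indexed by their sets of variables, so that closure under [Op]
    can be proved by induction. Equality in the operad enters only through [lspan_pcl]. *)
Inductive lspan : {set I} -> term K E I -> Prop :=
| lspan_gen A t of G A t & ml t A : lspan A t
| lspan0 A : lspan A Zero
| lspanD A t s of lspan A t & lspan A s : lspan A (Add t s)
| lspanZ A a t of lspan A t : lspan A (Scale a t)
| lspan_pcl A t s of lspan A t & ml s A & pcl R A t = pcl R A s : lspan A s.

Lemma lspan_ml A t : lspan A t -> ml t A.
Proof. by elim. Qed.

Lemma lspan_teq A t s : lspan A t -> ml s A -> teq t s -> lspan A s.
Proof. by move=> ht ms e; apply: (lspan_pcl ht ms); apply: pcl_teq => //; exact: lspan_ml. Qed.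

(** Bilinearity reduces to products of generators. The two nested inductions run over the
    derivations of [lspan], with [pcl_Op] for the case [lspan_pcl]. *)
Lemma lspan_Op e : (forall A B t s, G A t -> ml t A -> G B s -> ml s B ->
    [disjoint A & B] -> lspan (A :|: B) (Op e t s)) ->
  forall A B t s, lspan A t -> lspan B s -> [disjoint A & B] -> lspan (A :|: B) (Op e t s).
Proof.
move=> hG A B t s ht hs d; have mt := lspan_ml ht; have ms := lspan_ml hs.
elim: ht hs ms d {mt} => {A t}.
- move=> A t Gt mt hs; elim: hs => {B s} [B s Gs ms|B|B s u hs IHs hu IHu|B a s hs IHs|B s u hs IHs mu su] + d.
  + by move=> _; exact: hG.
  + move=> _; apply: lspan_teq (lspan0 _) _ (teq_sym (teq_op0r _ _)).
    exact: ml_Op.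
  + move=> [ms mu]; apply: lspan_teq (lspanD (IHs ms d) (IHu mu d)) _ (teq_sym (teq_opDr _ _ _ _)).
    exact: ml_Op.
  + move=> ms; apply: lspan_teq (lspanZ a (IHs ms d)) _ (teq_sym (teq_opZr _ _ _ _)).
    exact: (@ml_Op _ _ _ e t (Scale a s)).
  move=> _; have ms := lspan_ml hs; apply: lspan_pcl (IHs ms d) _ _; first exact: ml_Op.
  exact: pcl_Op.
- move=> A hs ms d; apply: lspan_teq (lspan0 _) _ (teq_sym (teq_op0l _ _)).
  exact: ml_Op.
- move=> A t u ht IHt hu IHu hs ms d.
  apply: lspan_teq (lspanD (IHt hs ms d) (IHu hs ms d)) _ (teq_sym (teq_opDl _ _ _ _)).
  by apply: ml_Op => //; split; exact: lspan_ml.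
- move=> A a t ht IHt hs ms d.
  apply: lspan_teq (lspanZ a (IHt hs ms d)) _ (teq_sym (teq_opZl _ _ _ _)).
  by apply: (@ml_Op _ _ _ e (Scale a t) s) => //; exact: (lspan_ml ht).
move=> A t u ht IHt mu tu hs ms d; have mt := lspan_ml ht.
apply: lspan_pcl (IHt hs ms d) _ _; first exact: ml_Op.
exact: pcl_Op.
Qed.

Lemma lspan_all :
  (forall i, G [set i] (Var i)) ->
  (forall e A B t s, G A t -> ml t A -> G B s -> ml s B ->
    [disjoint A & B] -> lspan (A :|: B) (Op e t s)) ->
  forall A t, ml t A -> lspan A t.
Proof.
move=> hV hO A t; elim: t A => //=.
- by move=> i A ->; apply: lspan_gen.
- by move=> A _; exact: lspan0.
- by move=> t IHt s IHs A [/IHt ? /IHs ?]; exact: lspanD.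
- by move=> a t IHt A /IHt ?; exact: lspanZ.
move=> e t IHt s IHs _ [B [C [-> d /IHt ht /IHs hs]]].
exact: (lspan_Op (hO e) ht hs d).
Qed.

Lemma lspan_ind_cl (Q : presented R I -> Prop) :
  Q 0 -> (forall x y, Q x -> Q y -> Q (x + y)) -> (forall a x, Q x -> Q (a *: x)) ->
  (forall t, G setT t -> ml t setT -> Q (cl R t)) ->
  forall t, lspan setT t -> Q (cl R t).
Proof.
move=> Q0 QD QZ QG t0 ht0.
suff h A t : lspan A t -> A = setT -> Q (cl R t) by exact: h ht0 erefl.
elim=> {A t}.
- by move=> A t + + eA; rewrite eA; exact: QG.
- by move=> A _; rewrite cl0.
- move=> A t s ht + hs + eA => /(_ eA) qt /(_ eA) qs.
  rewrite eA in ht hs; rewrite clD; [exact: QD| |]; exact: lspan_ml.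
- move=> A a t ht + eA => /(_ eA) qt.
  rewrite eA in ht; rewrite clZ; [exact: QZ|exact: lspan_ml].
move=> A t s ht + ms ts eA => /(_ eA); rewrite eA in ht ms ts.
by rewrite (pcl_setT _ _ ts) //; exact: lspan_ml.
Qed.

End LinearSpan.

Lemma lmonE (K : fieldType) (E : sigma2_module K) (m n : E) (i j k : 'I_3)
  (u : uniq [:: i; j; k]) : lmon m n u = fcl (Op m (Op n (Var i) (Var j)) (Var k)).
Proof. by rewrite (fclE (ml_lmon m n u)). Qed.

Lemma rmonE (K : fieldType) (E : sigma2_module K) (m n : E) (i j k : 'I_3)
  (u : uniq [:: i; j; k]) : rmon m n u = fcl (Op m (Var i) (Op n (Var j) (Var k))).
Proof. by rewrite (fclE (ml_rmon m n u)). Qed.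

Lemma ml_comb_var (K : fieldType) (E : sigma2_module K) (I : finType) (e : E)
    (s : seq I) :
  s != [::] -> uniq s -> ml (comb e (map (@Var K E I) s)) [set i in s].
Proof.
move=> sn us; have := @ml_comb K E I I (@Var K E I) (fun i => [:: i]) e s sn.
have -> : flatten [seq [:: i] | i <- s] = s by exact: flatten_seq1.
by apply=> // i _ /=; apply/setP => j; rewrite !inE.
Qed.

Section AssociativeOperad.
Variables (K : fieldType) (I : finType).
Notation E := (ass_gen K).
Notation R := (@ass_rel K).

Lemma ass_associates : associates I R (ass_mul K).
Proof.
move=> A B C t s u dAB dAC dBC mt ms mu.
apply: (pcl_rel (p := Op (ass_mul K) (Op (ass_mul K) (Var x1) (Var x2)) (Var x3))
   (p' := Op (ass_mul K) (Var x1) (Op (ass_mul K) (Var x2) (Var x3)))) => //.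
- exact: ml_lmon.
- exact: ml_rmon.
apply/eqP; rewrite -subr_eq0 /cl -prB -lmonE -rmonE; apply/eqP/pr_rel.
exact: span_gen.
Qed.

Definition ass_word (A : {set I}) (t : term K E I) := exists2 s : seq I,
  [/\ s != [::], uniq s & A = [set i in s]] & t = comb (ass_mul K) (map Var s).

Lemma ass_lspan A t : ml t A -> lspan R ass_word A t.
Proof.
have cat (A1 A2 : {set I}) t1 t2 : ass_word A1 t1 -> ass_word A2 t2 ->
    [disjoint A1 & A2] -> lspan R ass_word (A1 :|: A2) (Op (ass_mul K) t1 t2).
  move=> [s [sn us ->] ->] [s' [sn' us' ->] ->] d.
  have u : uniq (s ++ s').
    rewrite cat_uniq us us' andbT /=; apply/hasPn => i si'; apply/negP => si.
    by have /pred0P/(_ i) := d; rewrite /= !inE si; move: si' => /= ->.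
  have n : s ++ s' != [::] by case: (s) sn.
  have m := ml_comb_var (ass_mul K) n u.
  rewrite -set_cat; apply: lspan_pcl (lspan_gen _ _ m) _ _.
  - by exists (s ++ s').
  - by rewrite set_cat; apply: ml_Op => //; exact: ml_comb_var.
  have := @comb_cat K E I I (@Var K E I) (fun i => [:: i]) R (ass_mul K) s s' ass_associates sn sn'.
  have -> : flatten [seq [:: i] | i <- s ++ s'] = s ++ s' by exact: flatten_seq1.
  by move=> -> // i _ /=; apply/setP => j; rewrite !inE.
apply: lspan_all => [i|[a b] A1 A2 t1 t2 G1 m1 G2 m2 d].
  by exists [:: i] => //; split=> //; apply/setP => j; rewrite !inE.
(* An arbitrary operation [(a, b)] is [a] times the product plus [b] times its opposite, hence a
   combination of the two concatenations. *)
have h1 := cat _ _ _ _ G1 G2 d.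
have h2 := cat _ _ _ _ G2 G1; rewrite disjoint_sym setUC in h2.
apply: (lspan_teq (lspanD (@lspanZ K _ _ _ _ _ a _ h1) (@lspanZ K _ _ _ _ _ b _ (h2 d)))); first exact: ml_Op.
have -> : (a, b) = a *: ass_mul K + b *: (s2_swap (ass_mul K)).
  by congr pair; rewrite /= ?scaler0 ?addr0 ?add0r /GRing.scale /= mulr1.
apply: teq_sym; apply: teq_trans (teq_ope _ _ _ _ _) _; apply: teq_addc; first exact: teq_refl.
by apply: teq_trans (teq_opeZ _ _ _ _) _; apply/teq_scalec/teq_swap.
Qed.

Lemma ass_ind (Q : presented R I -> Prop) :
  Q 0 -> (forall x y, Q x -> Q y -> Q (x + y)) -> (forall a x, Q x -> Q (a *: x)) ->
  (forall s : seq I, s != [::] -> uniq s -> [set i in s] = setT ->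
     Q (cl R (comb (ass_mul K) (map Var s)))) ->
  forall x, Q x.
Proof.
move=> Q0 QD QZ QG x; have [t mt ->] := cl_rep x.
apply: (lspan_ind_cl Q0 QD QZ _ (ass_lspan mt)) => _ [s [sn us es] ->] _.
exact: QG.
Qed.

End AssociativeOperad.

Section BlockWords.
Variable I : finType.
Implicit Types (bs : seq (seq I)) (A : {set I}).

Definition good bs := [&& bs != [::], [::] \notin bs & uniq (flatten bs)].
Definition supp bs : {set I} := [set i in flatten bs].

Lemma good_block bs s : good bs -> s \in bs -> s != [::] /\ uniq s.
Proof.
case/and3P=> _ ns u sbs; split; first by apply: contraNneq ns => <-.
elim: bs u sbs {ns} => //= b bs IHbs; rewrite cat_uniq inE => /and3P[ub _ /IHbs h].
by case/orP => [/eqP ->|/h].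
Qed.

Lemma block_unique bs i j k : uniq (flatten bs) ->
  (i \in nth [::] bs j) -> (i \in nth [::] bs k) -> j = k.
Proof.
elim: bs j k => [|b bs IHbs] j k /=; first by rewrite nth_nil.
have h m : i \in nth [::] bs m -> i \in flatten bs.
  move=> im; apply/flattenP; exists (nth [::] bs m) => //; apply: mem_nth.
  by rewrite ltnNge; apply: contraTN im => ?; rewrite nth_default.
rewrite cat_uniq => /and3P[_ /hasPn nb u].
case: j k => [|j] [|k] //= ij ik.
- by have /negP := nb _ (h _ ik).
- by have /negP := nb _ (h _ ij).
by rewrite (IHbs _ _ u ij ik).
Qed.

Lemma uniq_flatten_map (T T' : eqType) (g : T -> seq T') (h : T' -> T) (e : seq T) :
  uniq e -> (forall j, uniq (g j)) -> (forall j x, x \in g j -> h x = j) ->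
  uniq (flatten (map g e)).
Proof.
move=> + ug hg; elim: e => //= j e IHe /andP[je /IHe u].
rewrite cat_uniq ug u andbT /=; apply/hasPn => x /flattenP[_ /mapP[k ke ->] /hg hx].
by apply: contra je => /hg <-; rewrite hx.
Qed.

End BlockWords.

Section NormalForms.
Variables (K : fieldType) (I : finType).

Definition block (s : seq I) : term K (ass2_gen K) I := comb (bul K) (map Var s).
Definition normal (bs : seq (seq I)) : term K (ass2_gen K) I :=
  comb (cir K) (map block bs).

Lemma ml_block s : s != [::] -> uniq s -> ml (block s) [set i in s].
Proof. exact: ml_comb_var. Qed.

Lemma ml_normal bs : good bs -> ml (normal bs) (supp bs).
Proof.
move=> gbs; have /and3P[n _ u] := gbs.
have := @ml_comb K _ I _ block id (cir K) bs n; rewrite map_id; apply=> // s sbs.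
by have [? ?] := good_block gbs sbs; exact: ml_block.
Qed.

End NormalForms.

(** * A spanning set of the composite product, indexed by words of words *)

Section CompositeSpan.
Variables (K : fieldType).
Notation E := (ass_gen K).
Notation R := (@ass_rel K).
Notation P1 := (presented R).

Definition letters (J : finType) (s : seq J) := [&& s != [::], uniq s & [set i in s] == setT].

Definition wcl (J : finType) (s : seq J) : P1 J := cl R (comb (ass_mul K) (map Var s)).

Lemma ml_letters (J : finType) (s : seq J) : letters s ->
  ml (comb (ass_mul K) (map (@Var K E J) s)) setT.
Proof. by case/and3P=> sn us /eqP <-; exact: ml_comb_var. Qed.

Lemma wcl_relabel (J J' : finType) (h : J -> J') (hh : bijective h) (s : seq J) :
  letters s -> relabel hh (wcl s) = wcl (map h s).
Proof.
move=> ls; rewrite cl_relabel; last exact: ml_letters.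
by rewrite comb_bind /wcl -!map_comp.
Qed.

Lemma letters_map (J J' : finType) (h : J -> J') (s : seq J) :
  bijective h -> letters s -> letters (map h s).
Proof.
move=> hh /and3P[sn us /eqP es]; apply/and3P; split; first by case: (s) sn.
  by rewrite map_inj_uniq //; exact: bij_inj.
apply/eqP/setP => j; rewrite !inE; have [g gK Kg] := hh.
have : g j \in [set i in s] by rewrite es inE.
by rewrite inE => gs; apply/mapP; exists (g j).
Qed.

(** Serves to expand a generator of the composite product in one argument at a time: [g] is the
    dependence on that argument and [S] the span to be reached. *)
Lemma ass_lin_ind (J : finType) (V : lmodType K) (g : P1 J -> V) (S : V -> Prop) :
  linear g -> S 0 -> (forall a x y, S x -> S y -> S (a *: x + y)) ->
  (forall s, letters s -> S (g (wcl s))) -> forall x, S (g x).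
Proof.
move=> lg S0 SL Sw.
have g0 := lin_zero lg.
apply: ass_ind => [|x y Sx Sy|a x Sx|s sn us es]; first by rewrite g0.
- by rewrite -[x]scale1r lg; exact: SL.
- by rewrite -[a *: x]addr0 lg g0; exact: SL.
by apply: Sw; rewrite /letters sn us es eqxx.
Qed.

Variable I : finType.
Notation comp := (composite P1 P1 I).
Notation ccls t := (@cls K (composite_prelmod P1 P1 I) t).

(* The symmetry relation of the composite product allows the outer operation to
   be normalized to the identity word [enum 'I_l]. *)
Definition cgen (bs : seq (seq I)) (u : comp) : Prop :=
  exists (l : nat) (f : I -> 'I_l) (s : forall j, seq (fibre f j)),
  [/\ (0 < l)%N, forall j, letters (s j),
      bs = [seq map val (s j) | j <- enum 'I_l]
    & u = ccls (@CGen K P1 P1 I l f (wcl (enum 'I_l)) (fun j => wcl (s j)))].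

(** All data can be read off [bs]: [l] is its length, [f] sends a letter to the position of its
    block, and the words [s j] are its blocks. *)
Lemma cgen_unique bs u u' : cgen bs u -> cgen bs u' -> u = u'.
Proof.
move=> [l [f [s [_ ls -> ->]]]] [l' [f' [s' [_ ls' e ->]]]].
have ll' : l = l' by have := congr1 size e; rewrite !size_map -!enumT !size_enum_ord.
subst l'; have es j : map val (s j) = map val (s' j).
  by have /eq_in_map := e; apply; rewrite mem_enum.
have ff' : f = f'.
  apply/funext => i; pose x : fibre f (f i) := exist (fun i' => f i' == f i) i (eqxx _).
  have : x \in s (f i) by have /and3P[_ _ /eqP/setP/(_ x)] := ls (f i); rewrite !inE.
  move=> /(map_f val); rewrite es => /mapP[y _ /= e'].
  by have := valP y; rewrite /= -e' => /eqP.
subst f'; have -> // : s = s'.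
by apply: functional_extensionality_dep => j; apply/(inj_map val_inj)/es.
Qed.

Lemma cgen_good bs u : cgen bs u -> good bs /\ supp bs = setT.
Proof.
move=> [l [f [s [l0 ls -> _]]]]; split.
  apply/and3P; split.
  - by rewrite -size_eq0 size_map size_enum_ord -lt0n.
  - apply/mapP => -[j _ /esym/eqP]; rewrite -size_eq0 size_map size_eq0.
    by apply/negP; have /and3P[] := ls j.
  apply: (@uniq_flatten_map _ _ _ f) => [|j|j x]; first exact: enum_uniq.
    by rewrite (map_inj_uniq val_inj); have /and3P[] := ls j.
  by move=> /mapP[y _ ->]; rewrite (eqP (valP y)).
apply/setP => i; rewrite !inE; apply/flattenP.
exists (map val (s (f i))); first by apply: map_f; rewrite mem_enum.
pose x : fibre f (f i) := exist (fun i' => f i' == f i) i (eqxx _).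
have : x \in s (f i) by have /and3P[_ _ /eqP/setP/(_ x)] := ls (f i); rewrite !inE.
exact: (map_f val).
Qed.

Lemma seq_sub_lift (T : Type) (p : pred T) (s : seq T) :
  all p s -> exists s' : seq {x | p x}, map val s' = s.
Proof.
elim: s => [|x s IHs] /=; first by exists [::].
by move=> /andP[px /IHs[s' <-]]; exists (exist _ x px :: s').
Qed.

Lemma cgen_exists bs : good bs -> supp bs = setT -> exists u, cgen bs u.
Proof.
move=> gbs ebs; have /and3P[n ne u] := gbs.
have hs i : has (fun s : seq I => i \in s) bs.
  have : i \in supp bs by rewrite ebs inE.
  by rewrite inE => /flattenP[s sbs si]; apply/hasP; exists s.
have lt i : (find (fun s : seq I => i \in s) bs < size bs)%N by rewrite -has_find.
pose f i : 'I_(size bs) := Ordinal (lt i).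
have fi i : i \in nth [::] bs (f i) by exact: (nth_find [::] (hs i)).
have fj i (j : 'I_(size bs)) : i \in nth [::] bs j -> f i == j.
  by move=> ij; apply/eqP/val_inj; apply: block_unique u (fi i) ij.
have hj (j : 'I_(size bs)) : exists s : seq (fibre f j), map val s = nth [::] bs j.
  by apply: seq_sub_lift; apply/allP => i; exact: fj.
pose s j := projT1 (cid (hj j)).
have sE j : map val (s j) = nth [::] bs j by rewrite /s; case: cid.
exists (ccls (@CGen K P1 P1 I _ f (wcl (enum 'I_(size bs))) (fun j => wcl (s j)))).
exists (size bs), f, s; split=> //.
- by rewrite lt0n size_eq0.
- move=> j; have jbs : nth [::] bs j \in bs by apply: mem_nth.
  have [bn bu] := good_block gbs jbs; rewrite -sE in bn bu.
  apply/and3P; split; [by case: (s j) bn|exact: map_uniq bu|].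
  apply/eqP/setP => x; rewrite !inE -(mem_map val_inj) sE.
  by have := fi (val x); rewrite (eqP (valP x)).
have -> : [seq map val (s j) | j <- enum 'I_(size bs)] =
    [seq nth [::] bs j | j <- map val (enum 'I_(size bs))].
  by rewrite -map_comp; apply: eq_map => j; exact: sE.
by rewrite val_enum_ord -/(mkseq _ _) mkseq_nth.
Qed.

(** Each summand is stored with its word, so that the coefficients of one word can be collected
    later, in the proof that xi is injective. *)
Definition cspan (u : comp) := exists2 L : seq (K * seq (seq I) * comp),
  forall p, p \in L -> cgen p.1.2 p.2 & u = \sum_(p <- L) p.1.1 *: p.2.

Lemma cspan0 : cspan 0.
Proof. by exists [::]; rewrite ?big_nil. Qed.

Lemma cspan_lin a u v : cspan u -> cspan v -> cspan (a *: u + v).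
Proof.
move=> [L hL ->] [L' hL' ->].
exists ([seq (a * p.1.1, p.1.2, p.2) | p <- L] ++ L') => [p|].
  by rewrite mem_cat => /orP[/mapP[q /hL ? ->]|/hL'].
rewrite big_cat big_map scaler_sumr; congr (_ + _).
by apply: eq_bigr => p _; rewrite scalerA.
Qed.

Lemma cspan_all u : cspan u.
Proof.
suff h t : cspan (ccls t) by rewrite -[u](@repK K (composite_prelmod P1 P1 I)).
elim: t => [|t IHt s IHs|a t IHt|l f m n].
- exact: cspan0.
- by rewrite (clsD (S := composite_prelmod P1 P1 I)) -[ccls t]scale1r; exact: cspan_lin.
- rewrite (clsZ (S := composite_prelmod P1 P1 I)) -[a *: ccls t]addr0.
  by apply: cspan_lin => //; exact: cspan0.
pose gm (m : P1 'I_l) : comp := ccls (@CGen K P1 P1 I l f m n).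
apply: (@ass_lin_ind _ _ gm) => [a x y||a x y|tau ltau].
- rewrite /gm -(clsZ (S := composite_prelmod P1 P1 I)) -(clsD (S := composite_prelmod P1 P1 I)).
  exact/clsP/ceq_genl.
- exact: cspan0.
- exact: cspan_lin.
rewrite /gm {gm m}; move: n.
(* The list [r] contains the inner arguments still to be expanded; those outside [r] are already
   words. *)
suff h (r : seq 'I_l) : forall n : forall j, P1 (fibre f j),
    (forall j, j \notin r -> exists2 s, letters s & n j = wcl s) ->
    cspan (ccls (@CGen K P1 P1 I l f (wcl tau) n)).
  by move=> n; apply: (h (enum 'I_l)) => j; rewrite mem_enum.
elim: r => [|j0 r IHr] n hn.
  have ltau' := ltau; have /and3P[_ utau /eqP etau] := ltau'.
  have tsz : perm_eq tau (ord_tuple l).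
    apply: uniq_perm => //; first by rewrite val_ord_tuple enum_uniq.
    move=> i; rewrite val_ord_tuple mem_enum; have /setP/(_ i) := etau.
    by rewrite !inE.
  have [p pE] := tuple_permP tsz.
  have l0 : (0 < l)%N.
    by case: (l) tau ltau {utau etau tsz pE p n hn ltau' f} => // -[|[]].
  have tE : tau = map p (enum 'I_l).
    by rewrite pE /=; apply: eq_map => i; rewrite tnth_ord_tuple.
  have le : letters (enum 'I_l).
    apply/and3P; split; first by rewrite -size_eq0 size_enum_ord -lt0n.
      exact: enum_uniq.
    by apply/eqP/setP => i; rewrite !inE mem_enum.
  have -> : wcl tau = relabel (perm_bij p) (wcl (enum 'I_l)) by rewrite wcl_relabel // tE.
  (* The permutation [p] takes the identity word to [tau]. Writing [f] as [p \o f'] gives the left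
     side of [ceq_perm], which removes [p] from the outer operation at the price of relabelling the
     fibres. *)
  have ef : f = p \o ((p^-1)%g \o f) by apply/funext => i; rewrite /= permKV.
  set f' := (p^-1)%g \o f in ef; clearbody f'; subst f.
  pose n' j := relabel (@refibre_bij I l f' p j) (n (p j)).
  have -> : ccls (@CGen K P1 P1 I l (p \o f') (relabel (perm_bij p) (wcl (enum 'I_l))) n) =
     ccls (@CGen K P1 P1 I l f' (wcl (enum 'I_l)) n') by apply/clsP/ceq_perm.
  have hn' j : exists s, letters s /\ n' j = wcl s.
    have [s ls es] := hn (p j) isT; exists (map (@refibre I l f' p j) s).
    by split; [apply: letters_map => //; exact: refibre_bij|rewrite /n' es wcl_relabel].
  pose s j := projT1 (cid (hn' j)).
  have [ls es] : (forall j, letters (s j)) /\ n' = fun j => wcl (s j).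
    by split=> [j|]; [|apply: functional_extensionality_dep => j]; rewrite /s; case: cid => ? [].
  exists [:: (1, [seq map val (s j) | j <- enum 'I_l], ccls (@CGen K P1 P1 I l f' (wcl (enum 'I_l)) n'))].
    by move=> q; rewrite inE => /eqP -> /=; exists l, f', s; rewrite es.
  by rewrite big_seq1 scale1r.
pose gn (x : P1 (fibre f j0)) : comp :=
  ccls (@CGen K P1 P1 I l f (wcl tau) (@dfwith _ (fun j => P1 (fibre f j)) n j0 x)).
have -> : ccls (@CGen K P1 P1 I l f (wcl tau) n) = gn (n j0).
  rewrite /gn; congr (ccls (CGen _ _)); apply: functional_extensionality_dep => j.
  by have [<-|jj] := eqVneq j0 j; rewrite ?dfwith_in ?dfwith_out.
apply: (@ass_lin_ind _ _ gn) => [a x y||a x y|s ls].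
- rewrite /gn -(clsZ (S := composite_prelmod P1 P1 I)) -(clsD (S := composite_prelmod P1 P1 I)).
  exact/clsP/ceq_genr.
- exact: cspan0.
- exact: cspan_lin.
apply: IHr => j jr; have [<-|jj] := eqVneq j0 j.
  by exists s => //; rewrite dfwith_in.
by rewrite dfwith_out //; apply: hn; rewrite inE eq_sym negb_or jj.
Qed.

End CompositeSpan.

Section XiWords.
Variables (K : fieldType) (I : finType).
Notation E := (ass2_gen K).
Notation R := (@ass_rel K).
Variable D : free_operad E 'I_3 -> free_operad E 'I_3.
Notation RD := (combined_rel R R D).

Definition xiD : composite (presented R) (presented R) I -> presented RD I :=
  @xi _ _ _ _ (canon1 R R D) (canon2 R R D) I.

Lemma canon1_cl (J : finType) (t : term K (ass_gen K) J) : ml t setT ->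
  canon1 R R D J (cl R t) = cl RD (opmap (inj1 _ _) t).
Proof. by move=> mt; rewrite /cl -(fcl_map _ mt); exact: (presented_funE (@combined_rel1 K _ _ R R D)). Qed.

Lemma canon2_cl (J : finType) (t : term K (ass_gen K) J) : ml t setT ->
  canon2 R R D J (cl R t) = cl RD (opmap (inj2 _ _) t).
Proof. by move=> mt; rewrite /cl -(fcl_map _ mt); exact: (presented_funE (@combined_rel2 K _ _ R R D)). Qed.

(** Hence xi is surjective when the normal words span the combined operad, and injective when they
    are independent there. *)
Lemma xi_cgen bs u : cgen bs u -> xiD u = cl RD (normal K bs).
Proof.
move=> [l [f [s [l0 ls -> ->]]]].
transitivity (relabel (flat_bij f) (op_comp (canon2 R R D 'I_l (wcl K (enum 'I_l)))
    (fun j => canon1 R R D (fibre f j) (wcl K (s j))))); first exact: xiE.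
have le : letters (enum 'I_l).
  apply/and3P; split; first by rewrite -size_eq0 size_enum_ord -lt0n.
    exact: enum_uniq.
  by apply/eqP/setP => i; rewrite !inE mem_enum.
have ml2 := ml_opmap (inj2 (ass_gen K) (ass_gen K)) (ml_letters K le).
have ml1 j := ml_opmap (inj1 (ass_gen K) (ass_gen K)) (ml_letters K (ls j)).
have -> : (fun j => canon1 R R D (fibre f j) (wcl K (s j))) =
    fun j => cl RD (opmap (inj1 _ _) (comb (ass_mul K) (map Var (s j)))).
  apply: functional_extensionality_dep => j; rewrite canon1_cl //; exact: ml_letters.
rewrite canon2_cl; last exact: ml_letters.
rewrite cl_comp // cl_relabel; last first.
  exact: (ml_comp (exist (fun t => ml t setT) _ ml2)
           (fun j => exist (fun t => ml t setT) _ (ml1 j))).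
congr (cl RD _); rewrite /normal comb_opmap !comb_bind; congr comb.
elim: (enum 'I_l) => //= j r ->; congr cons.
rewrite comb_opmap /block !comb_bind; congr comb.
by elim: (s j) => //= x q ->.
Qed.

End XiWords.

(** * Evaluation in algebras *)

Section Evaluation.
Variables (K : fieldType) (E : sigma2_module K) (A : lmodType K) (op : E -> A -> A -> A).
Hypotheses (op_linl : forall e a x x' y, op e (a *: x + x') y = a *: op e x y + op e x' y)
  (op_linr : forall e a x y y', op e x (a *: y + y') = a *: op e x y + op e x y')
  (op_line : forall a e e' x y, op (a *: e + e') x y = a *: op e x y + op e' x y)
  (op_swap : forall e x y, op (s2_swap e) x y = op e y x).

Fixpoint ev (I : Type) (k : I -> A) (t : term K E I) : A :=
  match t with
  | Var i => k i
  | Zero => 0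
  | Add t s => ev k t + ev k s
  | Scale a t => a *: ev k t
  | Op e t s => op e (ev k t) (ev k s)
  end.

Lemma ev_teq (I : Type) (k : I -> A) (t s : term K E I) : teq t s -> ev k t = ev k s.
Proof.
elim=> //=.
- by move=> {}t {}s u _ -> _ ->.
- by move=> {}t t' {}s s' _ -> _ ->.
- by move=> a {}t t' _ ->.
- by move=> e {}t t' {}s s' _ -> _ ->.
- by move=> *; rewrite addrA.
- by move=> *; rewrite addrC.
- by move=> *; rewrite add0r.
- by move=> *; rewrite scaleN1r addNr.
- by move=> *; rewrite scalerA.
- by move=> *; rewrite scale1r.
- by move=> *; rewrite scalerDr.
- by move=> *; rewrite scalerDl.
Qed.

Lemma ev_bind (I J : Type) (k : J -> A) (t : term K E I) (f : I -> term K E J) :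
  ev k (bind t f) = ev (fun i => ev k (f i)) t.
Proof. by elim: t => //= [t -> s ->|a t ->|e t -> s ->]. Qed.

Lemma op0l e y : op e 0 y = 0.
Proof. by have := op_linl e (-1) 0 0 y; rewrite scaler0 addr0 scaleN1r addNr. Qed.
Lemma op0r e y : op e y 0 = 0.
Proof. by have := op_linr e (-1) y 0 0; rewrite scaler0 addr0 scaleN1r addNr. Qed.

(** Every monomial contains the variable [i]. This gives closure under composition on the right in
    [ev_ideal]. *)
Lemma ev_zero (I : finType) (k : I -> A) (t : term K E I) (B : {set I}) i :
  ml t B -> i \in B -> k i = 0 -> ev k t = 0.
Proof.
move=> + + ki; elim: t B => //=.
- by move=> j B ->; rewrite inE => /eqP <-.
- by move=> t IHt s IHs B [/IHt ht /IHs hs] iB; rewrite ht // hs // addr0.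
- by move=> a t IHt B /IHt ht iB; rewrite ht // scaler0.
move=> e t IHt s IHs _ [B [C [-> _ /IHt ht /IHs hs]]]; rewrite inE => /orP[/ht->|/hs->].
  exact: op0l.
exact: op0r.
Qed.

Definition evF (I : finType) (k : I -> A) (x : free_operad E I) : A := ev k (sval (frep x)).

Lemma evF_fcl (I : finType) (k : I -> A) (t : term K E I) :
  ml t setT -> evF k (fcl t) = ev k t.
Proof. by move=> mt; rewrite (fclE mt); apply: ev_teq; exact: frep_cls. Qed.

Lemma evF_linear (I : finType) (k : I -> A) : linear (evF k).
Proof.
move=> a x y; have [t mt ->] := fcl_rep x; have [s ms ->] := fcl_rep y.
by rewrite -fclZ // -fclD // !evF_fcl.
Qed.

Lemma evF0 (I : finType) (k : I -> A) : evF k 0 = 0.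
Proof. exact/lin_zero/evF_linear. Qed.

Lemma evFB (I : finType) (k : I -> A) x y : evF k (x - y) = evF k x - evF k y.
Proof. exact/lin_sub/evF_linear. Qed.

Lemma evF_relabel (I J : finType) (f : I -> J) (hf : bijective f) (k : J -> A)
  (x : free_operad E I) : evF k (relabel hf x) = evF (k \o f) x.
Proof.
have [t mt ->] := fcl_rep x; rewrite fcl_relabel // !evF_fcl ?ev_bind //.
exact: (svalP (term_relabel hf (exist (fun t => ml t setT) t mt))).
Qed.

Lemma evF_comp (I : finType) (J : I -> finType) (p : free_operad E I)
    (q : forall i, free_operad E (J i)) (k : {i : I & J i} -> A) :
  evF k (op_comp p q) =
  evF (fun i => evF (fun j => k (existT (fun i => J i : Type) i j)) (q i)) p.
Proof.
have [t mt ->] := fcl_rep p.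
have -> : q = fun i => fcl (sval (frep (q i))).
  by apply: functional_extensionality_dep => i; rewrite fcl_sval frepK.
have mq i : ml (sval (frep (q i))) setT by exact: (svalP (frep (q i))).
rewrite fcl_comp // !evF_fcl //; last first.
  exact: (ml_comp (exist (fun t => ml t setT) t mt) (fun i => frep (q i))).
rewrite ev_bind; congr (ev _ _); apply/funext => i.
by rewrite ev_bind evF_fcl.
Qed.

Lemma ev_ideal : is_ideal (fun (I : finType) (x : free_operad E I) => forall k, evF k x = 0).
Proof.
split.
- by move=> I k; exact: evF0.
- by move=> I a x y hx hy k; rewrite evF_linear hx hy scaler0 addr0.
- by move=> I J f hf x hx k; rewrite evF_relabel.
- by move=> I J p q hp k; rewrite evF_comp.
by move=> I J p q i hq k; rewrite evF_comp; apply: (ev_zero (svalP (frep p)) (in_setT i)); exact: hq.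
Qed.

Variable R : free_operad E 'I_3 -> Prop.
Hypothesis evR : forall x, R x -> forall k, evF k x = 0.

Definition evp (I : finType) (k : I -> A) (x : presented R I) : A := evF k (qrep x).

Lemma evp_pr (I : finType) (k : I -> A) x : evp k (pr R x) = evF k x.
Proof.
apply/eqP; rewrite -subr_eq0 -evFB; apply/eqP.
have := qrep_qproj (ideal_genP R) x.
by move/(_ _ ev_ideal evR k).
Qed.

Lemma evp_cl (I : finType) (k : I -> A) (t : term K E I) :
  ml t setT -> evp k (cl R t) = ev k t.
Proof. by move=> mt; rewrite evp_pr evF_fcl. Qed.

Lemma evp_linear (I : finType) (k : I -> A) : linear (evp k).
Proof.
move=> a x y; have [x' ->] := pr_surj x; have [y' ->] := pr_surj y.
by rewrite -prZ -prD !evp_pr evF_linear.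
Qed.

End Evaluation.

Local Notation u123 := (isT : uniq [:: x1; x2; x3]).

(** * Generators of the source and the target of a rewriting map *)

Section RewritingMaps.
Variable K : fieldType.
Notation E := (ass2_gen K).
Notation F3 := (free_operad E 'I_3).
Notation V := (@Var K E 'I_3).
Notation bul := (bul K).
Notation cir := (cir K).

Lemma perm3 (i j k : 'I_3) : uniq [:: i; j; k] ->
  exists s : 'S_3, [/\ s x1 = i, s x2 = j & s x3 = k].
Proof.
move=> u; pose g (a : 'I_3) := nth i [:: i; j; k] a.
have gi : injective g.
  have lt (a : 'I_3) : (a < size [:: i; j; k])%N by exact: ltn_ord.
  by move=> a b /eqP; rewrite (nth_uniq i (lt a) (lt b) u) => /eqP/val_inj.
by exists (perm gi); rewrite !permE.
Qed.

Lemma lmon_relabel (m n : E) (i j k : 'I_3) (u : uniq [:: i; j; k]) (s : 'S_3) :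
  s x1 = i -> s x2 = j -> s x3 = k ->
  lmon m n u = relabel (perm_bij s) (xy_z m n).
Proof.
move=> si sj sk; rewrite /xy_z !lmonE fcl_relabel; last exact: (ml_lmon m n u123).
by rewrite /= si sj sk.
Qed.

Lemma rmon_relabel (m n : E) (i j k : 'I_3) (u : uniq [:: i; j; k]) (s : 'S_3) :
  s x1 = i -> s x2 = j -> s x3 = k ->
  rmon m n u = relabel (perm_bij s) (x_yz m n).
Proof.
move=> si sj sk; rewrite /x_yz !rmonE fcl_relabel; last exact: (ml_rmon m n u123).
by rewrite /= si sj sk.
Qed.

Lemma submodule_mon (W : F3 -> Prop) (m n : E) : is_submodule W ->
  W (xy_z m n) -> W (x_yz m n) -> forall i j k (u : uniq [:: i; j; k]),
  W (lmon m n u) /\ W (rmon m n u).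
Proof.
move=> [_ _ Wr] Wx Wy i j k u; have [s [si sj sk]] := perm3 u.
by rewrite (lmon_relabel _ _ _ si sj sk) (rmon_relabel _ _ _ si sj sk); split; exact: Wr.
Qed.

Lemma fcl_ope (I : finType) (a b : K) (e e' : E) (t s : term K E I) :
  ml (Op e t s) setT ->
  fcl (Op (a *: e + b *: e') t s) = a *: fcl (Op e t s) + b *: fcl (Op e' t s).
Proof.
move=> m; rewrite -!fclZ // -fclD //; apply: fcl_teq => //.
apply: teq_trans (teq_ope _ _ _ _ _) _; apply: teq_addc; first exact: teq_refl.
exact: teq_opeZ.
Qed.

Lemma ass_genE (e : ass_gen K) :
  e = (e.1 : K) *: ass_mul K + (e.2 : K) *: s2_swap (ass_mul K).
Proof. by case: e => a b; congr pair; rewrite /= ?scaler0 ?addr0 ?add0r /GRing.scale /= mulr1. Qed.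

(** Every operation is a combination of the product and its opposite. An opposite at the inner
    vertex permutes two variables, and an opposite at the root exchanges the left and the right
    monomials; equivariance of [W] absorbs both. *)
Lemma mon_submodule (W : F3 -> Prop) (f g : sigma2_hom (ass_gen K) E) :
  is_submodule W ->
  W (xy_z (f (ass_mul K)) (g (ass_mul K))) -> W (x_yz (f (ass_mul K)) (g (ass_mul K))) ->
  forall m n, W (xy_z (f m) (g n)) /\ W (x_yz (f m) (g n)).
Proof.
move=> Wsub Wx Wy; have [W0 WL _] := Wsub.
have WC (a b : K) x y : W x -> W y -> W (a *: x + b *: y).
  by move=> hx hy; apply: (WL) => //; rewrite -[b *: y]addr0; exact: WL.
have Wm := submodule_mon Wsub Wx Wy.
set bu := f (ass_mul K) in Wx Wy Wm; set ci := g (ass_mul K) in Wx Wy Wm.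
have lin (h : sigma2_hom (ass_gen K) E) e :
    h e = (e.1 : K) *: h (ass_mul K) + (e.2 : K) *: s2_swap (h (ass_mul K)).
  rewrite -s2_fun_swap {1}(ass_genE e) s2_fun_linear; congr (_ + _).
  have h0 : h 0 = 0.
    by have := s2_fun_linear h (-1) 0 0; rewrite scaler0 addr0 scaleN1r addNr.
  by have := s2_fun_linear h (e.2 : K) (s2_swap (ass_mul K)) 0; rewrite !addr0 h0 addr0.
have Wm' (i j k : 'I_3) (u : uniq [:: i; j; k]) :
    W (fcl (Op bu (Op ci (V i) (V j)) (V k))) /\ W (fcl (Op bu (V i) (Op ci (V j) (V k)))).
  by have := Wm _ _ _ u; rewrite lmonE rmonE.
have WL1 (i j k : 'I_3) (u : uniq [:: i; j; k]) n :
    W (fcl (Op bu (Op (g n) (V i) (V j)) (V k))) /\ W (fcl (Op bu (V i) (Op (g n) (V j) (V k)))).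
  rewrite (lin g); set a := (n.1 : K); set b := (n.2 : K).
  have u2 : uniq [:: j; i; k].
    by move: u; rewrite /= !inE !negb_or (eq_sym i j) => /and3P[/andP[-> ->] -> _].
  have u3 : uniq [:: i; k; j].
    by move: u; rewrite /= !inE !negb_or (eq_sym j k) => /and3P[/andP[-> ->] -> _].
  have -> : fcl (Op bu (Op (a *: ci + b *: s2_swap ci) (V i) (V j)) (V k)) =
      a *: fcl (Op bu (Op ci (V i) (V j)) (V k)) + b *: fcl (Op bu (Op ci (V j) (V i)) (V k)).
    have m1 := ml_lmon bu ci u; have m2 := ml_lmon bu ci u2.
    rewrite -!fclZ // -fclD //; apply: fcl_teq => //.
    apply: (@teq_trans _ _ _ _ (Op bu (Add (Scale a (Op ci (V i) (V j))) (Scale b (Op ci (V j) (V i)))) (V k))).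
      apply: teq_opc; last exact: teq_refl.
      apply: teq_trans (teq_ope _ _ _ _ _) _; apply: teq_addc; first exact: teq_refl.
      by apply: teq_trans (teq_opeZ _ _ _ _) _; apply/teq_scalec/teq_swap.
    apply: teq_trans (teq_opDl _ _ _ _) _; apply: teq_addc; exact: teq_opZl.
  have -> : fcl (Op bu (V i) (Op (a *: ci + b *: s2_swap ci) (V j) (V k))) =
      a *: fcl (Op bu (V i) (Op ci (V j) (V k))) + b *: fcl (Op bu (V i) (Op ci (V k) (V j))).
    have m1 := ml_rmon bu ci u; have m2 := ml_rmon bu ci u3.
    rewrite -!fclZ // -fclD //; apply: fcl_teq => //.
    apply: (@teq_trans _ _ _ _ (Op bu (V i) (Add (Scale a (Op ci (V j) (V k))) (Scale b (Op ci (V k) (V j)))))).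
      apply: teq_opc; first exact: teq_refl.
      apply: teq_trans (teq_ope _ _ _ _ _) _; apply: teq_addc; first exact: teq_refl.
      by apply: teq_trans (teq_opeZ _ _ _ _) _; apply/teq_scalec/teq_swap.
    apply: teq_trans (teq_opDr _ _ _ _) _; apply: teq_addc; exact: teq_opZr.
  have [h1 h2] := Wm' _ _ _ u; have [h3 _] := Wm' _ _ _ u2; have [_ h4] := Wm' _ _ _ u3.
  by split; exact: WC.
move=> m n; rewrite /xy_z /x_yz !lmonE !rmonE (lin f).
set a := (m.1 : K); set b := (m.2 : K).
have u : uniq [:: x1; x2; x3] by [].
have u' : uniq [:: x3; x1; x2] by [].
have u'' : uniq [:: x2; x3; x1] by [].
have m1 := ml_lmon bu (g n) u; have m2 := ml_rmon bu (g n) u.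
have sw (t s : term K E 'I_3) : ml (Op bu t s) setT ->
    fcl (Op (s2_swap bu) t s) = fcl (Op bu s t).
  move=> mts; apply: fcl_teq => //; last exact: teq_swap.
  by have [B [C [e d mt ms]]] := mts; exists C, B; split; rewrite ?e 1?setUC // disjoint_sym.
have [h1 h2] := WL1 _ _ _ u n; have [_ h3] := WL1 _ _ _ u' n; have [h4 _] := WL1 _ _ _ u'' n.
rewrite !fcl_ope // !sw //; split; exact: WC.
Qed.

Lemma F3_12_ind (W : F3 -> Prop) : is_submodule W -> W (xy_z bul cir) ->
  W (x_yz bul cir) -> forall x, F3_12 x -> W x.
Proof.
move=> Wsub Wx Wy x; apply=> // _ [m [n [->|->]]].
  by have [] := mon_submodule (f := inj1 _ _) (g := inj2 _ _) Wsub Wx Wy m n.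
by have [] := mon_submodule (f := inj1 _ _) (g := inj2 _ _) Wsub Wx Wy m n.
Qed.

Lemma F3_21_ind (W : F3 -> Prop) : is_submodule W -> W (xy_z cir bul) ->
  W (x_yz cir bul) -> forall x, F3_21 x -> W x.
Proof.
move=> Wsub Wx Wy x; apply=> // _ [m [n [->|->]]].
  by have [] := mon_submodule (f := inj2 _ _) (g := inj1 _ _) Wsub Wx Wy m n.
by have [] := mon_submodule (f := inj2 _ _) (g := inj1 _ _) Wsub Wx Wy m n.
Qed.

Lemma span_submodule (X : F3 -> Prop) : is_submodule (Defs.span X).
Proof.
split=> [W [W0 _ _] _ //|a x y hx hy W Wsub XW|s x hx W Wsub XW].
  by have [_ WL _] := Wsub; apply: WL; [exact: hx|exact: hy].
by have [_ _ Wr] := Wsub; apply: Wr; exact: hx.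
Qed.

Lemma F3_12_xy_z : F3_12 (xy_z bul cir).
Proof. by apply: span_gen; exists (ass_mul K), (ass_mul K); left. Qed.
Lemma F3_12_x_yz : F3_12 (x_yz bul cir).
Proof. by apply: span_gen; exists (ass_mul K), (ass_mul K); right. Qed.

(* The seven systems of rules are encoded by flags: [l] and [r] tell whether
   the right-hand sides of the two rules are nonzero, and [o] whether they are
   those of (e), (f), (g) instead of those of (b), (c), (d). *)
Definition flag_lhs (l o : bool) : F3 :=
  if l then (if o then xz_y cir bul else x_yz cir bul) else 0.
Definition flag_rhs (r o : bool) : F3 :=
  if r then (if o then y_xz cir bul else xy_z cir bul) else 0.
Definition obeys_flags (l r o : bool) (D : F3 -> F3) : Prop :=
  D (xy_z bul cir) = flag_lhs l o /\ D (x_yz bul cir) = flag_rhs r o.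

Definition flags_of (r : rules) : bool * bool * bool :=
  match r with
  | rule_a => (false, false, false)
  | rule_b => (false, true, false)
  | rule_c => (true, false, false)
  | rule_d => (true, true, false)
  | rule_e => (false, true, true)
  | rule_f => (true, false, true)
  | rule_g => (true, true, true)
  end.

Lemma obeysE r D : obeys r D =
  obeys_flags (flags_of r).1.1 (flags_of r).1.2 (flags_of r).2 D.
Proof. by case: r. Qed.

End RewritingMaps.

(** * An algebra over the combined operad on pairs of elements of M *)

Section Model.
Variables (K : fieldType) (M : algType K) (C : M) (l r o : bool).
Notation E := (ass2_gen K).
Notation A := (M * M)%type.
Notation F3 := (free_operad E 'I_3).
Notation R := (@ass_rel K).

(* The first component vanishes on o-products: [bmul] reads it instead of the
   second one on the side where the rule has right-hand side 0. *)
Definition bmul (x y : A) : A :=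
  (x.1 * y.1, (if l then x.2 else x.1) * (if r then y.2 else y.1)).
(** [C] acts as a separator between blocks. Reversing the factors when [o] holds replaces the
    product by its opposite, which turns the rules (b), (c), (d) into (e), (f), (g). *)
Definition cmul (x y : A) : A := (0, if o then y.2 * C * x.2 else x.2 * C * y.2).
Definition mop (e : E) (x y : A) : A :=
  (e.1.1 : K) *: bmul x y + (e.1.2 : K) *: bmul y x +
  ((e.2.1 : K) *: cmul x y + (e.2.2 : K) *: cmul y x).

Lemma fst_lin a (x y : A) : (a *: x + y).1 = a *: x.1 + y.1.
Proof. by []. Qed.
Lemma snd_lin a (x y : A) : (a *: x + y).2 = a *: x.2 + y.2.
Proof. by []. Qed.
Lemma pair_lin a (x y : A) : a *: x + y = (a *: x.1 + y.1, a *: x.2 + y.2).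
Proof. by []. Qed.

Lemma bmul_linl a x x' y : bmul (a *: x + x') y = a *: bmul x y + bmul x' y.
Proof.
rewrite [RHS]pair_lin; congr pair; rewrite ?fst_lin ?snd_lin /=; [|case: l];
  by rewrite mulrDl scalerAl.
Qed.
Lemma bmul_linr a x y y' : bmul x (a *: y + y') = a *: bmul x y + bmul x y'.
Proof.
rewrite [RHS]pair_lin; congr pair; rewrite ?fst_lin ?snd_lin /=; [|case: r];
  by rewrite mulrDr scalerAr.
Qed.
Lemma cmul_linl a x x' y : cmul (a *: x + x') y = a *: cmul x y + cmul x' y.
Proof.
rewrite [RHS]pair_lin; congr pair; rewrite ?fst_lin ?snd_lin /=.
  by rewrite scaler0 addr0.
by case: o; rewrite ?mulrDr ?mulrDl -?scalerAr -?scalerAl.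
Qed.
Lemma cmul_linr a x y y' : cmul x (a *: y + y') = a *: cmul x y + cmul x y'.
Proof.
rewrite [RHS]pair_lin; congr pair; rewrite ?fst_lin ?snd_lin /=.
  by rewrite scaler0 addr0.
by case: o; rewrite ?mulrDr ?mulrDl -?scalerAr -?scalerAl.
Qed.

Lemma scale_lin (V : lmodType K) (a c d : K) (p p' q q' : V) :
  c *: (a *: p + p') + d *: (a *: q + q') = a *: (c *: p + d *: q) + (c *: p' + d *: q').
Proof. by rewrite !scalerDr !scalerA ![_ * a]mulrC addrACA. Qed.

Lemma mop_linl e a x x' y : mop e (a *: x + x') y = a *: mop e x y + mop e x' y.
Proof.
rewrite /mop bmul_linl bmul_linr cmul_linl cmul_linr !scale_lin.
by rewrite addrACA -scalerDr.
Qed.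

Lemma mop_linr e a x y y' : mop e x (a *: y + y') = a *: mop e x y + mop e x y'.
Proof.
rewrite /mop bmul_linl bmul_linr cmul_linl cmul_linr !scale_lin.
by rewrite addrACA -scalerDr.
Qed.

Lemma mop_line a e e' x y : mop (a *: e + e') x y = a *: mop e x y + mop e' x y.
Proof.
rewrite /mop.
change ((a *: e + e').1.1) with (a * e.1.1 + e'.1.1).
change ((a *: e + e').1.2) with (a * e.1.2 + e'.1.2).
change ((a *: e + e').2.1) with (a * e.2.1 + e'.2.1).
change ((a *: e + e').2.2) with (a * e.2.2 + e'.2.2).
rewrite !scalerDl -!scalerA [X in X + _ = _]addrACA [X in _ + X = _]addrACA.
by rewrite [LHS]addrACA -!scalerDr.
Qed.

Lemma mop_swap e x y : mop (s2_swap e) x y = mop e y x.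
Proof. by rewrite /mop /= [X in X + _ = _]addrC [X in _ + X = _]addrC. Qed.

Lemma mop_bul x y : mop (bul K) x y = bmul x y.
Proof. by rewrite /mop /= scale1r !scale0r !addr0. Qed.
Lemma mop_cir x y : mop (cir K) x y = cmul x y.
Proof. by rewrite /mop /= scale1r !scale0r !addr0 add0r. Qed.

Lemma bmulA x y z : bmul (bmul x y) z = bmul x (bmul y z).
Proof. by rewrite /bmul; congr pair; case: l; case: r; rewrite /= !mulrA. Qed.
Lemma cmulA x y z : cmul (cmul x y) z = cmul x (cmul y z).
Proof. by rewrite /cmul; congr pair; case: o; rewrite /= !mulrA. Qed.

Notation mev := (@evF K E A mop 'I_3).

(** Meant for [h x = x - D x]: as [D] is linear and equivariant only on [F3_12], membership in [W]
    has to be carried along with the vanishing. *)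
Lemma mev_submodule (h : F3 -> F3) (W : F3 -> Prop) : is_submodule W ->
  (forall a x y, W x -> W y -> h (a *: x + y) = a *: h x + h y) ->
  (forall (s : 'S_3) x, W x -> h (relabel (perm_bij s) x) = relabel (perm_bij s) (h x)) ->
  is_submodule (fun x => W x /\ forall k, mev k (h x) = 0).
Proof.
move=> [W0 WL Wr] hL hr; split=> [|a x y [Wx hx] [Wy hy]|s x [Wx hx]].
- split=> // k; have := hL (-1) 0 0 W0 W0; rewrite !scaler0 !addr0 scaleN1r addNr => ->.
  exact: evF0 mop_linl mop_linr mop_line mop_swap _ _.
- by split=> [|k]; [exact: WL|rewrite hL // (evF_linear mop_linl mop_linr mop_line mop_swap) hx hy scaler0 addr0].
by split=> [|k]; [exact: Wr|rewrite hr // (evF_relabel mop_linl mop_linr mop_line mop_swap)].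
Qed.

Variable D : F3 -> F3.
Hypotheses (rD : rewriting_map D) (fD : obeys_flags l r o D).

Lemma model_sat x : combined_rel R R D x -> forall k, mev k x = 0.
Proof.
pose evE := evF_fcl mop_linl mop_linr mop_line mop_swap.
pose evB := evFB mop_linl mop_linr mop_line mop_swap.
have assoc (h : sigma2_hom (ass_gen K) E) (y : free_operad (ass_gen K) 'I_3) :
    (forall a b c, mop (h (ass_mul K)) (mop (h (ass_mul K)) a b) c =
      mop (h (ass_mul K)) a (mop (h (ass_mul K)) b c)) ->
    R y -> forall k, mev k (free_map h _ y) = 0.
  move=> ha Ry; apply: (Ry (fun y => forall k, mev k (free_map h _ y) = 0)) => [|_ -> k].
    split=> [k|a u v hu hv k|s u hu k].
    - have := hom_linear (free_map h) (-1) (0 : free_operad _ 'I_3) 0.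
      rewrite !scaler0 !addr0 scaleN1r addNr => ->.
      exact: evF0 mop_linl mop_linr mop_line mop_swap _ _.
    - by rewrite hom_linear (evF_linear mop_linl mop_linr mop_line mop_swap) hu hv scaler0 addr0.
    by rewrite hom_relabel (evF_relabel mop_linl mop_linr mop_line mop_swap).
  have mL := ml_lmon (ass_mul K) (ass_mul K) u123.
  have mR := ml_rmon (ass_mul K) (ass_mul K) u123.
  rewrite addrC -scaleN1r hom_linear lmonE rmonE (fcl_map h mL) (fcl_map h mR).
  have mL' := ml_opmap h mL; have mR' := ml_opmap h mR.
  by rewrite scaleN1r addrC evB (evE _ _ _ mL') (evE _ _ _ mR') /= ha subrr.
move=> hx; apply: (hx (fun x => forall k, mev k x = 0)) => [|y].
  split=> [k|a u v hu hv k|s u hu k].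
  - exact: evF0 mop_linl mop_linr mop_line mop_swap _ _.
  - by rewrite (evF_linear mop_linl mop_linr mop_line mop_swap) hu hv scaler0 addr0.
  by rewrite (evF_relabel mop_linl mop_linr mop_line mop_swap).
case=> [[z Rz ->]|[z Fz ->]|[z Rz ->]].
- by apply: assoc Rz => a b c; rewrite !mop_bul bmulA.
- move: z Fz.
  suff h z : F3_12 z -> F3_12 z /\ forall k, mev k (z - D z) = 0.
    by move=> z /h[].
  have [_ DL Dr] := rD; have [DLx DRx] := fD.
  apply: (@F3_12_ind K (fun z => F3_12 z /\ forall k, mev k (z - D z) = 0)).
  + apply: (mev_submodule (h := fun z => z - D z)); first exact: span_submodule.
      move=> a u v Fu Fv /=; rewrite DL // opprD scalerBr -scalerN; exact: addrACA.
    by move=> s u Fu /=; rewrite Dr //; apply: esym; exact: (@relabelB K (free_operad E)).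
  + split=> [|k]; first exact: F3_12_xy_z.
    rewrite DLx evB /xy_z lmonE (evE _ _ _ (ml_lmon _ _ u123)) /= mop_bul mop_cir.
    rewrite /flag_lhs; case el: l; last first.
      rewrite (evF0 mop_linl mop_linr mop_line mop_swap) subr0 /bmul el.
      by rewrite !mul0r.
    case eo: o; rewrite /xz_y /x_yz ?(lmonE, rmonE) evE /= ?mop_bul ?mop_cir.
    - by rewrite /bmul /cmul el eo /= mul0r mulrA subrr.
    - exact: (ml_lmon (cir K) (bul K) (isT : uniq [:: x1; x3; x2])).
    - by rewrite /bmul /cmul el eo /= mul0r mulrA subrr.
    exact: (ml_rmon (cir K) (bul K) u123).
  split=> [|k]; first exact: F3_12_x_yz.
  rewrite DRx evB /x_yz rmonE (evE _ _ _ (ml_rmon _ _ u123)) /= mop_bul mop_cir.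
  rewrite /flag_rhs; case er: r; last first.
    rewrite (evF0 mop_linl mop_linr mop_line mop_swap) subr0 /bmul er.
    by rewrite !mulr0.
  case eo: o; rewrite /y_xz /xy_z ?(lmonE, rmonE) evE /= ?mop_bul ?mop_cir.
  - by rewrite /bmul /cmul er eo /= mulr0 !mulrA subrr.
  - exact: (ml_rmon (cir K) (bul K) (isT : uniq [:: x2; x1; x3])).
  - by rewrite /bmul /cmul er eo /= mulr0 !mulrA subrr.
  exact: (ml_lmon (cir K) (bul K) u123).
by apply: assoc Rz => a b c; rewrite !mop_cir cmulA.
Qed.

End Model.

(** * Independence of the normal forms *)

Section PathMatrices.
Variables (K : fieldType) (T : eqType) (w : seq (option T)).
Notation M := 'M[K]_((size w).+1).

(* Edges of the path 0 -> 1 -> ... -> size w, the i-th one being labelled by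
   the i-th letter of [w]: a product of letters links 0 to [size w] only if it
   spells [w]. *)
Definition path_mx (a : option T) : M :=
  \matrix_(i, j) ((j == i.+1 :> nat) && (nth None w i == a))%:R.

Lemma path_mx_prod (v : seq (option T)) (i : 'I_(size w).+1) :
  (\prod_(a <- v) path_mx a) i ord_max = (v == drop i w)%:R.
Proof.
elim: v i => [|a v IHv] i.
  rewrite big_nil mxE; congr (nat_of_bool _)%:R.
  rewrite -val_eqE /= eq_sym -[RHS]eq_sym -size_eq0 size_drop subn_eq0.
  by rewrite eq_sym eqn_leq -ltnS ltn_ord.
rewrite big_cons mxE; have [iw|wi] := ltnP i (size w); last first.
  rewrite big1 => [|j _].
    by rewrite drop_oversize.
  rewrite mxE; case: eqP => [e|_]; last by rewrite mul0r.
  by have := ltn_ord j; rewrite e ltnS ltnNge wi.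
pose j0 : 'I_(size w).+1 := Ordinal (iw : i.+1 < (size w).+1)%N.
rewrite (bigD1 j0) //= [X in _ + X]big1 => [|j ji]; last first.
  by rewrite mxE; move: ji; rewrite -(inj_eq val_inj) /= => /negbTE ->; rewrite mul0r.
rewrite addr0 mxE eqxx IHv /= (drop_nth None iw) eqseq_cons (eq_sym a).
by case: eqP; rewrite ?mul1r ?mul0r.
Qed.

End PathMatrices.

Section Spelling.
Variable I : eqType.

(** The word that the model reads off a normal form: [None] is the separator, standing for the
    matrix [C], and the blocks come in reverse order when [o] reverses the second product. *)
Fixpoint spell (o : bool) (bs : seq (seq I)) : seq (option I) :=
  match bs with
  | [::] => [::]
  | b :: bs' => if bs' is [::] then map Some b
    else if o then spell o bs' ++ None :: map Some b
    else map Some b ++ None :: spell o bs'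
  end.

Lemma spell_inj0 bs bs' : bs != [::] -> bs' != [::] ->
  spell false bs = spell false bs' -> bs = bs'.
Proof.
have end1 (b b' : seq I) z : map Some b = map Some b' ++ None :: z -> False.
  move=> e; have : None \in map Some b by rewrite e mem_cat inE eqxx orbT.
  by case/mapP.
have split (b b' : seq I) z z' :
    map Some b ++ None :: z = map Some b' ++ None :: z' -> b = b' /\ z = z'.
  by elim: b b' => [|x b IHb] [|x' b'] //= [] // -> /IHb[-> ->].
elim: bs bs' => // b [|c bs] IHbs [|b' [|c' bs']] // _ _.
- by move=> /= /(inj_map (@Some_inj _)) ->.
- by move=> /end1.
- by move=> /esym/end1.
by move=> /split[-> e]; rewrite (IHbs (c' :: bs')).
Qed.

(** Reduces injectivity for [o = true] to the case without reversal. *)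
Lemma spell_rev bs : spell true bs = rev (spell false (map rev bs)).
Proof.
elim: bs => // b [|c bs] IHbs /=; first by rewrite -map_rev revK.
by rewrite rev_cat rev_cons cat_rcons -map_rev revK -IHbs.
Qed.

Lemma spell_inj o bs bs' : bs != [::] -> bs' != [::] ->
  spell o bs = spell o bs' -> bs = bs'.
Proof.
case: o => n n'; last exact: spell_inj0.
rewrite !spell_rev => /(can_inj (@revK _)) e.
apply: (inj_map (can_inj (@revK I))); apply: spell_inj0 e; [by case: (bs) n|by case: (bs') n'].
Qed.

End Spelling.

Section Coefficient.
Variables (K : fieldType) (l r o : bool) (D : free_operad (ass2_gen K) 'I_3 -> free_operad (ass2_gen K) 'I_3).
Hypotheses (rD : rewriting_map D) (fD : obeys_flags l r o D).
Notation R := (@ass_rel K).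
Notation RD := (combined_rel R R D).
Variable I : finType.

Section Matrices.
Variable w : seq (option I).
Notation M := 'M[K]_((size w).+1).

Definition letter_val (i : I) : M * M := (path_mx K w (Some i), path_mx K w (Some i)).
Notation op := (mop (path_mx K w None) l r o).
Notation evw := (ev op letter_val).

Lemma ev_block (s : seq I) : s != [::] ->
  evw (block K s) = (\prod_(i <- s) path_mx K w (Some i), \prod_(i <- s) path_mx K w (Some i)).
Proof.
elim: s => // i [|j s] IHs _; first by rewrite !big_seq1.
rewrite -[evw _]/(op (bul K) (letter_val i) (evw (block K (j :: s)))) IHs //.
by rewrite mop_bul [in RHS]big_cons /bmul; case: l; case: r.
Qed.

Lemma ev_normal (bs : seq (seq I)) : bs != [::] -> [::] \notin bs ->
  (evw (normal K bs)).2 = \prod_(a <- spell o bs) path_mx K w a.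
Proof.
elim: bs => // b [|c bs] IHbs _; rewrite in_cons negb_or eq_sym => /andP[bn bsn].
  by rewrite /= ev_block // big_map.
rewrite -[evw _]/(op (cir K) (evw (block K b)) (evw (normal K (c :: bs)))).
rewrite mop_cir /cmul /= ev_block // IHbs //=.
by case: o; rewrite big_cat /= big_cons !big_map mulrA.
Qed.

End Matrices.

(** The functional dual to the normal word [bs]: the path of the model is labelled by the spelling
    of [bs] itself, so that among products of letters only this spelling links its two ends. *)
Definition coef (bs : seq (seq I)) (x : presented RD I) : K :=
  (evp (mop (path_mx K (spell o bs) None) l r o) (@letter_val (spell o bs)) x).2 ord0 ord_max.

Lemma coef_linear bs : linear (coef bs : _ -> K^o).
Proof.
move=> a x y; rewrite /coef.
rewrite (evp_linear (@mop_linl _ _ _ l r o) (@mop_linr _ _ _ l r o) (@mop_line _ _ _ l r o)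
  (@mop_swap _ _ _ l r o) (model_sat _ rD fD)).
by rewrite snd_lin !mxE.
Qed.

Lemma coef_normal bs bs' : good bs -> good bs' -> supp bs' = setT ->
  coef bs (cl RD (normal K bs')) = (bs' == bs)%:R.
Proof.
move=> gbs gbs' sbs'; have /and3P[n ne _] := gbs; have /and3P[n' ne' _] := gbs'.
have := ml_normal K gbs'; rewrite sbs' => m'.
rewrite /coef (evp_cl (@mop_linl _ _ _ l r o) (@mop_linr _ _ _ l r o) (@mop_line _ _ _ l r o)
  (@mop_swap _ _ _ l r o) (model_sat _ rD fD) _ m').
rewrite ev_normal // path_mx_prod drop0; congr (nat_of_bool _)%:R.
by apply/eqP/eqP => [/(spell_inj n' n)|->].
Qed.

Lemma coef0 bs : coef bs 0 = 0.
Proof. exact: (lin_zero (coef_linear bs)). Qed.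

Lemma coef_sum bs (T : Type) (L : seq T) (f : T -> K) (g : T -> presented RD I) :
  coef bs (\sum_(p <- L) f p *: g p) = \sum_(p <- L) f p * coef bs (g p).
Proof.
elim: L => [|p L IHL]; first by rewrite !big_nil coef0.
by rewrite !big_cons coef_linear IHL.
Qed.

Lemma xi_inj : injective (@xiD K I D).
Proof.
have xiL : linear (@xiD K I D) by exact: xi_linear.
have xi0 : xiD D 0 = 0 :> presented RD I by exact: (lin_zero xiL).
suff h u : @xiD K I D u = 0 -> u = 0.
  move=> u v uv; apply/eqP; rewrite -subr_eq0; apply/eqP/h.
  by rewrite (lin_sub _ _ xiL) uv subrr.
have [L hL ->] := cspan_all u => xu0.
(* A word may occur several times in [L]. By [cgen_unique] its occurrences carry the same element
   [gen bs], so the sum can be grouped by words; the total coefficient of each word is then read by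
   [coef]. *)
pose words := undup [seq p.1.2 | p <- L].
pose gen bs : composite _ _ I := if pselect (exists u, @cgen K I bs u) is left h then projT1 (cid h) else 0.
have genE p : p \in L -> p.2 = gen p.1.2.
  move=> pL; rewrite /gen; case: pselect => [h|[]]; last by exists p.2; exact: hL.
  by case: cid => v /= hv; apply: cgen_unique (hL _ pL) hv.
rewrite (eq_big_seq (fun p => p.1.1 *: gen p.1.2)) => [|p pL]; last by rewrite -genE.
rewrite (eq_big_seq (fun p => \sum_(bs <- words | bs == p.1.2) p.1.1 *: gen bs)) => [|p pL]; last first.
  rewrite -big_filter filter_pred1_uniq ?undup_uniq ?big_seq1 // mem_undup.
  by apply: map_f.
rewrite (exchange_big_dep xpredT) //=; apply: big1_seq => bs /andP[_ bsw].
rewrite -scaler_suml.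
have [p pL ebs] : exists2 p, p \in L & bs = p.1.2.
  by move: bsw; rewrite mem_undup => /mapP.
have [gbs sbs] : good bs /\ supp bs = setT by rewrite ebs; exact: cgen_good (hL _ pL).
have : coef bs (xiD D (\sum_(p <- L) p.1.1 *: p.2)) = 0 by rewrite xu0 coef0.
have -> : xiD D (\sum_(p <- L) p.1.1 *: p.2) = \sum_(p <- L) p.1.1 *: cl RD (normal K p.1.2).
  transitivity (\sum_(p <- L) p.1.1 *: xiD D p.2).
    by elim: (L) => [|q L' IHL]; rewrite ?big_nil // !big_cons xiL IHL.
  by apply: eq_big_seq => q qL; rewrite (xi_cgen D (hL _ qL)).
rewrite coef_sum => e.
suff -> : \sum_(p <- L | bs == p.1.2) p.1.1 = 0 by rewrite scale0r.
rewrite -[RHS]e big_mkcond; apply: eq_big_seq => q qL.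
have [gq sq] := cgen_good (hL _ qL).
by rewrite coef_normal // eq_sym; case: eqP; rewrite ?mulr1 ?mulr0.
Qed.

End Coefficient.

(** * The normal forms span *)

Lemma disjoint_setU (I : finType) (A B C : {set I}) :
  [disjoint A :|: B & C] = [disjoint A & C] && [disjoint B & C].
Proof. by rewrite -!setI_eq0 setIUl setU_eq0. Qed.

Section CombinedRelations.
Variables (K : fieldType) (D : free_operad (ass2_gen K) 'I_3 -> free_operad (ass2_gen K) 'I_3).
Notation E := (ass2_gen K).
Notation R := (@ass_rel K).
Notation RD := (combined_rel R R D).
Notation V := (@Var K E 'I_3).

Lemma cl_rewrite (x : free_operad E 'I_3) : F3_12 x -> pr RD x = pr RD (D x).
Proof.
move=> Fx; apply/eqP; rewrite -subr_eq0 -prB; apply/eqP/pr_rel.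
by apply: span_gen; apply: Or32; exists x.
Qed.

Lemma cl_assoc (h : sigma2_hom (ass_gen K) E) :
  (forall r, R r -> RD (free_map h _ r)) ->
  cl RD (Op (h (ass_mul K)) (Op (h (ass_mul K)) (V x1) (V x2)) (V x3)) =
  cl RD (Op (h (ass_mul K)) (V x1) (Op (h (ass_mul K)) (V x2) (V x3))).
Proof.
move=> hR; apply/eqP; rewrite -subr_eq0 /cl -prB; apply/eqP/pr_rel.
have Rg : R (lmon (ass_mul K) (ass_mul K) u123 - rmon (ass_mul K) (ass_mul K) u123).
  exact: span_gen.
have := hR _ Rg; rewrite (lin_sub _ _ (hom_linear (I:='I_3) (free_map h))).
rewrite lmonE rmonE (fcl_map h (ml_lmon (ass_mul K) (ass_mul K) u123)).
by rewrite (fcl_map h (ml_rmon (ass_mul K) (ass_mul K) u123)).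
Qed.

Lemma bul_associates (I : finType) : associates I RD (bul K).
Proof.
move=> A B C t s u dAB dAC dBC mt ms mu.
apply: (pcl_rel (p := Op (bul K) (Op (bul K) (V x1) (V x2)) (V x3))
   (p' := Op (bul K) (V x1) (Op (bul K) (V x2) (V x3)))) => //.
- exact: (ml_lmon (bul K) (bul K)).
- exact: (ml_rmon (bul K) (bul K)).
by apply: (cl_assoc (h := inj1 _ _)) => y; exact: combined_rel1.
Qed.

Lemma cir_associates (I : finType) : associates I RD (cir K).
Proof.
move=> A B C t s u dAB dAC dBC mt ms mu.
apply: (pcl_rel (p := Op (cir K) (Op (cir K) (V x1) (V x2)) (V x3))
   (p' := Op (cir K) (V x1) (Op (cir K) (V x2) (V x3)))) => //.
- exact: (ml_lmon (cir K) (cir K)).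
- exact: (ml_rmon (cir K) (cir K)).
by apply: (cl_assoc (h := inj2 _ _)) => y; exact: combined_rel2.
Qed.

Section Substitution.
Variables (I : finType) (A B C : {set I}) (t s u : term K E I).
Hypotheses (dAB : [disjoint A & B]) (dAC : [disjoint A & C]) (dBC : [disjoint B & C])
  (mt : ml t A) (ms : ml s B) (mu : ml u C).

Lemma pcl_lhs (p : term K E 'I_3) : ml p setT ->
  D (xy_z (bul K) (cir K)) = fcl p ->
  pcl RD (A :|: (B :|: C)) (Op (bul K) (Op (cir K) t s) u) =
  pcl RD (A :|: (B :|: C)) (bind p (sub3 Zero t s u)).
Proof.
move=> mp Dp; apply: (pcl_rel (p := Op (bul K) (Op (cir K) (V x1) (V x2)) (V x3))) => //.
  exact: (ml_lmon (bul K) (cir K)).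
by rewrite /cl -Dp -(cl_rewrite (@F3_12_xy_z K)) /xy_z lmonE.
Qed.

Lemma pcl_rhs (p : term K E 'I_3) : ml p setT ->
  D (x_yz (bul K) (cir K)) = fcl p ->
  pcl RD (A :|: (B :|: C)) (Op (bul K) t (Op (cir K) s u)) =
  pcl RD (A :|: (B :|: C)) (bind p (sub3 Zero t s u)).
Proof.
move=> mp Dp; apply: (pcl_rel (p := Op (bul K) (V x1) (Op (cir K) (V x2) (V x3)))) => //.
  exact: (ml_rmon (bul K) (cir K)).
by rewrite /cl -Dp -(cl_rewrite (@F3_12_x_yz K)) /x_yz rmonE.
Qed.

End Substitution.

Section NormalSpan.
Variables (l r o : bool).
Hypothesis fD : obeys_flags l r o D.
Variable I : finType.
Implicit Types (A : {set I}) (bs : seq (seq I)).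

Definition is_normal A (t : term K E I) :=
  exists2 bs, good bs /\ supp bs = A & t = normal K bs.
Notation span := (lspan RD is_normal).

Lemma span_normal bs : good bs -> span (supp bs) (normal K bs).
Proof. by move=> g; apply: lspan_gen; [exists bs|exact: ml_normal]. Qed.

Lemma good1 (b : seq I) : good [:: b] = (b != [::]) && uniq b.
Proof. by rewrite /good [flatten _]cats0 mem_seq1 (eq_sym [::]). Qed.
Lemma supp1 (b : seq I) : supp [:: b] = [set i in b].
Proof. by rewrite /supp [flatten _]cats0. Qed.

Lemma good_cat bs bs' : good bs -> good bs' ->
  [disjoint supp bs & supp bs'] -> good (bs ++ bs').
Proof.
move=> /and3P[n nn u] /and3P[n' nn' u'] d; apply/and3P; split.
- by case: (bs) n.
- by rewrite mem_cat negb_or nn.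
rewrite flatten_cat cat_uniq u u' andbT; apply/hasPn => i ib'; apply/negP => ib.
by have /pred0P/(_ i) := d; rewrite /= !inE ib ib'.
Qed.

Lemma good_cons b c bs : good (b :: c :: bs) ->
  [/\ good [:: b], good (c :: bs), [disjoint supp [:: b] & supp (c :: bs)]
    & supp (b :: c :: bs) = supp [:: b] :|: supp (c :: bs)].
Proof.
move=> g; have /and3P[_ + u] := g; rewrite in_cons negb_or => /andP[bn bsn].
have u' := u; rewrite [flatten _]/(b ++ flatten (c :: bs)) in u'.
split.
- by rewrite good1 eq_sym bn; move: u'; rewrite cat_uniq => /andP[].
- by rewrite /good /= bsn; move: u'; rewrite cat_uniq => /and3P[].
- by rewrite supp1; exact: disjoint_cat.
by rewrite supp1 -set_cat.
Qed.

Lemma span_cir A B t s : span A t -> span B s -> [disjoint A & B] ->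
  span (A :|: B) (Op (cir K) t s).
Proof.
apply: lspan_Op => {A B t s} _ _ _ _ [bs [g <-] ->] m [bs' [g' <-] ->] m' d.
have gc := good_cat g g' d; have /and3P[n _ _] := g; have /and3P[n' _ _] := g'.
have eU : supp (bs ++ bs') = supp bs :|: supp bs' by rewrite /supp flatten_cat set_cat.
rewrite -eU; apply: lspan_pcl (span_normal gc) _ _.
  by rewrite eU; exact: ml_Op.
have := @comb_cat K E I _ (@block K I) id RD (cir K) bs bs' (@cir_associates I) n n'.
rewrite !map_id => -> //; first by have /and3P[] := gc.
by move=> b /(good_block gc)[? ?]; exact: ml_block.
Qed.

Lemma span_block1 b c : good [:: b] -> good [:: c] -> [disjoint supp [:: b] & supp [:: c]] ->
  span (supp [:: b] :|: supp [:: c]) (Op (bul K) (block K b) (block K c)).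
Proof.
move=> gb gc d; have [bn bu] : b != [::] /\ uniq b by apply: (good_block gb); rewrite inE.
have sb := supp1 b.
have [cn cu] : c != [::] /\ uniq c by apply: (good_block gc); rewrite inE.
have sc := supp1 c.
have ubc : uniq (b ++ c).
  by have /and3P[] := good_cat gb gc d; move=> _ _; rewrite -[flatten _]/(b ++ (c ++ [::])) cats0.
have gbc : good [:: b ++ c].
  by rewrite good1 ubc andbT; case: (b) bn.
have eU : supp [:: b ++ c] = supp [:: b] :|: supp [:: c].
  by rewrite sb sc -set_cat supp1.
rewrite -eU; apply: lspan_pcl (span_normal gbc) _ _.
  by rewrite eU; apply: ml_Op => //; rewrite ?sb ?sc; exact: ml_block.
have := @comb_cat K E I _ (@Var K E I) (fun i => [:: i]) RD (bul K) b c (@bul_associates I) bn cn.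
have -> : flatten [seq [:: i] | i <- b ++ c] = b ++ c by exact: flatten_seq1.
have -> : [set i in b ++ c] = supp [:: b ++ c] by rewrite supp1.
by move=> -> // i _ /=; apply/setP => j; rewrite !inE.
Qed.

(** Induction on the number of blocks. For a first block c followed by the rest s, the right rule
    turns b * (c o s) into 0, into (b * c) o s, or into c o (b * s), where the induction hypothesis
    applies. *)
Lemma span_block b bs : good [:: b] -> good bs -> [disjoint supp [:: b] & supp bs] ->
  span (supp [:: b] :|: supp bs) (Op (bul K) (block K b) (normal K bs)).
Proof.
move=> gb; have mb : ml (block K b) (supp [:: b]) by exact: (ml_normal K gb).
elim: bs => // c [|c' bs] IHbs gbs d; first exact: span_block1.
have [gc gbs' dc sc] := good_cons gbs.
have [d1 d2] : [disjoint supp [:: b] & supp [:: c]] /\ [disjoint supp [:: b] & supp (c' :: bs)].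
  by rewrite sc in d; split; apply: disjointWr d; rewrite ?subsetUl ?subsetUr.
have mc : ml (block K c) (supp [:: c]) by exact: (ml_normal K gc).
have mbs := ml_normal K gbs'; have {}IHbs := IHbs gbs' d2.
have spc : span (supp [:: c]) (block K c) by exact: (span_normal gc).
have spbs := span_normal gbs'.
rewrite sc; set t := Op _ _ _.
have mt : ml t (supp [:: b] :|: (supp [:: c] :|: supp (c' :: bs))).
  by rewrite -sc; apply: ml_Op => //; exact: (ml_normal K gbs).
have [_ fr] := fD; rewrite /flag_rhs in fr.
have key p := pcl_rhs d1 d2 dc mb mc mbs (p := p).
case: r fr => [|fr]; last first.
  by apply: lspan_pcl (lspan0 _ _ _) mt _; rewrite [RHS](key Zero) // fcl0.
case: o => fr.
  have m := ml_rmon (cir K) (bul K) (isT : uniq [:: x2; x1; x3]).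
  rewrite /y_xz rmonE in fr.
  apply: lspan_pcl _ mt (esym (key _ m fr)); rewrite setUCA; apply: span_cir => //.
  by rewrite disjoint_sym disjoint_setU d1 disjoint_sym dc.
have m := ml_lmon (cir K) (bul K) u123.
rewrite /xy_z lmonE in fr.
apply: lspan_pcl _ mt (esym (key _ m fr)); rewrite setUA; apply: span_cir => //.
  exact: span_block1.
by rewrite disjoint_setU d2.
Qed.

(** The left rule peels the blocks off the left factor in the same way, until a single block is left
    and [span_block] applies. *)
Lemma span_bul A B t s : span A t -> span B s -> [disjoint A & B] ->
  span (A :|: B) (Op (bul K) t s).
Proof.
apply: lspan_Op => {A B t s} _ _ _ _ [bs [g <-] ->] _ [bs' [g' <-] ->] _.
elim: bs g => // b [|c bs] IHbs gbs d; first exact: span_block.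
have [gb gc dbc sbc] := good_cons gbs.
have [d1 d2] : [disjoint supp [:: b] & supp bs'] /\ [disjoint supp (c :: bs) & supp bs'].
  by move: d; rewrite sbc disjoint_setU => /andP[].
have mb : ml (block K b) (supp [:: b]) by exact: (ml_normal K gb).
have mc := ml_normal K gc; have m' := ml_normal K g'.
have spb : span (supp [:: b]) (block K b) by exact: (span_normal gb).
have spc := span_normal gc; have {}IHbs := IHbs gc d2.
rewrite sbc -setUA; set t := Op _ _ _.
have mt : ml t (supp [:: b] :|: (supp (c :: bs) :|: supp bs')).
  by rewrite setUA -sbc; apply: ml_Op => //; exact: (ml_normal K gbs).
have [fl _] := fD; rewrite /flag_lhs in fl.
have key p := pcl_lhs dbc d1 d2 mb mc m' (p := p).
case: l fl => [|fl]; last first.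
  by apply: lspan_pcl (lspan0 _ _ _) mt _; rewrite [RHS](key Zero) // fcl0.
case: o => fl.
  have m := ml_lmon (cir K) (bul K) (isT : uniq [:: x1; x3; x2]).
  rewrite /xz_y lmonE in fl.
  apply: lspan_pcl _ mt (esym (key _ m fl)).
  rewrite [supp (c :: bs) :|: _]setUC setUA; apply: span_cir => //.
    exact: span_block.
  by rewrite disjoint_setU dbc disjoint_sym.
have m := ml_rmon (cir K) (bul K) u123.
rewrite /x_yz rmonE in fl.
apply: lspan_pcl _ mt (esym (key _ m fl)); apply: span_cir => //.
by rewrite disjoint_sym disjoint_setU disjoint_sym dbc disjoint_sym.
Qed.

Lemma normal_span A t : ml t A -> span A t.
Proof.
apply: lspan_all => [i|[[a a'] [b b']] B C {}t s Gt mt Gs ms d].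
  exists [:: [:: i]] => //; split; first by rewrite good1.
  by rewrite supp1; apply/setP => j; rewrite !inE.
have ht := lspan_gen RD Gt mt; have hs := lspan_gen RD Gs ms.
have d' : [disjoint C & B] by rewrite disjoint_sym.
have h1 := span_bul ht hs d; have h2 := span_bul hs ht d'.
have h3 := span_cir ht hs d; have h4 := span_cir hs ht d'.
rewrite setUC in h2; rewrite setUC in h4.
have m : ml (@Op K E I ((a, a'), (b, b')) t s) (B :|: C) by exact: ml_Op.
apply: (lspan_teq (lspanD (lspanD (@lspanZ K _ _ _ _ _ a _ h1) (@lspanZ K _ _ _ _ _ a' _ h2))
  (lspanD (@lspanZ K _ _ _ _ _ b _ h3) (@lspanZ K _ _ _ _ _ b' _ h4))) m).
have -> : ((a, a'), (b, b')) = ((a : K) *: bul K + (a' : K) *: s2_swap (bul K)) +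
    ((b : K) *: cir K + (b' : K) *: s2_swap (cir K)) :> E.
  by congr pair; congr pair; rewrite /= ?mulr0 ?addr0 ?add0r /GRing.scale /= ?mulr1 ?mulr0 ?addr0 ?add0r.
apply: teq_sym; apply: teq_trans (teq_opeD _ _ _ _) _.
apply: teq_addc; apply: teq_trans (teq_ope _ _ _ _ _) _; apply: teq_addc.
- exact: teq_refl.
- by apply: teq_trans (teq_opeZ _ _ _ _) _; apply/teq_scalec/teq_swap.
- exact: teq_refl.
by apply: teq_trans (teq_opeZ _ _ _ _) _; apply/teq_scalec/teq_swap.
Qed.

Lemma xi_surj (y : presented RD I) : exists u, @xiD K I D u = y.
Proof.
have xiL : linear (@xiD K I D) by exact: xi_linear.
have [t mt ->] := cl_rep y.
apply: (lspan_ind_cl (Q := fun y => exists u, @xiD K I D u = y)) (normal_span mt).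
- by exists 0; exact: (lin_zero xiL).
- by move=> _ _ [u <-] [v <-]; exists (1 *: u + v); rewrite xiL scale1r.
- by move=> a _ [u <-]; exists (a *: u + 0); rewrite xiL (lin_zero xiL) addr0.
move=> _ [bs [g sbs] ->] _; have [u cu] := cgen_exists K g sbs.
by exists u; exact: xi_cgen.
Qed.

End NormalSpan.
End CombinedRelations.

Lemma inj_surj_bij (T T' : Type) (f : T -> T') :
  injective f -> (forall y, exists x, f x = y) -> bijective f.
Proof.
move=> fi fs; pose g y := projT1 (cid (fs y)).
have gK y : f (g y) = y by rewrite /g; case: cid.
by exists g => // x; apply: fi; rewrite gK.
Qed.

Theorem obeys_flags_law (K : fieldType) (l r o : bool) D :
  rewriting_map D -> obeys_flags l r o D -> @ass_law K D.
Proof.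
move=> rD fD; split=> // n _; apply: (@inj_surj_bij _ _ (@xiD K 'I_n D)).
  exact: (xi_inj rD fD).
exact: (xi_surj fD).
Qed.

(** * Rewriting maps with prescribed values *)

Section RewritingMapExistence.
Variable K : fieldType.
Notation E := (ass2_gen K).
Notation F3 := (free_operad E 'I_3).
Notation A := 'rV[K]_7.

(* The only nonzero products of basis vectors are e0 o e1 = e3, e1 o e2 = e4,
   e3 * e2 = e5 and e0 * e4 = e6, so that evaluating the variables at e0, e1, e2
   reads off the coefficients of (x1 o x2) * x3 (in e5) and x1 * (x2 o x3) (in e6). *)
Definition probe (c : 'I_7) : bool * 'I_7 * 'I_7 :=
  match nat_of_ord c with
  | 3 => (false, inord 0, inord 1)
  | 4 => (false, inord 1, inord 2)
  | 5 => (true, inord 3, inord 2)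
  | _ => (true, inord 0, inord 4)
  end.

(** The test [c < 3] cuts off the last case of [probe] at the indices 0, 1, 2: the coordinates e0,
    e1, e2 of a product are 0. *)
Definition probe_op (e : E) (x y : A) : A := \row_c
  let: (b, i, j) := probe c in
  if (c < 3)%N then 0 else
  (if b then e.1.1 : K else e.2.1) * (x 0 i * y 0 j) +
  (if b then e.1.2 : K else e.2.2) * (y 0 i * x 0 j).

Lemma probe_linl e a x x' y : probe_op e (a *: x + x') y = a *: probe_op e x y + probe_op e x' y.
Proof.
apply/rowP => c; rewrite !mxE; case: probe => [[b i] j].
case: ifP => _; rewrite ?mulr0 ?addr0 // !mxE.
by move: (if b then _ else _ : K) (if b then _ else _ : K) => p q; ring.
Qed.
Lemma probe_linr e a x y y' : probe_op e x (a *: y + y') = a *: probe_op e x y + probe_op e x y'.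
Proof.
apply/rowP => c; rewrite !mxE; case: probe => [[b i] j].
case: ifP => _; rewrite ?mulr0 ?addr0 // !mxE.
by move: (if b then _ else _ : K) (if b then _ else _ : K) => p q; ring.
Qed.
Lemma probe_line a e e' x y : probe_op (a *: e + e') x y = a *: probe_op e x y + probe_op e' x y.
Proof.
apply/rowP => c; rewrite !mxE; case: probe => [[b i] j].
case: ifP => _; rewrite ?mulr0 ?addr0 // mulrDr addrACA !mulrA -!mulrDl.
by case: b.
Qed.
Lemma probe_swap e x y : probe_op (s2_swap e) x y = probe_op e y x.
Proof.
apply/rowP => c; rewrite !mxE; case: probe => [[b i] j].
by case: ifP => _ //; case: b; rewrite /= addrC.
Qed.

Let evl := evF_linear probe_linl probe_linr probe_line probe_swap.
Let evr := evF_relabel probe_linl probe_linr probe_line probe_swap.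
Let evf := evF_fcl probe_linl probe_linr probe_line probe_swap.

Definition unit_at (s : 'S_3) (i : 'I_3) : A := delta_mx 0 (inord (s i)).

(** The inverse makes the variable [s i] take the value e_i. So [c = 5] and [c = 6] read the
    coefficients of the translates by [s] of the two generators of [F3_12]. *)
Definition reading (c : 'I_7) (s : 'S_3) (x : F3) : K :=
  evF probe_op (unit_at s^-1) x 0 c.

Lemma reading_relabel c (s t : 'S_3) x :
  reading c s (relabel (perm_bij t) x) = reading c (s * t^-1)%g x.
Proof.
rewrite /reading evr (_ : _ \o _ = unit_at (s * t^-1)^-1) //.
by apply/funext => i; rewrite /unit_at /= invMg invgK permM.
Qed.

(** The translates of the two generators are independent, as the readings show; each is sent to the
    same translate of [L] or [R]. This is linear by construction, and equivariant by reindexing the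
    sum. *)
Definition rewriting_of (L R : F3) (x : F3) : F3 := \sum_(s : 'S_3)
  (reading (inord 5) s x *: relabel (perm_bij s) L +
   reading (inord 6) s x *: relabel (perm_bij s) R).

Lemma bul_coord : ((bul K).1.1 = 1 :> K) * ((bul K).1.2 = 0 :> K) *
  ((bul K).2.1 = 0 :> K) * ((bul K).2.2 = 0 :> K).
Proof. by []. Qed.
Lemma cir_coord : ((cir K).1.1 = 0 :> K) * ((cir K).1.2 = 0 :> K) *
  ((cir K).2.1 = 1 :> K) * ((cir K).2.2 = 0 :> K).
Proof. by []. Qed.

Lemma probe_bul x y :
  (probe_op (bul K) x y 0 (inord 5) = x 0 (inord 3) * y 0 (inord 2)) *
  (probe_op (bul K) x y 0 (inord 6) = x 0 (inord 0) * y 0 (inord 4)).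
Proof. by rewrite !mxE /probe !inordK //= ?bul_coord ?cir_coord ?mul1r ?mul0r ?addr0. Qed.

Lemma probe_cir x y :
  (probe_op (cir K) x y 0 (inord 3) = x 0 (inord 0) * y 0 (inord 1)) *
  (probe_op (cir K) x y 0 (inord 4) = x 0 (inord 1) * y 0 (inord 2)) *
  (probe_op (cir K) x y 0 (inord 0) = 0).
Proof. by rewrite !mxE /probe !inordK //= ?bul_coord ?cir_coord ?mul1r ?mul0r ?addr0. Qed.

Lemma unit_atE (s : 'S_3) i k : (k < 7)%N -> unit_at s i 0 (inord k) = (s i == k :> nat)%:R.
Proof.
move=> k7; rewrite mxE eqxx /= -val_eqE /= inordK // inordK; last exact: ltn_trans (ltn_ord _) _.
by rewrite eq_sym.
Qed.

Lemma unit_at_big (s : 'S_3) i k : (k < 7)%N -> (3 <= k)%N -> unit_at s i 0 (inord k) = 0.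
Proof.
by move=> k7 k3; rewrite unit_atE // ltn_eqF // (leq_trans (ltn_ord _)).
Qed.

Lemma unit_at_prod (s : 'S_3) :
  unit_at s x1 0 (inord 0) * unit_at s x2 0 (inord 1) * unit_at s x3 0 (inord 2) =
  (s == 1%g)%:R.
Proof.
rewrite !unit_atE //; have [->|/eqP s1] := eqVneq s 1%g.
  by rewrite !perm1 !mul1r.
case: eqP => e1; last by rewrite !mul0r.
case: eqP => e2; last by rewrite mulr0 mul0r.
case: eqP => e3; last by rewrite mulr0.
case: s1; apply/permP => -[[|[|[|]]] hi] //; rewrite perm1; apply/val_inj => /=.
- by rewrite -[RHS]e1; congr (val (s _)); exact: val_inj.
- by rewrite -[RHS]e2; congr (val (s _)); exact: val_inj.
by rewrite -[RHS]e3; congr (val (s _)); exact: val_inj.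
Qed.

Lemma reading_gen (s : 'S_3) :
  (reading (inord 5) s (xy_z (bul K) (cir K)) = (s == 1%g)%:R) *
  (reading (inord 6) s (xy_z (bul K) (cir K)) = 0) *
  (reading (inord 5) s (x_yz (bul K) (cir K)) = 0) *
  (reading (inord 6) s (x_yz (bul K) (cir K)) = (s == 1%g)%:R).
Proof.
rewrite /reading /xy_z /x_yz lmonE rmonE.
rewrite (evf _ (ml_lmon (bul K) (cir K) u123)) (evf _ (ml_rmon (bul K) (cir K) u123)) /=.
rewrite !probe_bul !probe_cir (@unit_at_big _ _ 3) // !mul0r mulrA unit_at_prod.
by rewrite -eq_invg1 invgK.
Qed.

Lemma span_sum (X : F3 -> Prop) (T : finType) (f : T -> F3) :
  (forall s, Defs.span X (f s)) -> Defs.span X (\sum_s f s).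
Proof.
move=> hf; have [S0 SL _] := span_submodule X.
by elim/big_rec: _ => // s x _ hx; rewrite -[f s]scale1r; exact: SL.
Qed.

Lemma rewriting_ofP (L R : F3) : F3_21 L -> F3_21 R -> rewriting_map (rewriting_of L R).
Proof.
move=> hL hR; split=> [x _|a x y _ _|t x _].
- have [S0 SL Sr] : is_submodule (@F3_21 K (ass_gen K) (ass_gen K)) by exact: span_submodule.
  apply: span_sum => s.
  apply: (SL); first exact: Sr.
  by rewrite -[_ *: _]addr0; apply: SL => //; exact: Sr.
- rewrite /rewriting_of scaler_sumr -big_split; apply: eq_bigr => s _.
  by rewrite /reading !evl !mxE /= !scalerDr !scalerA !scalerDl addrACA.
rewrite [LHS](reindex_inj (mulIg t)).
pose rl := relabel_linear (perm_bij t) : linear (relabel (perm_bij t) : F3 -> F3).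
transitivity (\sum_(s : 'S_3) relabel (perm_bij t)
  (reading (inord 5) s x *: relabel (perm_bij s) L + reading (inord 6) s x *: relabel (perm_bij s) R)).
  apply: eq_bigr => s _; rewrite !reading_relabel mulgK rl.
  have e (z : F3) : relabel (perm_bij (s * t)%g) z = relabel (perm_bij t) (relabel (perm_bij s) z).
    have h : bijective (t \o s) by apply: bij_comp; exact: perm_bij.
    rewrite -(relabel_comp _ _ h).
    have st : (s * t)%g = t \o s :> ('I_3 -> 'I_3) by apply/funext => i; rewrite permM.
    move: (perm_bij (s * t)%g) h; rewrite st => h h'.
    by congr relabel; exact: Prop_irrelevance.
  have rZ b (z : F3) : relabel (perm_bij t) (b *: z) = b *: relabel (perm_bij t) z.
    by rewrite -[b *: z]addr0 rl (lin_zero rl) addr0.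
  by rewrite !e rZ.
rewrite /rewriting_of; elim: (index_enum _) => [|s q IHq]; first by rewrite !big_nil (lin_zero rl).
have rD (u v : F3) : relabel (perm_bij t) (u + v) = relabel (perm_bij t) u + relabel (perm_bij t) v.
  by have := rl 1 u v; rewrite !scale1r.
by rewrite !big_cons IHq [RHS]rD.
Qed.

Lemma rewriting_of_xy_z (L R : F3) : rewriting_of L R (xy_z (bul K) (cir K)) = L.
Proof.
rewrite /rewriting_of (bigD1 1%g) //= !reading_gen eqxx scale1r scale0r addr0.
rewrite big1 => [|s /negbTE s1]; last by rewrite !reading_gen s1 !scale0r addr0.
rewrite addr0; have h : bijective (@id 'I_3) by exists id.
rewrite -[RHS](relabel_id h); move: (perm_bij _).
have -> : (1%g : 'S_3) = id :> ('I_3 -> 'I_3) by apply/funext => i; rewrite perm1.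
by move=> h'; rewrite (Prop_irrelevance h' h).
Qed.

Lemma rewriting_of_x_yz (L R : F3) : rewriting_of L R (x_yz (bul K) (cir K)) = R.
Proof.
rewrite /rewriting_of (bigD1 1%g) //= !reading_gen eqxx scale1r scale0r add0r.
rewrite big1 => [|s /negbTE s1]; last by rewrite !reading_gen s1 !scale0r addr0.
rewrite addr0; have h : bijective (@id 'I_3) by exists id.
rewrite -[RHS](relabel_id h); move: (perm_bij _).
have -> : (1%g : 'S_3) = id :> ('I_3 -> 'I_3) by apply/funext => i; rewrite perm1.
by move=> h'; rewrite (Prop_irrelevance h' h).
Qed.

Lemma obeys_flags_exists (l r o : bool) :
  exists D : F3 -> F3, rewriting_map D /\ obeys_flags l r o D.
Proof.
have sub : is_submodule (@F3_21 K (ass_gen K) (ass_gen K)) by exact: span_submodule.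
have [S0 _ _] := sub.
have Wx : F3_21 (xy_z (cir K) (bul K)).
  by apply: span_gen; exists (ass_mul K), (ass_mul K); left.
have Wy : F3_21 (x_yz (cir K) (bul K)).
  by apply: span_gen; exists (ass_mul K), (ass_mul K); right.
have h := submodule_mon sub Wx Wy.
exists (rewriting_of (flag_lhs K l o) (flag_rhs K r o)); split.
  apply: rewriting_ofP.
    by rewrite /flag_lhs; case: l; case: o => //; have [] := h _ _ _ (isT : uniq [:: x1; x3; x2]).
  by rewrite /flag_rhs; case: r; case: o => //; have [] := h _ _ _ (isT : uniq [:: x2; x1; x3]).
by split; [exact: rewriting_of_xy_z|exact: rewriting_of_x_yz].
Qed.

End RewritingMapExistence.

(** * Classification of the distributive laws *)

(* The twelve monomials spanning F(E)(3)_21: the first six have the block on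
   the left of [ci], the last six on the right. *)
Definition shape (T : Type) (bu ci : T -> T -> T) (j : nat) (x y z : T) : T :=
  let: (a, b, c) := match (j %% 6)%N with
    | 0 => (x, y, z) | 1 => (x, z, y) | 2 => (y, x, z)
    | 3 => (y, z, x) | 4 => (z, x, y) | _ => (z, y, x) end in
  if (j < 6)%N then ci (bu a b) c else ci a (bu b c).

Lemma shape_morph (T T' : Type) (bu ci : T -> T -> T) (bu' ci' : T' -> T' -> T')
    (h : T -> T') (j : nat) (x y z : T) :
  (forall a b, h (bu a b) = bu' (h a) (h b)) ->
  (forall a b, h (ci a b) = ci' (h a) (h b)) ->
  h (shape bu ci j x y z) = shape bu' ci' j (h x) (h y) (h z).
Proof.
move=> hb hc; rewrite /shape.
by case: (j %% 6)%N => [|[|[|[|[|?]]]]]; case: ifP => _; rewrite !hc !hb.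
Qed.

Section LinearCombinations.
Variables (K : fieldType) (E : sigma2_module K).

Definition lcomb (I T : Type) (c : T -> K) (f : T -> term K E I) (s : seq T) : term K E I :=
  foldr (fun p t => Add (Scale (c p) (f p)) t) Zero s.

Lemma ml_lcomb (I : finType) (T : eqType) (c : T -> K) (f : T -> term K E I) (s : seq T) A :
  {in s, forall p, ml (f p) A} -> ml (lcomb c f s) A.
Proof.
elim: s => //= p s IHs h; split; first by apply: h; rewrite inE eqxx.
by apply: IHs => q qs; apply: h; rewrite inE qs orbT.
Qed.

Lemma lcomb_bind (I J T : Type) (c : T -> K) (f : T -> term K E I) (s : seq T)
    (k : I -> term K E J) :
  bind (lcomb c f s) k = lcomb c (fun p => bind (f p) k) s.
Proof. by elim: s => //= p s ->. Qed.

Lemma teq_lcomb_opl (I T : Type) (e : E) (c : T -> K) (f : T -> term K E I) (s : seq T) u :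
  teq (Op e (lcomb c f s) u) (lcomb c (fun p => Op e (f p) u) s).
Proof.
elim: s => [|p s IHs] /=; first exact: teq_op0l.
apply: teq_trans (teq_opl _ _ _ _ _) _; apply: teq_addc => //; exact: teq_refl.
Qed.

Lemma teq_lcomb_opr (I T : Type) (e : E) (c : T -> K) (f : T -> term K E I) (s : seq T) u :
  teq (Op e u (lcomb c f s)) (lcomb c (fun p => Op e u (f p)) s).
Proof.
elim: s => [|p s IHs] /=; first exact: teq_op0r.
apply: teq_trans (teq_opr _ _ _ _ _) _; apply: teq_addc => //; exact: teq_refl.
Qed.

Lemma fcl_lcomb (I : finType) (T : eqType) (c : T -> K) (f : T -> term K E I) (s : seq T) :
  {in s, forall p, ml (f p) setT} ->
  fcl (lcomb c f s) = \sum_(p <- s) c p *: fcl (f p).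
Proof.
elim: s => [|p s IHs] h /=; first by rewrite big_nil fcl0.
have hp : ml (f p) setT by apply: h; rewrite inE eqxx.
have hs : {in s, forall q, ml (f q) setT} by move=> q qs; apply: h; rewrite inE qs orbT.
by rewrite big_cons fclD ?fclZ ?IHs //; exact: ml_lcomb.
Qed.

Lemma cl_lcomb (R : free_operad E 'I_3 -> Prop) (I : finType) (T : eqType) (c : T -> K)
    (f : T -> term K E I) (s : seq T) :
  {in s, forall p, ml (f p) setT} ->
  cl R (lcomb c f s) = \sum_(p <- s) c p *: cl R (f p).
Proof.
move=> h; rewrite /cl fcl_lcomb //.
elim: s {h} => [|p s IHs]; first by rewrite !big_nil pr0.
by rewrite !big_cons prD prZ IHs.
Qed.

End LinearCombinations.

(** * Computable reduction of trees with symbolic coefficients *)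

Section Trees.
Variable X : eqType.

(** Monomials as pure data, free of scalars and sets, so that reduction can be executed: [true]
    labels a vertex *, [false] a vertex o. *)
Inductive tree : Type := Lf of X | Nd of bool & tree & tree.

HB.instance Definition _ := gen_eqMixin tree.

Fixpoint leaves (T : tree) : seq X :=
  match T with Lf i => [:: i] | Nd _ l r => leaves l ++ leaves r end.

Notation poly := (seq (seq nat * tree)).

(* In pairs (m, T) : seq nat * tree, [m] is a monomial in 24 unknowns, the
   coefficients 0, ..., 11 of D((x o y) * z) and 12, ..., 23 of D(x * (y o z)). *)
Definition rewrite_lhs (T : tree) : option poly :=
  if T is Nd true (Nd false x y) z
  then Some [seq ([:: j], shape (Nd true) (Nd false) j x y z) | j <- iota 0 12] else None.

Definition rewrite_rhs (T : tree) : option poly :=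
  if T is Nd true x (Nd false y z)
  then Some [seq ([:: (12 + j)%N], shape (Nd true) (Nd false) j x y z) | j <- iota 0 12]
  else None.

Definition rotate (T : tree) : option poly :=
  if T is Nd b (Nd b' x y) z
  then if b == b' then Some [:: ([::], Nd b x (Nd b y z))] else None else None.

(** A fixed strategy: the left rule at the root, the right rule at the root, the subtrees, and
    associativity last. Starting from trees that are equal in the operad but bracketed differently
    then forces different orders of rewriting. *)
Fixpoint step (T : tree) : option poly :=
  if T is Nd b l r then
    if rewrite_lhs T is Some s then Some s
    else if rewrite_rhs T is Some s then Some s
    else if step l is Some s then Some [seq (p.1, Nd b p.2 r) | p <- s]
    else if step r is Some s then Some [seq (p.1, Nd b l p.2) | p <- s]
    else rotate T
  else None.

Lemma step_Nd b l r : step (Nd b l r) =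
  if rewrite_lhs (Nd b l r) is Some s then Some s
  else if rewrite_rhs (Nd b l r) is Some s then Some s
  else if step l is Some s then Some [seq (p.1, Nd b p.2 r) | p <- s]
  else if step r is Some s then Some [seq (p.1, Nd b l p.2) | p <- s]
  else rotate (Nd b l r).
Proof. by []. Qed.

Fixpoint reduce (n : nat) (T : tree) : poly :=
  if n is n'.+1 then
    if step T is Some s
    then flatten [seq [seq (p.1 ++ q.1, q.2) | q <- reduce n' p.2] | p <- s]
    else [:: ([::], T)]
  else [:: ([::], T)].

(* The fuel 20 suffices for the trees of interest: that the result is normal is
   checked by computation where it is used. *)
Definition reduce_all (s : poly) : poly :=
  flatten [seq [seq (p.1 ++ q.1, q.2) | q <- reduce 20 p.2] | p <- s].

Fixpoint blockb (T : tree) : bool :=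
  match T with Lf _ => true | Nd true (Lf _) r => blockb r | _ => false end.
Fixpoint normalb (T : tree) : bool :=
  match T with Nd false l r => blockb l && normalb r | _ => blockb T end.
Fixpoint decode (T : tree) : seq (seq X) :=
  match T with Nd false l r => leaves l :: decode r | _ => [:: leaves T] end.

(** The coefficient of the word [bs] in the reduced form, as a polynomial in the 24 unknowns given
    by its list of monomials. *)
Definition monomials (s : poly) (bs : seq (seq X)) : seq (seq nat) :=
  [seq p.1 | p <- reduce_all s & decode p.2 == bs].

End Trees.

(* The coefficient functionals of the composite product are those of the law
   with all right-hand sides 0, for which they are given by the matrix model. *)
Lemma law_functional (K : fieldType) D n : (2 <= n)%N -> @ass_law K D ->
  exists phi : seq (seq 'I_n) -> presented (combined_rel (@ass_rel K) (@ass_rel K) D) 'I_n -> K^o,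
    (forall bs, linear (phi bs)) /\
    forall bs bs', good bs -> good bs' -> supp bs' = setT ->
      phi bs (cl _ (normal K bs')) = (bs' == bs)%:R.
Proof.
move=> n2 [_ /(_ n n2) [g gK Kg]].
have xiL : linear (@xiD K 'I_n D) by exact: xi_linear.
have gL : linear g.
  move=> a x y; rewrite -[in LHS](Kg x) -[in LHS](Kg y).
  by rewrite -[X in g X]xiL [LHS]gK.
have [D0 [rD0 fD0]] := obeys_flags_exists K false false false.
have xiL0 : linear (@xiD K 'I_n D0) by exact: xi_linear.
exists (fun bs y => coef false false false (D := D0) bs (xiD D0 (g y))); split=> [bs a x y|bs bs' gb gb' sb'].
  by rewrite gL xiL0 (coef_linear rD0 fD0).
have [u cu] := cgen_exists K gb' sb'.
rewrite -(xi_cgen D cu) [g _]gK (xi_cgen D0 cu).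
exact: (coef_normal rD0 fD0).
Qed.

(** * Soundness of the reduction in the combined operad *)

Section TreeTerms.
Variables (K : fieldType) (I : finType).
Notation E := (ass2_gen K).
Notation R := (@ass_rel K).

Definition label (b : bool) : E := if b then bul K else cir K.

Fixpoint tree_term (T : tree I) : term K E I :=
  match T with
  | Lf i => Var i
  | Nd b l r => Op (label b) (tree_term l) (tree_term r)
  end.
Notation lset T := [set i in leaves T].

Lemma ml_tree (T : tree I) : uniq (leaves T) -> ml (tree_term T) (lset T).
Proof.
elim: T => [i _|b l IHl r IHr u] /=; first by apply/setP => j; rewrite !inE.
have /and3P[/IHl ml _ /IHr mr] : [&& uniq (leaves l), ~~ has (mem (leaves l)) (leaves r) & uniq (leaves r)].
  by rewrite -cat_uniq.
rewrite set_cat; exists (lset l), (lset r); split=> //; exact: disjoint_cat.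
Qed.

Lemma perm_lset (T T' : tree I) : perm_eq (leaves T) (leaves T') -> lset T = lset T'.
Proof. by move=> /perm_mem e; apply/setP => i; rewrite !inE. Qed.

Lemma ml_tree_perm (T T' : tree I) : uniq (leaves T') ->
  perm_eq (leaves T) (leaves T') -> ml (tree_term T) (lset T').
Proof. by move=> u e; rewrite -(perm_lset e); apply: ml_tree; rewrite (perm_uniq e). Qed.

Lemma shape_leaves j (x y z : tree I) :
  perm_eq (leaves (shape (Nd true) (Nd false) j x y z)) ((leaves x ++ leaves y) ++ leaves z).
Proof.
apply/seq.permP => a; rewrite /shape.
by case: (j %% 6)%N => [|[|[|[|[|?]]]]]; case: ifP => _; rewrite /= !count_cat; lia.
Qed.

Lemma normal_tree (T : tree I) : normalb T ->
  [/\ tree_term T = normal K (decode T), leaves T = flatten (decode T),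
      decode T != [::] & [::] \notin decode T].
Proof.
have blk (U : tree I) : blockb U -> tree_term U = block K (leaves U) /\ leaves U != [::].
  elim: U => [i|[] [i|b l1 l2] IHl r IHr] //= /IHr[-> nr]; split=> //.
  by rewrite /block; case: (leaves r) nr.
have blk1 (U : tree I) : blockb U -> [/\ tree_term U = normal K [:: leaves U],
    leaves U = flatten [:: leaves U], [:: leaves U] != [::] & [::] \notin [:: leaves U]].
  move=> /blk[e n]; split=> //; first by rewrite [flatten _]cats0.
  by rewrite mem_seq1 eq_sym.
elim: T => [i _|[] l IHl r IHr nT]; first exact: blk1.
  exact: blk1.
move: nT => /= /andP[/blk[el nl] /IHr[er flr nr nnr]]; split=> //.
- by rewrite el er /normal /=; case: (decode r) nr.
- by rewrite flr.
by rewrite in_cons negb_or nnr andbT eq_sym.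
Qed.

Variables (D : free_operad E 'I_3 -> free_operad E 'I_3) (v : nat -> K).
Notation RD := (combined_rel R R D).
Notation V := (@Var K E 'I_3).

Definition rhs_term (w : nat -> K) : term K E 'I_3 :=
  lcomb w (fun j => shape (Op (bul K)) (Op (cir K)) j (V x1) (V x2) (V x3)) (iota 0 12).

Hypotheses (DL : D (xy_z (bul K) (cir K)) = fcl (rhs_term v))
  (DR : D (x_yz (bul K) (cir K)) = fcl (rhs_term (fun j => v (12 + j)%N))).

Definition mon (m : seq nat) : K := \prod_(i <- m) v i.
Definition poly_term (s : seq (seq nat * tree I)) : term K E I :=
  lcomb (fun p => mon p.1) (fun p => tree_term p.2) s.

Lemma ml_shape j : ml (shape (Op (bul K)) (Op (cir K)) j (V x1) (V x2) (V x3)) setT.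
Proof.
have h a b c (u : uniq [:: a; b; c]) :
    ml (Op (cir K) (Op (bul K) (V a) (V b)) (V c)) setT /\
    ml (Op (cir K) (V a) (Op (bul K) (V b) (V c))) setT.
  by split; [exact: (ml_lmon (cir K) (bul K) u)|exact: (ml_rmon (cir K) (bul K) u)].
rewrite /shape; case: (j %% 6)%N => [|[|[|[|[|?]]]]];
  [have := h x1 x2 x3 isT|have := h x1 x3 x2 isT|have := h x2 x1 x3 isT
  |have := h x2 x3 x1 isT|have := h x3 x1 x2 isT|have := h x3 x2 x1 isT]; by case: ifP => _ [].
Qed.

Lemma ml_rhs_term w : ml (rhs_term w) setT.
Proof. by apply: ml_lcomb => j _; exact: ml_shape. Qed.

Lemma rhs_term_bind w (x y z : tree I) (g : nat -> seq nat) :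
  (forall j, mon (g j) = w j) ->
  bind (rhs_term w) (sub3 Zero (tree_term x) (tree_term y) (tree_term z)) =
  poly_term [seq (g j, shape (Nd true) (Nd false) j x y z) | j <- iota 0 12].
Proof.
move=> hg; rewrite lcomb_bind /poly_term; elim: (iota 0 12) => //= j q ->.
congr (Add (Scale _ _) _); first by rewrite hg.
rewrite (shape_morph (h := tree_term) (bu' := Op (bul K)) (ci' := Op (cir K))) //.
rewrite (shape_morph (h := fun t => bind t (sub3 Zero (tree_term x) (tree_term y) (tree_term z)))
  (bu' := Op (bul K)) (ci' := Op (cir K))) //.
Qed.

(** Keeping the leaves up to permutation ensures that all trees produced are multilinear in the same
    variables, so that their classes can be compared. *)
Definition sound (T : tree I) (s : seq (seq nat * tree I)) :=
  {in s, forall p, perm_eq (leaves p.2) (leaves T)} /\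
  pcl RD (lset T) (tree_term T) = pcl RD (lset T) (poly_term s).

Lemma lset_split (x y z : seq I) : uniq ((x ++ y) ++ z) ->
  [/\ [disjoint [set i in x] & [set i in y]], [disjoint [set i in x] & [set i in z]],
      [disjoint [set i in y] & [set i in z]] &
      [set i in (x ++ y) ++ z] = [set i in x] :|: ([set i in y] :|: [set i in z])].
Proof.
move=> u; have := disjoint_cat u; rewrite set_cat disjoint_setU => /andP[d1 d2].
split=> //; last by rewrite -catA !set_cat.
by apply: disjoint_cat; move: u; rewrite cat_uniq => /andP[].
Qed.

Lemma uniq_split (x y z : seq I) : uniq ((x ++ y) ++ z) -> [/\ uniq x, uniq y & uniq z].
Proof. by rewrite !cat_uniq => /and3P[/and3P[-> _ ->] _ ->]. Qed.

Lemma rewrite_lhs_sound T s : uniq (leaves T) -> rewrite_lhs T = Some s -> sound T s.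
Proof.
case: T => // -[] // [] // [] // x y z u es; rewrite /= in u.
have {es}-> : s = [seq ([:: j], shape (Nd true) (Nd false) j x y z) | j <- iota 0 12].
  by case: es => <-.
have [dxy dxz dyz eU] := lset_split u; have [ux uy uz] := uniq_split u.
split=> [p /mapP[j _ ->]|]; first exact: shape_leaves.
rewrite eU (pcl_lhs dxy dxz dyz (ml_tree ux) (ml_tree uy) (ml_tree uz) (ml_rhs_term v) DL).
rewrite (rhs_term_bind x y z (g := fun j => [:: j])) // => j.
by rewrite /mon big_seq1.
Qed.

Lemma rewrite_rhs_sound T s : uniq (leaves T) -> rewrite_rhs T = Some s -> sound T s.
Proof.
case: T => // -[] // x [] // [] // y z u es; rewrite /= catA in u.
have {es}-> : s = [seq ([:: (12 + j)%N], shape (Nd true) (Nd false) j x y z) | j <- iota 0 12].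
  by case: es => <-.
have [dxy dxz dyz eU] := lset_split u; have [ux uy uz] := uniq_split u.
split=> [p /mapP[j _ ->]|]; first by rewrite /= catA; exact: shape_leaves.
rewrite /= catA eU (pcl_rhs dxy dxz dyz (ml_tree ux) (ml_tree uy) (ml_tree uz) (ml_rhs_term _) DR).
rewrite (rhs_term_bind x y z (g := fun j => [:: (12 + j)%N])) // => j.
by rewrite /mon big_seq1.
Qed.

Lemma rotate_pcl b (x y z : tree I) : uniq (leaves (Nd b (Nd b x y) z)) ->
  pcl RD (lset (Nd b (Nd b x y) z)) (tree_term (Nd b (Nd b x y) z)) =
  pcl RD (lset (Nd b (Nd b x y) z)) (tree_term (Nd b x (Nd b y z))).
Proof.
move=> /= u; have [dxy dxz dyz eU] := lset_split u; have [ux uy uz] := uniq_split u.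
have ass : associates I RD (label b).
  by case: b; [exact: bul_associates|exact: cir_associates].
by rewrite eU; apply: ass => //; exact: ml_tree.
Qed.

Lemma teq_poly1 (T : tree I) : teq (poly_term [:: ([::], T)]) (tree_term T).
Proof.
rewrite /poly_term /= /mon big_nil; apply: teq_trans (teq_addr0 _) _; exact: teq_scale1.
Qed.

Lemma rotate_sound T s : uniq (leaves T) -> rotate T = Some s -> sound T s.
Proof.
case: T => // b [] // b' x y z u /=; case: eqP => // bb [<-]; subst b'.
have p : perm_eq (leaves (Nd b x (Nd b y z))) (leaves (Nd b (Nd b x y) z)) by rewrite /= catA.
split=> [q|]; first by rewrite inE => /eqP ->.
rewrite rotate_pcl //; apply: pcl_teq.
- exact: ml_tree_perm u p.
- by split=> //; exact: ml_tree_perm u p.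
exact/teq_sym/teq_poly1.
Qed.

Lemma ml_poly_term T s : uniq (leaves T) ->
  {in s, forall p, perm_eq (leaves p.2) (leaves T)} -> ml (poly_term s) (lset T).
Proof. by move=> u h; apply: ml_lcomb => p ps; apply: ml_tree_perm => //; exact: h. Qed.

Lemma poly_term_map (f : tree I -> tree I) s :
  poly_term [seq (p.1, f p.2) | p <- s] =
  lcomb (fun p => mon p.1) (fun p => tree_term (f p.2)) s.
Proof. by rewrite /poly_term; elim: s => //= p s ->. Qed.

Lemma sound_l b l r s : uniq (leaves (Nd b l r)) -> sound l s ->
  sound (Nd b l r) [seq (p.1, Nd b p.2 r) | p <- s].
Proof.
move=> u [ps es]; have /= u' := u; move: u'; rewrite cat_uniq => /and3P[ul _ ur].
have hp : {in [seq (p.1, Nd b p.2 r) | p <- s], forall p, perm_eq (leaves p.2) (leaves (Nd b l r))}.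
  by move=> _ /mapP[q /ps qs ->] /=; rewrite perm_cat2r.
split=> //; have ms := ml_poly_term u hp; move: ms; rewrite (poly_term_map (fun U => Nd b U r)) => ms.
have d := disjoint_cat u; have mp := ml_poly_term ul ps.
rewrite [lset _]set_cat in ms *.
transitivity (pcl RD (lset l :|: lset r) (Op (label b) (poly_term s) (tree_term r))).
  by apply: pcl_Op => //; exact: ml_tree.
apply: pcl_teq => //; first by apply: ml_Op => //; exact: ml_tree.
exact: teq_lcomb_opl.
Qed.

Lemma sound_r b l r s : uniq (leaves (Nd b l r)) -> sound r s ->
  sound (Nd b l r) [seq (p.1, Nd b l p.2) | p <- s].
Proof.
move=> u [ps es]; have /= u' := u; move: u'; rewrite cat_uniq => /and3P[ul _ ur].
have hp : {in [seq (p.1, Nd b l p.2) | p <- s], forall p, perm_eq (leaves p.2) (leaves (Nd b l r))}.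
  by move=> _ /mapP[q /ps qs ->] /=; rewrite perm_cat2l.
split=> //; have ms := ml_poly_term u hp; move: ms; rewrite (poly_term_map (fun U => Nd b l U)) => ms.
have d := disjoint_cat u; have mp := ml_poly_term ur ps.
rewrite [lset _]set_cat in ms *.
transitivity (pcl RD (lset l :|: lset r) (Op (label b) (tree_term l) (poly_term s))).
  by apply: pcl_Op => //; exact: ml_tree.
apply: pcl_teq => //; first by apply: ml_Op => //; exact: ml_tree.
exact: teq_lcomb_opr.
Qed.

Lemma step_sound T s : uniq (leaves T) -> step T = Some s -> sound T s.
Proof.
elim: T s => // b l IHl r IHr s u.
have [ul ur] : uniq (leaves l) /\ uniq (leaves r).
  by move: (u); rewrite /= cat_uniq => /and3P[].
rewrite step_Nd.
case e1: (rewrite_lhs (Nd b l r)) => [s1|]; first by move=> [<-]; exact: rewrite_lhs_sound.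
case e2: (rewrite_rhs (Nd b l r)) => [s2|]; first by move=> [<-]; exact: rewrite_rhs_sound.
case e3: (step l) => [s3|]; first by move=> [<-]; apply: sound_l => //; exact: IHl.
case e4: (step r) => [s4|]; first by move=> [<-]; apply: sound_r => //; exact: IHr.
exact: rotate_sound.
Qed.

Variable phi : presented RD I -> K^o.
Hypothesis phiL : linear phi.

Definition full (T : tree I) := perm_eq (leaves T) (enum I).
Definition value (s : seq (seq nat * tree I)) : K :=
  \sum_(p <- s) mon p.1 * phi (cl RD (tree_term p.2)).

Lemma full_uniq T : full T -> uniq (leaves T).
Proof. by move=> /perm_uniq ->; exact: enum_uniq. Qed.
Lemma full_lset T : full T -> lset T = setT.
Proof. by move=> /perm_mem e; apply/setP => i; rewrite !inE e mem_enum. Qed.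
Lemma full_ml T : full T -> ml (tree_term T) setT.
Proof. by move=> f; rewrite -(full_lset f); apply/ml_tree/full_uniq. Qed.

Lemma phi_sum (S : Type) (s : seq S) (c : S -> K) (x : S -> presented RD I) :
  phi (\sum_(p <- s) c p *: x p) = \sum_(p <- s) c p * phi (x p).
Proof.
elim: s => [|p s IHs]; first by rewrite !big_nil (lin_zero phiL).
by rewrite !big_cons phiL IHs.
Qed.

Lemma sound_value T s : full T -> sound T s ->
  {in s, forall p, full p.2} /\ phi (cl RD (tree_term T)) = value s.
Proof.
move=> fT [ps es]; have hs : {in s, forall p, full p.2}.
  by move=> p /ps pT; exact: perm_trans pT fT.
split=> //; rewrite full_lset // in es.
rewrite (pcl_setT _ _ es); [|exact: full_ml|by apply: ml_lcomb => p /hs/full_ml].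
by rewrite cl_lcomb ?phi_sum // => p /hs/full_ml.
Qed.

Lemma value_flatten (s : seq (seq nat * tree I)) (f : tree I -> seq (seq nat * tree I)) :
  {in s, forall p, phi (cl RD (tree_term p.2)) = value (f p.2)} ->
  value s = value (flatten [seq [seq (p.1 ++ q.1, q.2) | q <- f p.2] | p <- s]).
Proof.
elim: s => [|p s IHs] h; first by rewrite /value !big_nil.
have hs : {in s, forall q, phi (cl RD (tree_term q.2)) = value (f q.2)}.
  by move=> q qs; apply: h; rewrite inE qs orbT.
have -> : value (p :: s) = mon p.1 * value (f p.2) + value s.
  by rewrite [LHS]big_cons h // inE eqxx.
rewrite (IHs hs) [RHS]big_cat; congr (_ + _).
rewrite big_map /value mulr_sumr; apply: eq_bigr => q _.
by rewrite /mon big_cat mulrA.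
Qed.

Lemma reduce_sound n T : full T ->
  {in reduce n T, forall p, full p.2} /\ phi (cl RD (tree_term T)) = value (reduce n T).
Proof.
have triv U : full U -> {in [:: ([::] : seq nat, U)], forall p, full p.2} /\
    phi (cl RD (tree_term U)) = value [:: ([::], U)].
  move=> fU; split=> [p|]; first by rewrite inE => /eqP ->.
  by rewrite /value big_seq1 /mon big_nil mul1r.
elim: n T => [|n IHn] T fT /=; first exact: triv.
case eT: (step T) => [s|]; last exact: triv.
have [fs ->] := sound_value fT (step_sound (full_uniq fT) eT).
split=> [p /flatten_mapP[q qs /mapP[q' q's ->]]|].
  exact: (proj1 (IHn _ (fs _ qs)) _ q's).
by apply: value_flatten => p ps; exact: (proj2 (IHn _ (fs _ ps))).
Qed.

Lemma reduce_all_sound s : {in s, forall p, full p.2} ->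
  {in reduce_all s, forall p, full p.2} /\ value s = value (reduce_all s).
Proof.
move=> fs; split=> [p /flatten_mapP[q qs /mapP[q' q's ->]]|].
  exact: (proj1 (reduce_sound 20 (fs _ qs)) _ q's).
by apply: value_flatten => p ps; exact: (proj2 (reduce_sound 20 (fs _ ps))).
Qed.

End TreeTerms.

Section Coordinates.
Variable K : fieldType.
Notation E := (ass2_gen K).
Notation V := (@Var K E 'I_3).

Lemma fcl_rhs_term (w : nat -> K) : fcl (rhs_term w) =
  \sum_(j <- iota 0 12) w j *: fcl (shape (Op (bul K)) (Op (cir K)) j (V x1) (V x2) (V x3)).
Proof. by apply: fcl_lcomb => j _; exact: ml_shape. Qed.

(** The symmetric group permutes the twelve shapes, and the two generators are among them, so their
    span is everything. *)
Lemma F3_21_coord (x : free_operad E 'I_3) : F3_21 x ->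
  exists w : nat -> K, x = fcl (rhs_term w).
Proof.
have W0 : exists w : nat -> K, (0 : free_operad E 'I_3) = fcl (rhs_term w).
  by exists (fun=> 0); rewrite fcl_rhs_term big1 // => j _; rewrite scale0r.
have WL (a : K) (y z : free_operad E 'I_3) : (exists w : nat -> K, y = fcl (rhs_term w)) ->
    (exists w : nat -> K, z = fcl (rhs_term w)) ->
    exists w : nat -> K, a *: y + z = fcl (rhs_term w).
  move=> [w ->] [w' ->]; exists (fun j => a * w j + w' j).
  rewrite !fcl_rhs_term scaler_sumr -big_split; apply: eq_bigr => j _.
  by rewrite /= scalerA -scalerDl.
have Wsh j : (j < 12)%N -> exists w : nat -> K,
    fcl (shape (Op (bul K)) (Op (cir K)) j (V x1) (V x2) (V x3)) = fcl (rhs_term w).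
  move=> j12; exists (fun i => (i == j)%:R); rewrite fcl_rhs_term.
  rewrite (bigD1_seq j) ?mem_iota ?iota_uniq //= eqxx scale1r big1 ?addr0 // => i /negbTE ->.
  by rewrite scale0r.
have Wm (i j k : 'I_3) : uniq [:: i; j; k] ->
    (exists w : nat -> K, fcl (Op (cir K) (Op (bul K) (V i) (V j)) (V k)) = fcl (rhs_term w)) /\
    (exists w : nat -> K, fcl (Op (cir K) (V i) (Op (bul K) (V j) (V k))) = fcl (rhs_term w)).
  have e3 (a : 'I_3) : [|| a == x1, a == x2 | a == x3] by case: a => [[|[|[|]]]].
  case/or3P: (e3 i) => /eqP->; case/or3P: (e3 j) => /eqP->; case/or3P: (e3 k) => /eqP-> // _;
    split; first [exact: (Wsh 0%N)|exact: (Wsh 1%N)|exact: (Wsh 2%N)|exact: (Wsh 3%N)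
      |exact: (Wsh 4%N)|exact: (Wsh 5%N)|exact: (Wsh 6%N)|exact: (Wsh 7%N)|exact: (Wsh 8%N)
      |exact: (Wsh 9%N)|exact: (Wsh 10%N)|exact: (Wsh 11%N)].
apply: (@F3_21_ind K (fun x => exists w, x = fcl (rhs_term w))).
- split=> // s _ [w ->]; rewrite fcl_rhs_term.
  have rl : linear (relabel (perm_bij s) : free_operad E 'I_3 -> free_operad E 'I_3) by exact: relabel_linear.
  have Wr j : exists w' : nat -> K,
      relabel (perm_bij s) (fcl (shape (Op (bul K)) (Op (cir K)) j (V x1) (V x2) (V x3))) = fcl (rhs_term w').
    rewrite (fcl_relabel _ (ml_shape K j)).
    rewrite (shape_morph (h := fun t => bind t (fun i => V (s i))) (bu' := Op (bul K)) (ci' := Op (cir K))) //=.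
    have u (a b c : 'I_3) : uniq [:: a; b; c] -> uniq [:: s a; s b; s c].
      by move=> abc; rewrite -[[:: s a; _; _]]/(map s [:: a; b; c]) (map_inj_uniq perm_inj).
    have h a b c (abc : uniq [:: a; b; c]) := Wm _ _ _ (u a b c abc).
    rewrite /shape; case: (j %% 6)%N => [|[|[|[|[|?]]]]];
      [have := h x1 x2 x3 isT|have := h x1 x3 x2 isT|have := h x2 x1 x3 isT
      |have := h x2 x3 x1 isT|have := h x3 x1 x2 isT|have := h x3 x2 x1 isT]; by case: ifP => _ [].
  elim: (iota 0 12) => [|j q IHq]; first by rewrite big_nil (lin_zero rl).
  by rewrite big_cons rl; apply: WL.
- by have [] := Wm _ _ _ u123; rewrite /xy_z lmonE.
by have [] := Wm _ _ _ u123; rewrite /x_yz rmonE.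
Qed.

End Coordinates.

Definition o0 : 'I_4 := @Ordinal 4 0 isT.
Definition o1 : 'I_4 := @Ordinal 4 1 isT.
Definition o2 : 'I_4 := @Ordinal 4 2 isT.
Definition o3 : 'I_4 := @Ordinal 4 3 isT.

Lemma enum_ord4 : enum 'I_4 = [:: o0; o1; o2; o3].
Proof. by apply: (inj_map val_inj); rewrite val_enum_ord. Qed.

Section Monomials.
Variable K : fieldType.
Notation E := (ass2_gen K).
Variables (D : free_operad E 'I_3 -> free_operad E 'I_3) (v : nat -> K).
Notation RD := (combined_rel (@ass_rel K) (@ass_rel K) D).
Hypotheses (DL : D (xy_z (bul K) (cir K)) = fcl (rhs_term v))
  (DR : D (x_yz (bul K) (cir K)) = fcl (rhs_term (fun j => v (12 + j)%N))).
Variable phi : seq (seq 'I_4) -> presented RD 'I_4 -> K^o.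
Hypotheses (phiL : forall bs, linear (phi bs))
  (phi_normal : forall bs bs', good bs -> good bs' -> supp bs' = setT ->
    phi bs (cl _ (normal K bs')) = (bs' == bs)%:R).

Definition peval (l : seq (seq nat)) : K := \sum_(m <- l) mon v m.

Definition fullb (T : tree 'I_4) := perm_eq (leaves T) [:: o0; o1; o2; o3].

(** After reduction all trees are normal words, and [phi bs] is 1 on [bs] and 0 on the others: only
    the trees that decode to [bs] contribute. *)
Lemma value_monomials s bs : all (fun p => fullb p.2) s ->
  all (fun p => normalb p.2) (reduce_all s) -> good bs ->
  value v (phi bs) s = peval (monomials s bs).
Proof.
move=> /allP fs /allP ns gbs.
have fs' : {in s, forall p, full p.2} by move=> p /fs; rewrite /full enum_ord4.
have [fr ->] := reduce_all_sound DL DR (phiL bs) fs'.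
rewrite /peval /monomials big_map big_filter /value [RHS]big_mkcond.
apply: eq_big_seq => p pr; have [-> fl n nn] := normal_tree K (ns _ pr).
have gd : good (decode p.2) by rewrite /good n nn -fl full_uniq // fr.
rewrite phi_normal // ; last by rewrite /supp -fl full_lset // fr.
by case: eqP => _; rewrite ?mulr1 ?mulr0.
Qed.

Lemma value1 (T : tree 'I_4) bs : value v (phi bs) [:: ([::], T)] = phi bs (cl RD (tree_term K T)).
Proof. by rewrite /value big_seq1 /mon big_nil mul1r. Qed.

Lemma coincide (T T' : tree 'I_4) bs : full T -> full T' ->
  pcl RD [set i in leaves T] (tree_term K T) = pcl RD [set i in leaves T] (tree_term K T') ->
  value v (phi bs) [:: ([::], T)] = value v (phi bs) [:: ([::], T')].
Proof.
move=> fT fT'; rewrite full_lset // => e; rewrite !value1.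
by rewrite (pcl_setT _ _ e) //; exact: full_ml.
Qed.

End Monomials.

(** * The equations satisfied by the coefficients of a law *)

Section Classification.
Variables (K : fieldType) (charK : ([pchar K]%R : nat_pred) =i pred0).
Notation E := (ass2_gen K).
Variables (D : free_operad E 'I_3 -> free_operad E 'I_3) (lawD : ass_law D).
Notation RD := (combined_rel (@ass_rel K) (@ass_rel K) D).
Notation V := (@Var K E 'I_3).

Notation L0 := (Lf o0). Notation L1 := (Lf o1). Notation L2 := (Lf o2). Notation L3 := (Lf o3).
Notation B := (Nd true). Notation C := (Nd false).

Lemma double_eq0 (x : K) : x + x = 0 -> x = 0.
Proof.
move=> xx; have n2 : (2%:R : K) != 0.
  by apply: contraFN (charK 2) => n2; rewrite inE.
by apply/eqP; rewrite -(mulrI_eq0 _ (mulfI n2)) mulr_natl mulr2n xx.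
Qed.

Lemma idempotent_cases (x : K) : x = x * x -> x = 0 \/ x = 1.
Proof.
move=> xx; have /eqP : x * (1 - x) = 0 by rewrite mulrBr mulr1 -xx subrr.
by rewrite mulf_eq0 subr_eq0 => /orP[/eqP|/eqP]; [left|right].
Qed.

(* Each use of an identity below compares the coefficients of one normal word
   in two expressions for the same element of arity 4. *)
Ltac coefficient_of H :=
  move: (H isT);
  match goal with |- peval _ ?a = peval _ ?b -> _ =>
    let a' := eval vm_compute in a in let b' := eval vm_compute in b in
    rewrite (_ : a = a'); [|by vm_compute]; rewrite (_ : b = b'); [|by vm_compute] end;
  rewrite /peval /mon ?(big_cons, big_nil) /= ?mulr1 ?addr0;
  repeat match goal with z : _ = 0 |- _ => progress rewrite ?z end;
  rewrite ?mulr0 ?mul0r ?mulr0 ?addr0 ?add0r ?addr0 ?add0r.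

Theorem law_obeys : exists r : rules, obeys r D.
Proof.
have [[D21 _ _] _] := lawD.
have [w DL] := F3_21_coord (D21 _ (@F3_12_xy_z K)).
have [w' DR] := F3_21_coord (D21 _ (@F3_12_x_yz K)).
pose v j := if (j < 12)%N then w j else w' (j - 12)%N.
have eL : fcl (rhs_term w) = fcl (rhs_term v) by [].
have eR : fcl (rhs_term w') = fcl (rhs_term (fun j => v (12 + j)%N)) by [].
rewrite {}eL in DL; rewrite {}eR in DR.
clearbody v; have [phi [phiL phi_normal]] := law_functional (isT : 2 <= 4)%N lawD.
have same T T' bs : fullb T -> fullb T' ->
    all (fun p => normalb p.2) (reduce_all [:: ([::] : seq nat, T)]) ->
    all (fun p => normalb p.2) (reduce_all [:: ([::] : seq nat, T')]) ->
    pcl RD [set i in leaves T] (tree_term K T) = pcl RD [set i in leaves T] (tree_term K T') ->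
    good bs -> peval v (monomials [:: ([::], T)] bs) = peval v (monomials [:: ([::], T')] bs).
  move=> fT fT' nT nT' e gbs.
  rewrite -(value_monomials DL DR phiL phi_normal) //=; last by rewrite fT.
  rewrite -(value_monomials DL DR phiL phi_normal) //=; last by rewrite fT'.
  by apply: coincide e => //; rewrite /full enum_ord4.
have h1 bs : good bs -> peval v (monomials [:: ([::], B (C L0 L1) (B L2 L3))] bs) =
    peval v (monomials [:: ([::], B (B (C L0 L1) L2) L3)] bs).
  by move=> g; symmetry; apply: same; [by []|by []|by vm_compute|by vm_compute|exact: rotate_pcl|exact: g].
have h2 bs : good bs -> peval v (monomials [:: ([::], B L0 (B L1 (C L2 L3)))] bs) =
    peval v (monomials [:: ([::], B (B L0 L1) (C L2 L3))] bs).
  by move=> g; symmetry; apply: same; [by []|by []|by vm_compute|by vm_compute|exact: rotate_pcl|exact: g].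
have h3 bs : good bs -> peval v (monomials [:: ([::], B (C (C L0 L1) L2) L3)] bs) =
    peval v (monomials [:: ([::], B (C L0 (C L1 L2)) L3)] bs).
  move=> g; apply: same; [by []|by []|by vm_compute|by vm_compute| |exact: g].
  rewrite -[leaves _]/(leaves (C (C L0 L1) L2) ++ leaves L3) set_cat.
  apply: pcl_Op; [exact: disjoint_cat|exact: (ml_tree K (T := C (C L0 L1) L2) isT)
    |exact: (ml_tree_perm K (T := C L0 (C L1 L2)) (T' := C (C L0 L1) L2) isT isT)
    |exact: (ml_tree K (T := L3) isT)|exact: (ml_tree K (T := L3) isT)| |by []].
  exact: (rotate_pcl _ (b := false) (x := L0) (y := L1) (z := L2)).
have h4 bs : good bs -> peval v (monomials [:: ([::], B L0 (C (C L1 L2) L3))] bs) =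
    peval v (monomials [:: ([::], B L0 (C L1 (C L2 L3)))] bs).
  move=> g; apply: same; [by []|by []|by vm_compute|by vm_compute| |exact: g].
  rewrite -[leaves _]/(leaves L0 ++ leaves (C (C L1 L2) L3)) set_cat.
  apply: pcl_Op; [exact: disjoint_cat|exact: (ml_tree K (T := L0) isT)
    |exact: (ml_tree K (T := L0) isT)|exact: (ml_tree K (T := C (C L1 L2) L3) isT)
    |exact: (ml_tree_perm K (T := C L1 (C L2 L3)) (T' := C (C L1 L2) L3) isT isT)|by []|].
  exact: (rotate_pcl _ (b := false) (x := L1) (y := L2) (z := L3)).
(* Both rules apply at this root and [step] takes the left one. The other reduction is obtained by
   performing the right rule first and reducing its result. *)
have h5 bs : good bs -> peval v (monomials [:: ([::], B (C L0 L1) (C L2 L3))] bs) =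
    peval v (monomials (odflt [::] (rewrite_rhs (B (C L0 L1) (C L2 L3)))) bs).
  move=> g; set T := B _ _; set s := odflt _ _.
  have fa : all (fun p => fullb p.2) [:: ([::] : seq nat, T)] by [].
  have na : all (fun p => normalb p.2) (reduce_all [:: ([::] : seq nat, T)]) by vm_compute.
  have fb : all (fun p => fullb p.2) s by vm_compute.
  have nb : all (fun p => normalb p.2) (reduce_all s) by vm_compute.
  rewrite -(value_monomials DL DR phiL phi_normal fa na g).
  rewrite -(value_monomials DL DR phiL phi_normal fb nb g).
  rewrite value1; have fT : full T by rewrite /full enum_ord4.
  have es : rewrite_rhs T = Some s by [].
  have sT := rewrite_rhs_sound DR (full_uniq fT) es.
  by have [_ <-] := sound_value (phiL bs) fT sT.
(* In the next eight words, the letter multiplied last in the stepwise product, [o3] for [h1] and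
   [o0] for [h2], lies inside a block of three letters. The stepwise product can put it only at an
   end of a block, so its coefficient is 0 and the other side consists of a single unknown. *)
have z9 : v 9 = 0 by coefficient_of (h1 [:: [:: o1]; [:: o2; o3; o0]]).
have z5 : v 5 = 0 by coefficient_of (h1 [:: [:: o2; o3; o1]; [:: o0]]).
have z4 : v 4 = 0 by coefficient_of (h1 [:: [:: o2; o3; o0]; [:: o1]]).
have z7 : v 7 = 0 by coefficient_of (h1 [:: [:: o0]; [:: o2; o3; o1]]).
have z21 : v 21 = 0 by coefficient_of (h2 [:: [:: o2]; [:: o3; o0; o1]]).
have z16 : v 16 = 0 by coefficient_of (h2 [:: [:: o3; o0; o1]; [:: o2]]).
have z23 : v 23 = 0 by coefficient_of (h2 [:: [:: o3]; [:: o2; o0; o1]]).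
have z14 : v 14 = 0 by coefficient_of (h2 [:: [:: o2; o0; o1]; [:: o3]]).
(* In these four words the middle block is a single letter of the o-product. Only one of the two
   bracketings lets that letter end up between the other blocks, and there with a single unknown as
   coefficient. *)
have z3 : v 3 = 0 by coefficient_of (h3 [:: [:: o2; o3]; [:: o0]; [:: o1]]).
have z8 : v 8 = 0 by coefficient_of (h3 [:: [:: o1]; [:: o2]; [:: o0; o3]]).
have z22 : v 22 = 0 by coefficient_of (h4 [:: [:: o2]; [:: o3]; [:: o0; o1]]).
have z13 : v 13 = 0 by coefficient_of (h4 [:: [:: o0; o3]; [:: o1]; [:: o2]]).
(* The unknowns [v 6], [v 1], [v 12], [v 20] are called c, f, b, e after the system of rules in
   which each is the only nonzero one. *)
have cc : v 6 = v 6 * v 6 by coefficient_of (h1 [:: [:: o0]; [:: o1; o2; o3]]).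
have ff : v 1 = v 1 * v 1 by coefficient_of (h1 [:: [:: o0; o2; o3]; [:: o1]]).
have bb : v 12 * v 12 = v 12 by coefficient_of (h2 [:: [:: o0; o1; o2]; [:: o3]]).
have ee : v 20 * v 20 = v 20 by coefficient_of (h2 [:: [:: o2]; [:: o0; o1; o3]]).
have cf : 0 = v 6 * v 1 by coefficient_of (h1 [:: [:: o0; o3]; [:: o1; o2]]).
have be : v 12 * v 20 = 0 by coefficient_of (h2 [:: [:: o1; o2]; [:: o0; o3]]).
have fb : v 1 * v 12 = 0 by coefficient_of (h5 [:: [:: o0; o2]; [:: o3]; [:: o1]]).
have ce : v 6 * v 20 = 0 by coefficient_of (h5 [:: [:: o0]; [:: o2]; [:: o1; o3]]).
(* Eight other unknowns remain, called a1, a2, a3, a4 for [v 0], [v 2], [v 10], [v 11] and d1, d2,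
   d3, d4 for [v 15], [v 17], [v 18], [v 19]. Each of a2, a3, d1, d4 is both fixed and killed by
   multiplication with one of c, f, e, b, hence is 0. *)
have a1c : v 0 = v 0 * v 6 by coefficient_of (h1 [:: [:: o0; o1]; [:: o2; o3]]).
have ca2 : 0 = v 6 * v 2 by coefficient_of (h1 [:: [:: o1; o2; o0]; [:: o3]]).
have a2c : v 2 = v 2 * v 6 by coefficient_of (h1 [:: [:: o1; o0]; [:: o2; o3]]).
have a3f : v 10 = v 10 * v 1 by coefficient_of (h1 [:: [:: o2; o3]; [:: o0; o1]]).
have fa3 : 0 = v 1 * v 10 by coefficient_of (h1 [:: [:: o3]; [:: o0; o2; o1]]).
have a4f : v 11 = v 11 * v 1 by coefficient_of (h1 [:: [:: o2; o3]; [:: o1; o0]]).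
have ea4 : v 11 = v 20 * v 11 by coefficient_of (h5 [:: [:: o2]; [:: o3]; [:: o1; o0]]).
have ba1 : v 0 = v 12 * v 0 by coefficient_of (h5 [:: [:: o0; o1]; [:: o2]; [:: o3]]).
have a1a1 : 0 = v 0 * v 0 + (v 6 * v 0 + v 10 * v 2) by coefficient_of (h1 [:: [:: o0; o1; o2]; [:: o3]]).
have a1a1' : v 0 * v 0 + v 2 * v 15 = v 0 * v 12 by coefficient_of (h3 [:: [:: o0; o1]; [:: o2]; [:: o3]]).
have a4a4 : 0 = v 1 * v 11 + (v 2 * v 10 + v 11 * v 11) by coefficient_of (h1 [:: [:: o3]; [:: o1; o0; o2]]).
have a4a4' : v 11 * v 20 = v 10 * v 19 + v 11 * v 11 by coefficient_of (h3 [:: [:: o3]; [:: o0]; [:: o2; o1]]).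
have d1e : v 15 * v 20 = v 15 by coefficient_of (h2 [:: [:: o2; o3]; [:: o0; o1]]).
have ed1 : v 20 * v 15 = 0 by coefficient_of (h2 [:: [:: o2; o1; o3]; [:: o0]]).
have d4b : v 19 * v 12 = v 19 by coefficient_of (h2 [:: [:: o0; o1]; [:: o3; o2]]).
have bd4 : v 12 * v 19 = 0 by coefficient_of (h2 [:: [:: o0]; [:: o3; o1; o2]]).
have d3b : v 18 * v 12 = v 18 by coefficient_of (h2 [:: [:: o0; o1]; [:: o2; o3]]).
have cd3 : v 6 * v 18 = v 18 by coefficient_of (h5 [:: [:: o0]; [:: o1]; [:: o2; o3]]).
have d3d3 : v 12 * v 18 + (v 15 * v 19 + v 18 * v 18) = 0 by coefficient_of (h2 [:: [:: o0]; [:: o1; o2; o3]]).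
have d3d3' : v 18 * v 6 = v 18 * v 18 + v 19 * v 10 by coefficient_of (h4 [:: [:: o0]; [:: o1]; [:: o2; o3]]).
have d2e : v 17 * v 20 = v 17 by coefficient_of (h2 [:: [:: o3; o2]; [:: o0; o1]]).
have fd2 : v 1 * v 17 = v 17 by coefficient_of (h5 [:: [:: o3; o2]; [:: o0]; [:: o1]]).
have d2d2 : v 17 * v 17 + (v 19 * v 15 + v 20 * v 17) = 0 by coefficient_of (h2 [:: [:: o1; o3; o2]; [:: o0]]).
have d2d2' : v 15 * v 2 + v 17 * v 17 = v 17 * v 1 by coefficient_of (h4 [:: [:: o2; o1]; [:: o3]; [:: o0]]).
have z2 : v 2 = 0 by rewrite a2c mulrC -ca2.
have z10 : v 10 = 0 by rewrite a3f mulrC -fa3.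
(* Both products left in [a1a1] are equal to [v 0], so that [v 0 + v 0 = 0]: division by 2 enters
   here. The same pattern gives [v 11], [v 18] and [v 17]. *)
have z0 : v 0%N = 0.
  rewrite z2 z10 !mul0r !addr0 in a1a1 a1a1'; apply: double_eq0.
  have e1 : v 0%N * v 0%N = v 0%N by rewrite a1a1' mulrC -ba1.
  have e2 : v 6 * v 0%N = v 0%N by rewrite mulrC -a1c.
  by rewrite [RHS]a1a1 e1 e2.
have z11 : v 11 = 0.
  rewrite z2 z10 !mul0r !add0r in a4a4 a4a4'; apply: double_eq0.
  have e1 : v 11 * v 11 = v 11 by rewrite -a4a4' mulrC -ea4.
  have e2 : v 1%N * v 11 = v 11 by rewrite mulrC -a4f.
  by rewrite [RHS]a4a4 e1 e2.
have z15 : v 15 = 0 by rewrite -d1e mulrC ed1.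
have z19 : v 19 = 0 by rewrite -d4b mulrC bd4.
have z18 : v 18 = 0.
  rewrite z15 z19 !mul0r ?add0r ?addr0 in d3d3 d3d3'; apply: double_eq0.
  have e1 : v 18 * v 18 = v 18 by rewrite -d3d3' mulrC cd3.
  have e2 : v 12 * v 18 = v 18 by rewrite mulrC d3b.
  by rewrite -[RHS]d3d3 e1 e2.
have z17 : v 17 = 0.
  rewrite z15 z19 !mul0r ?add0r ?addr0 in d2d2 d2d2'; apply: double_eq0.
  have e1 : v 17 * v 17 = v 17 by rewrite d2d2' mulrC fd2.
  have e2 : v 20 * v 17 = v 17 by rewrite mulrC d2e.
  by rewrite -[RHS]d2d2 e1 e2.
have DLE : D (xy_z (bul K) (cir K)) = v 1%N *: xz_y (cir K) (bul K) + v 6 *: x_yz (cir K) (bul K).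
  rewrite DL fcl_rhs_term !big_cons big_nil z0 z2 z3 z4 z5 z7 z8 z9 z10 z11 !scale0r !add0r !addr0.
  by rewrite /xz_y /x_yz lmonE rmonE.
have DRE : D (x_yz (bul K) (cir K)) = v 12 *: xy_z (cir K) (bul K) + v 20 *: y_xz (cir K) (bul K).
  rewrite DR fcl_rhs_term !big_cons big_nil z13 z14 z15 z16 z17 z18 z19 z21 z22 z23.
  by rewrite !scale0r !add0r !addr0 /y_xz /xy_z lmonE rmonE.
have n1 := oner_neq0 K.
(* Of the sixteen cases, [cf], [be], [fb] and [ce] exclude those in which both factors of one of
   these products are 1. The seven others are the seven systems. *)
have [c|c] := idempotent_cases cc; have [f|f] := idempotent_cases ff;
have [b|b] := idempotent_cases (esym bb); have [e|e] := idempotent_cases (esym ee);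
rewrite c f in cf DLE; rewrite b e in be DRE; rewrite f b in fb; rewrite c e in ce;
rewrite ?scale1r ?scale0r ?addr0 ?add0r in DLE DRE;
try (by rewrite mulr1 in cf; move: n1; rewrite -cf eqxx);
try (by rewrite mulr1 in be; move: n1; rewrite be eqxx);
try (by rewrite mulr1 in fb; move: n1; rewrite fb eqxx);
try (by rewrite mulr1 in ce; move: n1; rewrite ce eqxx).
- by exists rule_a.
- by exists rule_e.
- by exists rule_b.
- by exists rule_f.
- by exists rule_g.
- by exists rule_c.
by exists rule_d.
Qed.

End Classification.

(** * Isomorphisms and invariants *)

Section OppositeAutomorphisms.
Variables (K : fieldType) (p q : bool).
Notation E := (ass2_gen K).
Notation F3 := (free_operad E 'I_3).
Notation R := (@ass_rel K).
Notation V := (@Var K E 'I_3).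

Definition opp_fun (e : E) : E :=
  (if p then s2_swap e.1 else e.1, if q then s2_swap e.2 else e.2).

Lemma opp_linear : linear opp_fun.
Proof. by move=> a [x y] [x' y']; rewrite /opp_fun /=; case: p; case: q. Qed.
Lemma opp_swap e : opp_fun (s2_swap e) = s2_swap (opp_fun e).
Proof. by case: e => x y; rewrite /opp_fun /=; case: p; case: q. Qed.
Definition opp_hom : sigma2_hom E E := Sigma2Hom opp_linear opp_swap.

Lemma opp_involutive : involutive opp_fun.
Proof. by move=> [[a b] [c d]]; rewrite /opp_fun /=; case: p; case: q. Qed.

Lemma free_map_involutive (I : finType) (x : free_operad E I) :
  free_map opp_hom I (free_map opp_hom I x) = x.
Proof.
have [t mt ->] := fcl_rep x; rewrite fcl_map // (fcl_map _ (ml_opmap opp_hom mt)).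
congr fcl; elim: t {mt} => //= [t -> s ->|a t ->|e t -> s ->] //.
by rewrite opp_involutive.
Qed.

Definition flip (b : bool) (op : term K E 'I_3 -> term K E 'I_3 -> term K E 'I_3) t s :=
  if b then op s t else op t s.

Lemma teq_opp_bul t s : teq (Op (opp_hom (bul K)) t s) (flip p (Op (bul K)) t s).
Proof.
rewrite /flip -[Op (opp_hom _)]/(Op (opp_fun (bul K))) /opp_fun; case: p.
  have -> : (s2_swap (bul K).1, if q then s2_swap (bul K).2 else (bul K).2) = s2_swap (bul K).
    by congr pair; case: q => //=; rewrite s2_swap0.
  exact: teq_swap.
have -> : ((bul K).1, if q then s2_swap (bul K).2 else (bul K).2) = bul K.
  by congr pair; case: q => //=; rewrite s2_swap0.
exact: teq_refl.
Qed.

Lemma teq_opp_cir t s : teq (Op (opp_hom (cir K)) t s) (flip q (Op (cir K)) t s).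
Proof.
rewrite /flip -[Op (opp_hom _)]/(Op (opp_fun (cir K))) /opp_fun; case: q.
  have -> : (if p then s2_swap (cir K).1 else (cir K).1, s2_swap (cir K).2) = s2_swap (cir K).
    by congr pair; case: p => //=; rewrite s2_swap0.
  exact: teq_swap.
have -> : (if p then s2_swap (cir K).1 else (cir K).1, (cir K).2) = cir K.
  by congr pair; case: p => //=; rewrite s2_swap0.
exact: teq_refl.
Qed.

Lemma ml_flip (b : bool) (e : E) t s (A : {set 'I_3}) :
  ml (Op e t s) A -> ml (flip b (Op e) t s) A.
Proof.
case: b => // -[B [C [-> d mt ms]]]; exists C, B; split; rewrite 1?setUC //.
by rewrite disjoint_sym.
Qed.

Section Image.
Variables (b1 b2 : bool) (m n : E).
Hypotheses (hm : forall t s, teq (Op (opp_hom m) t s) (flip b1 (Op m) t s))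
  (hn : forall t s, teq (Op (opp_hom n) t s) (flip b2 (Op n) t s)).

Lemma teq_flip b e t t' s s' : teq t t' -> teq s s' ->
  teq (flip b (Op e) t s) (flip b (Op e) t' s').
Proof. by case: b => ? ?; apply: teq_opc. Qed.

Lemma opp_lmon i j k (u : uniq [:: i; j; k]) : free_map opp_hom 'I_3 (lmon m n u) =
  fcl (flip b1 (Op m) (flip b2 (Op n) (V i) (V j)) (V k)).
Proof.
rewrite lmonE (fcl_map _ (ml_lmon m n u)); apply: fcl_teq.
- exact: ml_opmap (ml_lmon m n u).
- apply: ml_flip; have [B [C [e d ml1 ml2]]] := ml_lmon m n u.
  by exists B, C; split=> //; exact: ml_flip.
apply: teq_trans (hm _ _) _; apply: teq_flip; [exact: hn|exact: teq_refl].
Qed.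

Lemma opp_rmon i j k (u : uniq [:: i; j; k]) : free_map opp_hom 'I_3 (rmon m n u) =
  fcl (flip b1 (Op m) (V i) (flip b2 (Op n) (V j) (V k))).
Proof.
rewrite rmonE (fcl_map _ (ml_rmon m n u)); apply: fcl_teq.
- exact: ml_opmap (ml_rmon m n u).
- apply: ml_flip; have [B [C [e d ml1 ml2]]] := ml_rmon m n u.
  by exists B, C; split=> //; exact: ml_flip.
apply: teq_trans (hm _ _) _; apply: teq_flip; [exact: teq_refl|exact: hn].
Qed.

End Image.

Variables (l r o : bool) (D D' : F3 -> F3).
Hypotheses (rD : rewriting_map D) (fD : obeys_flags l r o D) (rD' : rewriting_map D')
  (fD' : obeys_flags (if p then r else l) (if p then l else r) (o (+) p (+) q) D').
Notation RD' := (combined_rel R R D').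

Lemma RD'_submodule : is_submodule RD'. Proof. exact: span_submodule. Qed.

Lemma RD'_opp x : RD' x -> RD' (- x).
Proof.
have [W0 WL _] := RD'_submodule => hx.
by rewrite -scaleN1r -[_ *: _]addr0; exact: WL.
Qed.

(** Opposites permute the variables, so this relation and the next two are wanted for every order of
    the three variables. *)
Lemma RD'_assoc (h : sigma2_hom (ass_gen K) E) :
  (forall y, R y -> RD' (free_map h _ y)) -> forall i j k (u : uniq [:: i; j; k]),
  RD' (fcl (Op (h (ass_mul K)) (Op (h (ass_mul K)) (V i) (V j)) (V k)) -
       fcl (Op (h (ass_mul K)) (V i) (Op (h (ass_mul K)) (V j) (V k)))).
Proof.
move=> hR i j k u; have [_ _ Wr] := RD'_submodule; have [s [si sj sk]] := perm3 u.
have := Wr s _ (hR _ (span_gen (erefl : lmon (ass_mul K) (ass_mul K) u123 -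
   rmon (ass_mul K) (ass_mul K) u123 = _))).
rewrite (lin_sub _ _ (hom_linear (I := 'I_3) (free_map h))) lmonE rmonE.
rewrite (fcl_map h (ml_lmon (ass_mul K) (ass_mul K) u123)).
rewrite (fcl_map h (ml_rmon (ass_mul K) (ass_mul K) u123)).
rewrite (@relabelB K (free_operad E)).
rewrite (fcl_relabel _ (ml_opmap h (ml_lmon (ass_mul K) (ass_mul K) u123))).
rewrite (fcl_relabel _ (ml_opmap h (ml_rmon (ass_mul K) (ass_mul K) u123))).
by rewrite /= si sj sk.
Qed.

Lemma RD'_lhs i j k (u : uniq [:: i; j; k]) :
  RD' (fcl (Op (bul K) (Op (cir K) (V i) (V j)) (V k)) -
       if (if p then r else l) then
         if o (+) p (+) q then fcl (Op (cir K) (Op (bul K) (V i) (V k)) (V j))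
         else fcl (Op (cir K) (V i) (Op (bul K) (V j) (V k)))
       else 0).
Proof.
have [_ _ Wr] := RD'_submodule; have [s [si sj sk]] := perm3 u.
have : RD' (xy_z (bul K) (cir K) - D' (xy_z (bul K) (cir K))).
  by apply: span_gen; apply: Or32; exists (xy_z (bul K) (cir K)) => //; exact: F3_12_xy_z.
move=> /(Wr s); rewrite (@relabelB K (free_operad E)) (proj1 fD') /flag_lhs /xy_z lmonE.
rewrite (fcl_relabel _ (ml_lmon (bul K) (cir K) u123)) /= si sj sk.
case: (if p then r else l); last by rewrite (lin_zero (@free_relabel_linear _ _ _ _ _ _)).
case: (o (+) p (+) q).
  rewrite /xz_y lmonE [X in _ - X]fcl_relabel /= ?si ?sj ?sk //.
  exact: (ml_lmon (cir K) (bul K) (isT : uniq [:: x1; x3; x2])).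
rewrite /x_yz rmonE [X in _ - X]fcl_relabel /= ?si ?sj ?sk //.
exact: (ml_rmon (cir K) (bul K) u123).
Qed.

Lemma RD'_rhs i j k (u : uniq [:: i; j; k]) :
  RD' (fcl (Op (bul K) (V i) (Op (cir K) (V j) (V k))) -
       if (if p then l else r) then
         if o (+) p (+) q then fcl (Op (cir K) (V j) (Op (bul K) (V i) (V k)))
         else fcl (Op (cir K) (Op (bul K) (V i) (V j)) (V k))
       else 0).
Proof.
have [_ _ Wr] := RD'_submodule; have [s [si sj sk]] := perm3 u.
have : RD' (x_yz (bul K) (cir K) - D' (x_yz (bul K) (cir K))).
  by apply: span_gen; apply: Or32; exists (x_yz (bul K) (cir K)) => //; exact: F3_12_x_yz.
move=> /(Wr s); rewrite (@relabelB K (free_operad E)) (proj2 fD') /flag_rhs /x_yz rmonE.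
rewrite (fcl_relabel _ (ml_rmon (bul K) (cir K) u123)) /= si sj sk.
case: (if p then l else r); last by rewrite (lin_zero (@free_relabel_linear _ _ _ _ _ _)).
case: (o (+) p (+) q).
  rewrite /y_xz rmonE [X in _ - X]fcl_relabel /= ?si ?sj ?sk //.
  exact: (ml_rmon (cir K) (bul K) (isT : uniq [:: x2; x1; x3])).
rewrite /xy_z lmonE [X in _ - X]fcl_relabel /= ?si ?sj ?sk //.
exact: (ml_lmon (cir K) (bul K) u123).
Qed.

(** The opposite of * exchanges the left and the right rule, and the opposite of either product
    exchanges the forms (b), (c), (d) with (e), (f), (g). This explains the flags required of [D'].
    By equivariance the generators of the relations suffice. *)
Lemma opp_combined_rel x : combined_rel R R D x -> RD' (free_map opp_hom 'I_3 x).
Proof.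
have [W0 WL Wr] := RD'_submodule.
have hL := hom_linear (I := 'I_3) (free_map opp_hom).
have sub (X : F3 -> Prop) (g : F3 -> F3) : is_submodule X ->
    (forall a x y, X x -> X y -> g (a *: x + y) = a *: g x + g y) ->
    (forall (s : 'S_3) x, X x -> g (relabel (perm_bij s) x) = relabel (perm_bij s) (g x)) ->
    is_submodule (fun x => X x /\ RD' (free_map opp_hom 'I_3 (g x))).
  move=> [X0 XL Xr] gL gr; split=> [|a y z [Xy hy] [Xz hz]|s y [Xy hy]].
  - split=> //; have := gL (-1) 0 0 X0 X0; rewrite scaler0 addr0 scaleN1r addNr => ->.
    by rewrite (lin_zero hL).
  - by split; [exact: XL|rewrite gL // hL; exact: WL].
  by split; [exact: Xr|rewrite gr // hom_relabel; exact: Wr].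
have assoc (h : sigma2_hom (ass_gen K) E) b : (forall y, R y -> RD' (free_map h _ y)) ->
    (forall t s, teq (Op (opp_hom (h (ass_mul K))) t s) (flip b (Op (h (ass_mul K))) t s)) ->
    forall y, R y -> RD' (free_map opp_hom 'I_3 (free_map h 'I_3 y)).
  move=> hR hb y Ry.
  have kL := hom_linear (I := 'I_3) (free_map h).
  apply: (Ry (fun y => RD' (free_map opp_hom 'I_3 (free_map h 'I_3 y)))) => [|_ ->].
    split=> [|a u w hu hw|s u hu]; first by rewrite (lin_zero kL) (lin_zero hL).
      by rewrite kL hL; exact: WL.
    by rewrite !hom_relabel; exact: Wr.
  rewrite (lin_sub _ _ kL) (lin_sub _ _ hL) lmonE rmonE.
  rewrite (fcl_map h (ml_lmon (ass_mul K) (ass_mul K) u123)).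
  rewrite (fcl_map h (ml_rmon (ass_mul K) (ass_mul K) u123)).
  have := opp_lmon hb hb u123; rewrite lmonE => ->.
  have := opp_rmon hb hb u123; rewrite rmonE => ->.
  case: (b); last exact: (RD'_assoc hR u123).
  rewrite /flip -opprB; apply: RD'_opp.
  exact: (RD'_assoc hR (isT : uniq [:: x3; x2; x1])).
move=> hx; apply: (hx (fun x => RD' (free_map opp_hom 'I_3 x))) => [|y].
  split=> [|a u w hu hw|s u hu]; first by rewrite (lin_zero hL).
    by rewrite hL; exact: WL.
  by rewrite hom_relabel; exact: Wr.
case=> [[z Rz ->]|[z Fz ->]|[z Rz ->]].
- by apply: (assoc (inj1 _ _) p) Rz => [y0|]; [exact: combined_rel1|exact: teq_opp_bul].
- have [_ DL Dr] := rD; have [DLx DRx] := fD.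
  suff h : F3_12 z -> F3_12 z /\ RD' (free_map opp_hom 'I_3 (z - D z)) by have [] := h Fz.
  apply: (@F3_12_ind K (fun z => F3_12 z /\ RD' (free_map opp_hom 'I_3 (z - D z)))).
  + apply: (sub _ (fun z => z - D z)); first exact: span_submodule.
      by move=> a u w Fu Fw /=; rewrite DL // opprD scalerBr -scalerN; exact: addrACA.
    by move=> s u Fu /=; rewrite Dr //; apply: esym; exact: (@relabelB K (free_operad E)).
  + split; first exact: F3_12_xy_z.
    rewrite (lin_sub _ _ hL) DLx (opp_lmon teq_opp_bul teq_opp_cir) /flag_lhs.
    rewrite (fun_if (free_map opp_hom 'I_3)) (fun_if (free_map opp_hom 'I_3)) (lin_zero hL).
    rewrite (opp_lmon teq_opp_cir teq_opp_bul) (opp_rmon teq_opp_cir teq_opp_bul) /flip.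
    move: (@RD'_lhs) (@RD'_rhs) => e1 e2.
    (* One instance for each value of [p] and [q]: the image of (x1 o x2) * x3 stays a left monomial
       when [p] is false and becomes a right one otherwise, with x1 and x2 exchanged when [q] is
       true. *)
    move: {e1 e2} (e1 x1 x2 x3 isT) (e1 x2 x1 x3 isT) (e2 x3 x1 x2 isT) (e2 x3 x2 x1 isT).
    by case: p; case: q; case: l; case: o.
  split; first exact: F3_12_x_yz.
  rewrite (lin_sub _ _ hL) DRx (opp_rmon teq_opp_bul teq_opp_cir) /flag_rhs.
  rewrite (fun_if (free_map opp_hom 'I_3)) (fun_if (free_map opp_hom 'I_3)) (lin_zero hL).
  rewrite (opp_lmon teq_opp_cir teq_opp_bul) (opp_rmon teq_opp_cir teq_opp_bul) /flip.
  move: (@RD'_lhs) (@RD'_rhs) => e1 e2.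
  move: {e1 e2} (e1 x2 x3 x1 isT) (e1 x3 x2 x1 isT) (e2 x1 x2 x3 isT) (e2 x1 x3 x2 isT).
  by case: p; case: q; case: r; case: o.
by apply: (assoc (inj2 _ _) q) Rz => [y0|]; [exact: combined_rel2|exact: teq_opp_cir].
Qed.

End OppositeAutomorphisms.

Section Isomorphisms.
Variable K : fieldType.
Notation E := (ass2_gen K).
Notation F3 := (free_operad E 'I_3).

(* [p] and [q] tell whether * and o are replaced by their opposites. *)
Lemma flags_iso (p q l r o : bool) (D D' : F3 -> F3) :
  rewriting_map D -> obeys_flags l r o D -> rewriting_map D' ->
  obeys_flags (if p then r else l) (if p then l else r) (o (+) p (+) q) D' ->
  ass_laws_iso D D'.
Proof.
move=> rD fD rD' fD'.
have f x := opp_combined_rel rD fD fD' (x := x).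
(* The change of flags is involutive, so the same map with [D] and [D'] exchanged gives the
   inverse. *)
have fD2 : obeys_flags (if p then if p then l else r else if p then r else l)
    (if p then if p then r else l else if p then l else r) (o (+) p (+) q (+) p (+) q) D.
  by move: fD; case: (p); case: (q); case: (o).
have g x := opp_combined_rel rD' fD' fD2 (x := x).
exists (presented_map f) => I.
exists (presented_map g I) => u.
  have [x ->] := pr_surj u.
  transitivity (presented_map g I (pr _ (free_map (opp_hom K p q) I x))).
    by congr (presented_map g I _); exact: presented_funE.
  transitivity (pr (combined_rel (@ass_rel K) (@ass_rel K) D) (free_map (opp_hom K p q) I (free_map (opp_hom K p q) I x))).
    exact: presented_funE.
  by rewrite free_map_involutive.
have [x ->] := pr_surj u.
transitivity (presented_map f I (pr _ (free_map (opp_hom K p q) I x))).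
  by congr (presented_map f I _); exact: presented_funE.
transitivity (pr (combined_rel (@ass_rel K) (@ass_rel K) D') (free_map (opp_hom K p q) I (free_map (opp_hom K p q) I x))).
  exact: presented_funE.
by rewrite free_map_involutive.
Qed.

Lemma class_iso (a a' : rules) (D D' : F3 -> F3) :
  rewriting_map D -> obeys a D -> rewriting_map D' -> obeys a' D' ->
  class_of a = class_of a' -> ass_laws_iso D D'.
Proof.
rewrite !obeysE => rD fD rD' fD' caa'.
(* Within one class the left flags differ only for truncated laws, where exchanging the two rules
   repairs them. Then [q] is chosen to correct the third flag, which [p] may have changed. *)
pose p := (flags_of a).1.1 != (flags_of a').1.1.
pose q := (flags_of a).2 (+) (flags_of a').2 (+) p.
apply: (@flags_iso p q _ _ _ D D' rD fD rD'); rewrite /p /q.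
by move: caa' fD'; rewrite /q /p; case: (a); case: (a').
Qed.

End Isomorphisms.

(** * Zero composites of binary operations as invariants *)

Section Invariants.
Variable K : fieldType.

Lemma negb_bij : bijective negb. Proof. by exists negb; exact: negbK. Qed.

(** Binary operations have the inputs [true], taken as the first, and [false]. In mu(nu, 1) the
    first input of mu receives the two inputs of nu, the second one receives the unit. *)
Definition pair_inputs (b : bool) : finType := if b then (bool : finType) else (unit : finType).

Definition partial_args (P : operad K) (nu : P bool) (b : bool) : P (pair_inputs b) :=
  match b return P (pair_inputs b) with true => nu | false => op_one P end.

Definition comp1 (P : operad K) (mu nu : P bool) : P {b : bool & pair_inputs b} :=
  op_comp mu (partial_args nu).

Definition has_zero_composite (P : operad K) := exists mu nu : P bool,
  [/\ mu <> 0, nu <> 0 & comp1 mu nu = 0].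

Definition has_zero_composites (P : operad K) := exists mu nu : P bool,
  [/\ mu <> 0, nu <> 0, comp1 mu nu = 0 & comp1 (relabel negb_bij mu) nu = 0].

Lemma hom_comp1 (P Q : operad K) (phi : operad_hom P Q) mu nu :
  phi _ (comp1 mu nu) = comp1 (phi _ mu) (phi _ nu).
Proof.
rewrite /comp1 hom_comp; congr op_comp.
by apply: functional_extensionality_dep => -[] //=; rewrite hom_one.
Qed.

Lemma iso_zero_composite (P Q : operad K) : operad_iso P Q ->
  (has_zero_composite P <-> has_zero_composite Q) /\
  (has_zero_composites P <-> has_zero_composites Q).
Proof.
move=> [phi hphi]; have phi0 I : phi I 0 = 0 by exact: (lin_zero (@hom_linear _ _ _ phi I)).
have inj I : injective (phi I) by exact: bij_inj.
have nz (x : P bool) : x <> 0 -> phi _ x <> 0 by move=> x0 e; apply: x0; apply: inj; rewrite phi0.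
have nz' (x : P bool) : phi _ x <> 0 -> x <> 0 by move=> x0 e; apply: x0; rewrite e.
have surj (y : Q bool) : exists x, y = phi _ x by have [g _ gK] := hphi bool; exists (g y); rewrite gK.
split; split.
- move=> [mu [nu [m n e]]]; exists (phi _ mu), (phi _ nu); split; [exact: nz|exact: nz|].
  by rewrite -hom_comp1 e.
- move=> [mu [nu]]; have [m ->] := surj mu; have [n ->] := surj nu => -[m0 n0 e].
  exists m, n; split; [exact: nz'|exact: nz'|].
  by apply: inj; rewrite phi0 hom_comp1.
- move=> [mu [nu [m n e e']]]; exists (phi _ mu), (phi _ nu).
  split; [exact: nz|exact: nz|by rewrite -hom_comp1 e|].
  by rewrite -hom_relabel -hom_comp1 e'.
move=> [mu [nu]]; have [m ->] := surj mu; have [n ->] := surj nu => -[m0 n0 e e'].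
exists m, n; split; [exact: nz'|exact: nz'| |].
  by apply: inj; rewrite phi0 hom_comp1.
by apply: inj; rewrite phi0 hom_comp1 hom_relabel.
Qed.

End Invariants.

Section BinaryOperations.
Variables (K : fieldType) (E : sigma2_module K).

(** There are only binary generators, hence no constants: a product over the empty set has factors
    over the empty set, and induction applies. On one input, likewise, one factor of any product has
    no variable and the product vanishes. *)
Lemma ml_set0 (I : finType) (t : term K E I) : ml t set0 -> teq t Zero.
Proof.
elim: t => //=.
- by move=> i /setP/(_ i); rewrite !inE eqxx.
- by move=> _; exact: teq_refl.
- move=> t IHt s IHs [/IHt ht /IHs hs]; apply: teq_trans (teq_addc ht hs) _; exact: teq_add0.
- move=> a t IHt /IHt ht; apply: teq_trans (teq_scalec a ht) _; exact: teq_scale0.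
move=> e t IHt s _ [B [C [/esym/eqP]]]; rewrite setU_eq0 => /andP[/eqP B0 _] _ mt _.
rewrite B0 in mt; apply: teq_trans (teq_opc e (IHt mt) teq_refl) _; exact: teq_op0l.
Qed.

Lemma ml_set1 (I : finType) (i : I) (t : term K E I) : ml t [set i] ->
  exists a, teq t (Scale a (Var i)).
Proof.
have z (u : term K E I) : teq u Zero -> exists a, teq u (Scale a (Var i)).
  by move=> u0; exists 0; apply: teq_trans u0 _; exact/teq_sym/teq_scale_zero.
elim: t => //=.
- move=> j /set1_inj ->; exists 1; exact/teq_sym/teq_scale1.
- by move=> _; apply: z; exact: teq_refl.
- move=> t IHt s IHs [/IHt[a ha] /IHs[b hb]]; exists (a + b).
  by apply: teq_trans (teq_addc ha hb) _; exact/teq_sym/teq_scaleDl.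
- move=> a t IHt /IHt[b hb]; exists (a * b).
  by apply: teq_trans (teq_scalec a hb) _; exact: teq_scaleA.
move=> e t _ s _ [B [C [iBC d mt ms]]]; apply: z.
have : B \subset [set i] by rewrite iBC subsetUl.
rewrite subset1 => /orP[/eqP eB|/eqP B0].
  have C0 : C = set0.
    apply/setP => j; rewrite inE; apply/negP => jC.
    have : j \in [set i] by rewrite iBC inE jC orbT.
    rewrite inE => /eqP ji; have /pred0P/(_ j) := d.
    by rewrite /= jC eB inE ji eqxx.
  rewrite C0 in ms; apply: teq_trans (teq_opc e teq_refl (ml_set0 ms)) _; exact: teq_op0r.
rewrite B0 in mt; apply: teq_trans (teq_opc e (ml_set0 mt) teq_refl) _; exact: teq_op0l.
Qed.

(** A nonzero product must give one input to each factor, and each factor is then a multiple of its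
    variable. If the inputs come in the wrong order, the operation is replaced by its opposite. *)
Lemma ml_bool (t : term K E bool) : ml t setT ->
  exists e : E, teq t (Op e (Var true) (Var false)).
Proof.
have z (u : term K E bool) : teq u Zero -> exists e : E, teq u (Op e (Var true) (Var false)).
  by move=> u0; exists 0; apply: teq_trans u0 _; exact/teq_sym/teq_ope0.
elim: t => //=.
- by move=> b /setP/(_ (~~ b)); rewrite !inE; case: b.
- by move=> _; apply: z; exact: teq_refl.
- move=> t IHt s IHs [/IHt[a ha] /IHs[b hb]]; exists (a + b).
  by apply: teq_trans (teq_addc ha hb) _; exact/teq_sym/teq_opeD.
- move=> a t IHt /IHt[b hb]; exists (a *: b).
  by apply: teq_trans (teq_scalec a hb) _; exact/teq_sym/teq_opeZ.
move=> e t _ s _ [B [C [TBC d mt ms]]].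
have BC b : (b \in B) = ~~ (b \in C).
  have : b \in B :|: C by rewrite -TBC inE.
  by have /pred0P/(_ b) := d; rewrite /= inE; case: (b \in B); case: (b \in C).
have op2 b (x y : K) : teq (Op e (Scale x (Var b)) (Scale y (Var (~~ b)))) (Scale (x * y) (Op e (Var b) (Var (~~ b)))).
  apply: teq_trans (teq_opZl _ _ _ _) _; apply: teq_trans (teq_scalec x (teq_opZr _ _ _ _)) _.
  exact: teq_scaleA.
case Bt: (true \in B); case Bf: (false \in B).
- have C0 : C = set0 by apply/setP => -[]; rewrite inE; apply/negbTE; rewrite -BC ?Bt ?Bf.
  rewrite C0 in ms; apply: z.
  apply: teq_trans (teq_opc e teq_refl (ml_set0 ms)) _; exact: teq_op0r.
- have eB : B = [set true] by apply/setP => -[]; rewrite inE ?Bt ?Bf.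
  have eC : C = [set false].
    by apply/setP => b; rewrite inE -[b \in C]negbK -BC; case: b; rewrite ?Bt ?Bf.
  rewrite eB in mt; rewrite eC in ms.
  have [x hx] := ml_set1 mt; have [y hy] := ml_set1 ms; exists ((x * y) *: e).
  apply: teq_trans (teq_opc e hx hy) _; apply: teq_trans (op2 true _ _) _.
  exact/teq_sym/teq_opeZ.
- have eB : B = [set false] by apply/setP => -[]; rewrite inE ?Bt ?Bf.
  have eC : C = [set true].
    by apply/setP => b; rewrite inE -[b \in C]negbK -BC; case: b; rewrite ?Bt ?Bf.
  rewrite eB in mt; rewrite eC in ms.
  have [x hx] := ml_set1 mt; have [y hy] := ml_set1 ms; exists ((x * y) *: s2_swap e).
  apply: teq_trans (teq_opc e hx hy) _; apply: teq_trans (op2 false _ _) _.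
  apply: teq_sym; apply: teq_trans (teq_opeZ _ _ _ _) _.
  apply: teq_scalec; exact: teq_swap.
have B0 : B = set0 by apply/setP => -[]; rewrite inE ?Bt ?Bf.
rewrite B0 in mt; apply: z.
apply: teq_trans (teq_opc e (ml_set0 mt) teq_refl) _; exact: teq_op0l.
Qed.

Lemma ml_op_bool (e : E) b : ml (@Op K E bool e (Var b) (Var (~~ b))) setT.
Proof.
exists [set b], [set ~~ b]; split=> //; first by apply/setP => c; rewrite !inE; case: b; case: c.
by rewrite disjoints1 inE; case: b.
Qed.

Variable R : free_operad E 'I_3 -> Prop.
Notation P := (presented R).

Definition bin (e : E) : P bool := cl R (Op e (Var true) (Var false)).

Lemma bin_surj (x : P bool) : exists e, x = bin e.
Proof.
have [t mt ->] := cl_rep x; have [e he] := ml_bool mt; exists e.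
by apply: cl_teq => //; exact: (ml_op_bool e true).
Qed.

Lemma bin0 : bin 0 = 0.
Proof. by rewrite -(cl0 R bool); apply: cl_teq; [exact: (ml_op_bool 0 true)|by []|exact: teq_ope0]. Qed.

Lemma bin_relabel e : relabel negb_bij (bin e) = bin (s2_swap e).
Proof.
rewrite cl_relabel; last exact: (ml_op_bool e true).
apply: cl_teq; [exact: (ml_op_bool e false)|exact: (ml_op_bool _ true)|].
exact/teq_sym/teq_swap.
Qed.

Definition in1 : {b : bool & pair_inputs b} := existT (fun b => pair_inputs b : Type) true true.
Definition in2 : {b : bool & pair_inputs b} := existT (fun b => pair_inputs b : Type) true false.
Definition in3 : {b : bool & pair_inputs b} := existT (fun b => pair_inputs b : Type) false tt.

Lemma pair_inputsP (i : {b : bool & pair_inputs b}) : [|| i == in1, i == in2 | i == in3].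
Proof.
case: i => -[] x; last by have -> : x = tt by case: (x : unit).
have [->|->] : x = true \/ x = false by case: (x : bool); [left|right].
  by rewrite eqxx.
by rewrite eqxx orbT.
Qed.

Lemma in_neq : (in1 == in2 = false) * (in1 == in3 = false) * (in2 == in3 = false) *
  (in2 == in1 = false) * (in3 == in1 = false) * (in3 == in2 = false).
Proof.
have h12 : in1 == in2 = false by rewrite /in1 /in2 eq_Tagged.
have h13 : in1 == in3 = false by apply/eqP => /(congr1 (@tag _ _)).
have h23 : in2 == in3 = false by apply/eqP => /(congr1 (@tag _ _)).
by rewrite h12 h13 h23 (eq_sym in2) (eq_sym in3) h12 (eq_sym in3) h13 h23.
Qed.

Lemma ml_comp1 (e e' : E) :
  ml (Op e (Op e' (Var in1) (Var in2)) (@Var K E _ in3)) setT.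
Proof.
exists ([set in1] :|: [set in2]), [set in3]; split=> //.
- apply/setP => i; rewrite !inE; by case/or3P: (pair_inputsP i) => /eqP ->; rewrite eqxx ?orbT.
- by rewrite disjoint_setU !disjoints1 !inE !in_neq.
by exists [set in1], [set in2]; split=> //; rewrite disjoints1 inE in_neq.
Qed.

Lemma comp1_bin (e e' : E) :
  comp1 (bin e) (bin e') = cl R (Op e (Op e' (Var in1) (Var in2)) (Var in3)).
Proof.
pose args (b : bool) : term K E (pair_inputs b) :=
  match b return term K E (pair_inputs b) with
  | true => Op e' (Var true) (Var false) | false => Var tt end.
have margs b : ml (args b) setT by case: b; [exact: (ml_op_bool e' true)|exact: ml_one].
have -> : comp1 (bin e) (bin e') = op_comp (cl R (Op e (Var true) (Var false))) (fun b => cl R (args b)).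
  congr op_comp; apply: functional_extensionality_dep => -[] //=.
  by rewrite /cl (fclE (ml_one E)).
by rewrite cl_comp //; exact: (ml_op_bool e true).
Qed.

End BinaryOperations.

Section Composites.
Variables (K : fieldType).
Notation E := (ass2_gen K).
Notation F3 := (free_operad E 'I_3).
Notation R := (@ass_rel K).

Section ZeroComposites.
Variables (l : bool) (D : F3 -> F3).
Hypotheses (rD : rewriting_map D) (fD : obeys_flags l true false D).
Notation RD := (combined_rel R R D).
Variables (e e' : E).
Hypothesis zero : comp1 (bin RD e) (bin RD e') = 0.

(** The equation mu(nu, 1) = 0 evaluated in the matrix model along the path [w], the letters 0, 1, 2
    being the values of the three inputs. [sum pre post b] is the contribution of nu between [pre]
    and [post]; [b] is false when the first component of nu is read, on which o-products vanish. *)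
Lemma comp1_entry (w : seq (option nat)) :
  let d (v : seq (option nat)) : K := (v == w)%:R in
  let sum (pre post : seq (option nat)) (b : bool) : K :=
    (e'.1.1 : K) * d (pre ++ [:: Some 0; Some 1] ++ post) +
    (e'.1.2 : K) * d (pre ++ [:: Some 1; Some 0] ++ post) +
    ((if b then e'.2.1 : K else 0) * d (pre ++ [:: Some 0; None; Some 1] ++ post) +
     (if b then e'.2.2 : K else 0) * d (pre ++ [:: Some 1; None; Some 0] ++ post)) in
  (e.1.1 : K) * sum [::] [:: Some 2] l + (e.1.2 : K) * sum [:: Some 2] [::] true +
  ((e.2.1 : K) * sum [::] [:: None; Some 2] true +
   (e.2.2 : K) * sum [:: Some 2; None] [::] true) = 0.
Proof.
move=> d sum; pose Pw (v : seq (option nat)) : 'M[K]_((size w).+1) := \prod_(a <- v) path_mx K w a.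
have Pcat v v' : Pw v * Pw v' = Pw (v ++ v') by rewrite /Pw big_cat.
pose F (A : 'M[K]_((size w).+1)) : K := A ord0 ord_max.
have FP v : F (Pw v) = d v by rewrite /F /Pw path_mx_prod drop0.
have FD A B : F (A + B) = F A + F B by rewrite /F mxE.
have FZ a A : F (a *: A) = a * F A by rewrite /F mxE.
pose k (i : {b : bool & pair_inputs b}) :=
  let a := if i == in1 then 0%N else if i == in2 then 1%N else 2 in
  (Pw [:: Some a], Pw [:: Some a]).
pose N := Pw [:: None].
have linl := @mop_linl _ _ N l true false; have linr := @mop_linr _ _ N l true false.
have line := @mop_line _ _ N l true false; have swap := @mop_swap _ _ N l true false.
have sat := model_sat N rD fD.
have := evp_cl linl linr line swap sat k (ml_comp1 e e').
rewrite -comp1_bin zero (lin_zero (evp_linear linl linr line swap sat k)) /=.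
have -> : k in1 = (Pw [:: Some 0%N], Pw [:: Some 0%N]) by rewrite /k eqxx.
have -> : k in2 = (Pw [:: Some 1%N], Pw [:: Some 1%N]) by rewrite /k in_neq eqxx.
have -> : k in3 = (Pw [:: Some 2], Pw [:: Some 2]) by rewrite /k !in_neq.
set op := mop _ _ _ _; set U := op e' _ _; set Z := (Pw [:: Some 2], _).
have F0 : F 0 = 0 by rewrite /F mxE.
move=> h; have {h} : F (op e U Z).2 = 0 by rewrite -h; exact: F0.
have U2 : U.2 = (e'.1.1 : K) *: Pw [:: Some 0; Some 1]%N + (e'.1.2 : K) *: Pw [:: Some 1; Some 0]%N +
   ((e'.2.1 : K) *: Pw [:: Some 0; None; Some 1]%N + (e'.2.2 : K) *: Pw [:: Some 1; None; Some 0]%N).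
  transitivity ((e'.1.1 : K) *: (Pw [:: Some 0%N] * Pw [:: Some 1%N]) +
    (e'.1.2 : K) *: (Pw [:: Some 1%N] * Pw [:: Some 0%N]) +
   ((e'.2.1 : K) *: (Pw [:: Some 0%N] * Pw [:: None] * Pw [:: Some 1%N]) +
    (e'.2.2 : K) *: (Pw [:: Some 1%N] * Pw [:: None] * Pw [:: Some 0%N]))).
    by rewrite /U /op /mop /bmul /cmul /=; case: (l).
  by rewrite !Pcat.
have U1 : U.1 = (e'.1.1 : K) *: Pw [:: Some 0; Some 1]%N + (e'.1.2 : K) *: Pw [:: Some 1; Some 0]%N +
   ((e'.2.1 : K) *: 0 + (e'.2.2 : K) *: 0).
  transitivity ((e'.1.1 : K) *: (Pw [:: Some 0%N] * Pw [:: Some 1%N]) +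
    (e'.1.2 : K) *: (Pw [:: Some 1%N] * Pw [:: Some 0%N]) +
   ((e'.2.1 : K) *: 0 + (e'.2.2 : K) *: 0)); first by [].
  by rewrite !Pcat.
have -> : (op e U Z).2 = (e.1.1 : K) *: ((if l then U.2 else U.1) * Pw [:: Some 2]) +
    (e.1.2 : K) *: (Pw [:: Some 2] * U.2) +
    ((e.2.1 : K) *: (U.2 * Pw [:: None] * Pw [:: Some 2]) +
     (e.2.2 : K) *: (Pw [:: Some 2] * Pw [:: None] * U.2)).
  by rewrite /op /mop /bmul /cmul /=; case: (l).
rewrite -!mulrA Pcat => <-.
rewrite !FD !FZ; congr (_ * _ + _ * _ + (_ * _ + _ * _)).
- case: (l); rewrite ?U1 ?U2 !mulrDl !FD -!scalerAl !FZ ?mul0r ?F0 ?mul0r ?mulr0 !Pcat !FP /sum ?mul0r //.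
- by rewrite U2 !mulrDr !FD -!scalerAr !FZ !Pcat !FP.
- by rewrite U2 !mulrDl !FD -!scalerAl !FZ !Pcat !FP.
by rewrite mulrA Pcat U2 !mulrDr !FD -!scalerAr !FZ !Pcat !FP.
Qed.

Hypothesis e'0 : e' <> 0.

Lemma annihilator_eq0 (a : K) :
  [/\ a * e'.1.1 = 0, a * e'.1.2 = 0, a * e'.2.1 = 0 & a * e'.2.2 = 0] -> a = 0.
Proof.
have [//|/mulfI inj] := eqVneq a 0; rewrite -{1 2 3 4}(mulr0 a) => -[/inj a0 /inj a1 /inj a2 /inj a3].
case: e'0; move: a0 a1 a2 a3; case: (e') => -[? ?] [? ?] /= -> -> -> ->.
by [].
Qed.

(** The four coordinates of [e] put the third input in four different positions: after or before nu,
    without or with a separator. Each resulting word isolates the product of one coordinate of [e]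
    with one of [e'], and some coordinate of [e'] is nonzero. *)
Lemma zero_comp1_coords :
  [/\ l -> e.1.1 = 0, e.1.2 = 0, e.2.1 = 0 & e.2.2 = 0].
Proof.
pose word pre post (i : nat) : seq (option nat) :=
  nth [::] [seq pre ++ v ++ post | v <- [:: [:: Some 0; Some 1]; [:: Some 1; Some 0];
    [:: Some 0; None; Some 1]; [:: Some 1; None; Some 0]]] i.
pose c pre post i := comp1_entry (word pre post i).
split=> [lT|||]; apply: annihilator_eq0.
- move: (c [::] [:: Some 2]) => h; move: (h 0%N) (h 1%N) (h 2) (h 3).
  by rewrite lT /= /eq_op /= ?(mulr0, mulr1, addr0, add0r).
- move: (c [:: Some 2] [::]) => h; move: (h 0%N) (h 1%N) (h 2) (h 3).
  by rewrite /= /eq_op /= ?(mulr0, mulr1, addr0, add0r).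
- move: (c [::] [:: None; Some 2]) => h; move: (h 0%N) (h 1%N) (h 2) (h 3).
  by rewrite /= /eq_op /= ?(mulr0, mulr1, addr0, add0r).
move: (c [:: Some 2; None] [::]) => h; move: (h 0%N) (h 1%N) (h 2) (h 3).
by rewrite /= /eq_op /= ?(mulr0, mulr1, addr0, add0r).
Qed.

End ZeroComposites.
End Composites.

Section Classes.
Variables (K : fieldType).
Notation E := (ass2_gen K).
Notation F3 := (free_operad E 'I_3).
Notation R := (@ass_rel K).

Lemma bin_bul_cir_neq0 (l r o : bool) (D : F3 -> F3) :
  rewriting_map D -> obeys_flags l r o D ->
  bin (combined_rel R R D) (bul K) <> 0 /\ bin (combined_rel R R D) (cir K) <> 0.
Proof.
move=> rD fD.
have g1 : good [:: [:: true; false]] by [].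
have g2 : good [:: [:: true]; [:: false]] by [].
have s1 : supp [:: [:: true; false]] = setT by apply/setP => -[]; rewrite !inE.
have s2 : supp [:: [:: true]; [:: false]] = setT by apply/setP => -[]; rewrite !inE.
have c1 := coef_normal rD fD g1 g1 s1; have c2 := coef_normal rD fD g2 g2 s2.
rewrite eqxx in c1 c2.
split=> e.
  move: c1; have -> : cl (combined_rel R R D) (normal K [:: [:: true; false]]) = bin _ (bul K) by [].
  by rewrite e (coef0 rD fD) => /esym/eqP; rewrite oner_eq0.
move: c2; have -> : cl (combined_rel R R D) (normal K [:: [:: true]; [:: false]]) = bin _ (cir K) by [].
by rewrite e (coef0 rD fD) => /esym/eqP; rewrite oner_eq0.
Qed.

Lemma comp1_bul_cir (r o : bool) (D : F3 -> F3) : obeys_flags false r o D ->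
  comp1 (bin (combined_rel R R D) (bul K)) (bin _ (cir K)) = 0.
Proof.
move=> [fD _]; rewrite comp1_bin -(cl0 _ {b : bool & pair_inputs b}).
have d12 : [disjoint [set in1] & [set in2]] by rewrite disjoints1 inE in_neq.
have d13 : [disjoint [set in1] & [set in3]] by rewrite disjoints1 inE in_neq.
have d23 : [disjoint [set in2] & [set in3]] by rewrite disjoints1 inE in_neq.
apply: pcl_setT => //; first exact: ml_comp1.
have <- : [set in1] :|: ([set in2] :|: [set in3]) = setT :> {set {b : bool & pair_inputs b}}.
  by apply/setP => i; rewrite !inE; case/or3P: (pair_inputsP i) => ->; rewrite ?orbT.
by rewrite (pcl_lhs d12 d13 d23 _ _ _ (p := Zero)) // fD fcl0.
Qed.

(** With the opposite of * at the root, the composite is a right monomial, so that the right rule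
    makes it vanish. *)
Lemma comp1_bul_op_cir (o : bool) (D : F3 -> F3) : obeys_flags false false o D ->
  comp1 (bin (combined_rel R R D) (s2_swap (bul K))) (bin _ (cir K)) = 0.
Proof.
move=> [_ fD]; rewrite comp1_bin -(cl0 _ {b : bool & pair_inputs b}).
have d12 : [disjoint [set in1] & [set in2]] by rewrite disjoints1 inE in_neq.
have d31 : [disjoint [set in3] & [set in1]] by rewrite disjoints1 inE in_neq.
have d32 : [disjoint [set in3] & [set in2]] by rewrite disjoints1 inE in_neq.
have eT : [set in3] :|: ([set in1] :|: [set in2]) = setT :> {set {b : bool & pair_inputs b}}.
  by apply/setP => i; rewrite !inE; case/or3P: (pair_inputsP i) => ->; rewrite ?orbT.
have m : ml (Op (bul K) (Var in3) (Op (cir K) (Var in1) (@Var K E _ in2))) setT.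
  by rewrite -eT; apply: ml_Op => //; [apply: ml_Op|rewrite disjoint_sym disjoint_setU !(disjoint_sym _ [set in3]) d31].
transitivity (cl (combined_rel R R D) (Op (bul K) (Var in3) (Op (cir K) (Var in1) (Var in2)))).
  by apply: cl_teq => //; [exact: ml_comp1|exact: teq_swap].
apply: pcl_setT => //; rewrite -eT.
by rewrite (pcl_rhs d31 d32 d12 _ _ _ (p := Zero)) // fD fcl0.
Qed.

Lemma no_zero_composite (D : F3 -> F3) : rewriting_map D -> obeys_flags true true false D ->
  ~ has_zero_composite (combined R R D).
Proof.
move=> rD fD [mu [nu []]]; have [e ->] := bin_surj mu; have [e' ->] := bin_surj nu => e0 e'0 z.
have e'1 : e' <> 0 by move=> h; apply: e'0; rewrite h bin0.
have [/(_ isT)] := zero_comp1_coords rD fD z e'1.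
by case: e e0 {z} => -[? ?] [? ?] e0 /= a b c d; apply: e0; rewrite a b c d bin0.
Qed.

Lemma no_zero_composites (D : F3 -> F3) : rewriting_map D -> obeys_flags false true false D ->
  ~ has_zero_composites (combined R R D).
Proof.
move=> rD fD [mu [nu []]]; have [e ->] := bin_surj mu; have [e' ->] := bin_surj nu => e0 e'0 z.
rewrite bin_relabel => z'; have e'1 : e' <> 0 by move=> h; apply: e'0; rewrite h bin0.
have [_ + + +] := zero_comp1_coords rD fD z e'1; have [_ + _ _] := zero_comp1_coords rD fD z' e'1.
by case: e e0 {z z'} => -[? ?] [? ?] e0 /= a b c d; apply: e0; rewrite a b c d bin0.
Qed.

Lemma has_zero_compositeP (a : rules) (D : F3 -> F3) : rewriting_map D -> obeys a D ->
  has_zero_composite (combined R R D) <-> class_of a <> ns_poisson_class.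
Proof.
move=> rD oD; split=> [h ca|ca].
  have [D' [rD' fD']] := obeys_flags_exists K true true false.
  apply: (no_zero_composite rD' fD').
  by apply/(iso_zero_composite (class_iso rD oD rD' (a' := rule_d) fD' ca)).1.
(* Outside the class of (d) there is a representative whose left rule has right-hand side 0; for it
   * and o give a zero composite, which the isomorphism transports. *)
have [a' [ca' fa']] : exists a', class_of a' = class_of a /\ (flags_of a').1.1 = false.
  by move: ca; case: (a) => //; [exists rule_a|exists rule_b..].
have [D' [rD' fD']] := obeys_flags_exists K (flags_of a').1.1 (flags_of a').1.2 (flags_of a').2.
have oD' : obeys a' D' by rewrite obeysE.
apply/(iso_zero_composite (class_iso rD oD rD' oD' (esym ca'))).1.
have [b0 c0] := bin_bul_cir_neq0 rD' fD'.
exists (bin _ (bul K)), (bin _ (cir K)); split=> //.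
by move: fD'; rewrite fa' => /comp1_bul_cir.
Qed.

Lemma has_zero_compositesP (a : rules) (D : F3 -> F3) : rewriting_map D -> obeys a D ->
  has_zero_composites (combined R R D) <-> class_of a = trivial_class.
Proof.
move=> rD oD; split=> [h|ca].
  case ca: (class_of a) => //.
    have [D' [rD' fD']] := obeys_flags_exists K false true false.
    case: (no_zero_composites rD' fD').
    by apply/(iso_zero_composite (class_iso rD oD rD' (a' := rule_b) fD' ca)).2.
  have [mu [nu [m0 n0 z _]]] := h.
  have : has_zero_composite (combined R R D) by exists mu, nu.
  by move/(has_zero_compositeP rD oD).
have {ca} ea : a = rule_a by move: ca; case: (a).
move: oD; rewrite ea obeysE => fD.
have [b0 c0] := bin_bul_cir_neq0 rD fD.
exists (bin _ (bul K)), (bin _ (cir K)); split=> //; first exact: (comp1_bul_cir fD).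
by rewrite bin_relabel (comp1_bul_op_cir fD).
Qed.

(** The two invariants take the values yes and yes on the trivial class, yes and no on the truncated
    one, no and no on the third, so they separate the three classes. *)
Lemma iso_class (a a' : rules) (D D' : F3 -> F3) :
  rewriting_map D -> obeys a D -> rewriting_map D' -> obeys a' D' ->
  ass_laws_iso D D' -> class_of a = class_of a'.
Proof.
move=> rD oD rD' oD' /iso_zero_composite.
rewrite (has_zero_compositeP rD oD) (has_zero_compositesP rD oD).
rewrite (has_zero_compositeP rD' oD') (has_zero_compositesP rD' oD').
case: (class_of a); case: (class_of a') => -[[h1 h2] [h3 h4]] //.
- by have := h3 erefl.
- by have := h3 erefl.
- by have := h4 erefl.
- by case: h1.
- by have := h4 erefl.
by case: h2.
Qed.

End Classes.

Theorem theorem3p4 (K : fieldType) (charK : ([pchar K]%R : nat_pred) =i pred0) :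
  [/\ (* each system of rules determines a distributive law *)
      forall r : rules,
        (exists D : free_operad (ass2_gen K) 'I_3 -> free_operad (ass2_gen K) 'I_3,
           rewriting_map D /\ obeys r D) /\
        (forall D : free_operad (ass2_gen K) 'I_3 -> free_operad (ass2_gen K) 'I_3,
           rewriting_map D -> obeys r D -> ass_law D),
      (* every distributive law is isomorphic to one of these *)
      forall D : free_operad (ass2_gen K) 'I_3 -> free_operad (ass2_gen K) 'I_3,
        ass_law D ->
        exists (r : rules)
          (D' : free_operad (ass2_gen K) 'I_3 -> free_operad (ass2_gen K) 'I_3),
          [/\ ass_law D', obeys r D' & ass_laws_iso D D']
    & (* two of them are isomorphic exactly when they are in the same class *)
      forall (r r' : rules)
        (D D' : free_operad (ass2_gen K) 'I_3 -> free_operad (ass2_gen K) 'I_3),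
        ass_law D -> obeys r D -> ass_law D' -> obeys r' D' ->
        (ass_laws_iso D D' <-> class_of r = class_of r')].
Proof.
split=> [r|D lD|r r' D D' [rD _] oD [rD' _] oD'].
- split=> [|D rD]; rewrite ?obeysE; last exact: obeys_flags_law.
  by have [D oD] := obeys_flags_exists K (flags_of r).1.1 (flags_of r).1.2 (flags_of r).2; exists D; rewrite obeysE.
(* Every law already obeys one of the systems, so [D] itself serves as [D']. *)
- have [r oD] := law_obeys charK lD; exists r, D; split=> //.
  by have [rD _] := lD; exact: (class_iso rD oD rD oD erefl).
split; first exact: (iso_class rD oD rD' oD').
exact: (class_iso rD oD rD' oD').
Qed.
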